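(* Assume Condition C holds and the walk is transient to the right, $X_n\to+\infty$ (i.e. $\xi_n\to+\infty$) $\mathbb{P}^\mu$-a.s., where the initial distribution is $P_\omega^\mu(\xi_0=0,\,Y_0=i)=\mu_\omega(i)=\mathbf{y}_{-1}(i)$, $i\in\mathscr{D}$, for $P$-a.e. $\omega$. Assume in addition that $v_p>0$. Then, $\mathbb{P}^\mu$-a.s., $$\lim_{n\to\infty}\frac{\xi_n}{n}=\frac{1}{E\Big(\mathbf{y}_{-1}\big(u_0+A_0u_{-1}+\cdots+A_0A_{-1}\cdots A_{-k}u_{-k-1}+\cdots\big)\Big)}.$$
   Context: Environment. Fix an integer $d\ge1$, $\mathscr{D}=\{1,\dots,d\}$. $(P_n,Q_n,R_n)_{n\in\mathbb{Z}}$ is a strictly stationary ergodic sequence of triples of $d\times d$ matrices with non-negative entries such that $P_n+Q_n+R_n$ is stochastic for every $n$. $\Omega$ is the space of all sequences $\omega=(\omega_n)=((P_n,Q_n,R_n))_{n\in\mathbb{Z}}$ of such triples, $\mathscr{F}$ its natural $\sigma$-algebra, $P$ the law of the sequence, $E$ its expectation, and $\theta$ the shift, $(\theta\omega)_n=\omega_{n+1}$. $I$ is the identity matrix, $\mathbf{1}$ is the all-ones column vector, and $\|A\|=\max_i\sum_j|a(i,j)|$ for a matrix $A=(a(i,j))$. Walk. Given $\omega$ and a family $\mu=(\mu_\omega)$ of probability (row) vectors on $\mathscr{D}$, the quenched law $P_\omega^\mu$ is that of the time-homogeneous Markov chain $X_n=(\xi_n,Y_n)$, $n\ge0$, on $S=\mathbb{Z}\times\mathscr{D}$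 with $\xi_0=0$, $Y_0\sim\mu_\omega$, which from $(n,i)$ moves to $(n+1,j)$ with probability $P_n(i,j)$, to $(n,j)$ with probability $R_n(i,j)$, and to $(n-1,j)$ with probability $Q_n(i,j)$. The annealed law is $\mathbb{P}^\mu(F\times G)=\int_F P_\omega^\mu(G)\,P(d\omega)$, with expectation $\mathbb{E}^\mu$. The layer $n$ is $L_n=\{(n,j):1\le j\le d\}$, $T_1=\inf\{t\ge0: X_t\in L_1\}$, and $v_p=1/\mathbb{E}^\mu T_1$ with $\mu_\omega=\mathbf{y}_{-1}$ (so $v_p>0$ means $\mathbb{E}^\mu T_1<\infty$). Condition C. (C1) $(\Omega,\mathscr{F},P,\theta)$ is ergodic. (C2) $E\log(1-\|R_n+P_n\|)^{-1}<\infty$ and $E\log(1-\|R_n+Q_n\|)^{-1}<\infty$. (C3) For all $j\in\mathscr{D}$ and all $n$, $\sum_{i=1}^dQ_n(i,j)>0$ and $\sum_{i=1}^dP_n(i,j)>0$, $P$-a.s. (C4) With positive $P$-probability, the layer $0$ is in one communication class of the chain. Matrices. Under Condition C, $(\zeta_n)_{n\in\mathbb{Z}}$ denotes the ($P$-a.s. unique) sequence of stochastic $d\times d$ matrices satisfying $\zeta_n=(I-Q_n\zeta_{n-1}-R_n)^{-1}P_n$ for all $n\in\mathbb{Z}$, and $$A_n:=(I-Q_n\zeta_{n-1}-R_n)^{-1}Q_n,\qquad u_n:=(I-Q_n\zeta_{n-1}-R_n)^{-1}\mathbf{1}.$$ Standing assumption: $\lambda^+:=\lim_{n\to\infty}\frac1n\log\|A_nA_{n-1}\cdots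 A_1\|<0$; under Condition C this is known to be equivalent to transience to the right. Vectors $\mathbf{y}_n$. $\mathbf{y}_n:=\lim_{a\to-\infty}\mathbf{u}_a\zeta_a\zeta_{a+1}\cdots\zeta_n$, where $(\mathbf{u}_a)$ is any sequence of probability row vectors on $\mathscr{D}$; under Condition C the limit is known to exist $P$-a.s., does not depend on $(\mathbf{u}_a)$, and $(\mathbf{y}_n)$ is the unique sequence of probability vectors with $\mathbf{y}_n=\mathbf{y}_{n-1}\zeta_n$ for all $n$; it is stationary with strictly positive entries. *)

(* Defs.v *)
From HB Require Import structures.
From mathcomp Require Import all_boot all_order all_algebra.
From mathcomp Require Import all_classical all_reals all_analysis.
Set Implicit Arguments.
Unset Strict Implicit.
Unset Printing Implicit Defensive.
Import Order.TTheory GRing.Theory Num.Theory.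
Import numFieldNormedType.Exports.
Local Open Scope classical_set_scope.
Local Open Scope ring_scope.

(* Throughout, the parameter d stands for "number of states per layer, minus
   one": a layer is 'I_d.+1 and matrices are 'M_d.+1, so that the strip has
   width at least 1. *)

Definition mxnonneg (R : realType) (m n : nat) (A : 'M[R]_(m, n)) : bool :=
  [forall i, forall j, 0 <= A i j].

Definition stochastic (R : realType) (m n : nat) (A : 'M[R]_(m, n)) : bool :=
  mxnonneg A && [forall i, \sum_j A i j == 1].

Definition probvec (R : realType) (d : nat) (v : 'rV[R]_d.+1) : bool :=
  stochastic v.

Definition mxrownorm (R : realType) (m n : nat) (A : 'M[R]_(m, n)) : R :=
  \big[Num.max/0]_i \sum_j `|A i j|.

(* Triples are ordered as (P, Q, R). *)
Definition is_triple (R : realType) (d : nat)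
    (t : 'M[R]_d.+1 * 'M[R]_d.+1 * 'M[R]_d.+1) : bool :=
  [&& mxnonneg t.1.1, mxnonneg t.1.2, mxnonneg t.2
    & stochastic (t.1.1 + t.1.2 + t.2)].

Definition triple (R : realType) (d : nat) :=
  {t : 'M[R]_d.+1 * 'M[R]_d.+1 * 'M[R]_d.+1 | is_triple t}.

Lemma is_triple1 (R : realType) (d : nat) :
  is_triple ((1%:M, 0, 0) : 'M[R]_d.+1 * 'M[R]_d.+1 * 'M[R]_d.+1).
Proof.
have nn1 : mxnonneg (1%:M : 'M[R]_d.+1).
  by apply/forallP => i; apply/forallP => j; rewrite mxE ler0n.
have nn0 : mxnonneg (0 : 'M[R]_d.+1).
  by apply/forallP => i; apply/forallP => j; rewrite mxE.
rewrite /is_triple /stochastic /= !addr0 nn1 nn0 /=.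
apply/forallP => i; rewrite (bigD1 i) //= big1 ?addr0 ?mxE ?eqxx //.
by move=> j ji; rewrite mxE eq_sym (negbTE ji).
Qed.

HB.instance Definition _ (R : realType) (d : nat) := Choice.on (triple R d).
HB.instance Definition _ (R : realType) (d : nat) :=
  isPointed.Build (triple R d) (exist (fun t => is_triple t) _ (is_triple1 R d)).

Definition matP (R : realType) (d : nat) (w : int -> triple R d) (n : int) :
  'M[R]_d.+1 := (val (w n)).1.1.
Definition matQ (R : realType) (d : nat) (w : int -> triple R d) (n : int) :
  'M[R]_d.+1 := (val (w n)).1.2.
Definition matR (R : realType) (d : nat) (w : int -> triple R d) (n : int) :
  'M[R]_d.+1 := (val (w n)).2.

Definition env_cylinders (R : realType) (d : nat) :
    set (set (int -> triple R d)) :=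
  [set A | exists n i j (B : set R), measurable B /\
    [\/ A = [set w | B (matP w n i j)],
        A = [set w | B (matQ w n i j)]
      | A = [set w | B (matR w n i j)]]].

Definition env (R : realType) (d : nat) :=
  g_sigma_algebraType (@env_cylinders R d).

Definition shift (R : realType) (d : nat) (w : env R d) : env R d :=
  fun n => w (n + 1).

Definition state (d : nat) : Type := (int * 'I_d.+1)%type.
HB.instance Definition _ (d : nat) := Choice.on (state d).
HB.instance Definition _ (d : nat) :=
  isPointed.Build (state d) (0 : int, ord0 : 'I_d.+1).

Definition path_cylinders (d : nat) : set (set (nat -> state d)) :=
  [set A | exists t s, A = [set x | x t = s]].

Definition paths (d : nat) := g_sigma_algebraType (@path_cylinders d).

Definition xi (d : nat) (x : paths d) (t : nat) : int := (x t).1.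

Definition trans (R : realType) (d : nat) (w : env R d) (a b : state d) : R :=
  if b.1 == a.1 + 1 then matP w a.1 a.2 b.2
  else if b.1 == a.1 then matR w a.1 a.2 b.2
  else if b.1 == a.1 - 1 then matQ w a.1 a.2 b.2
  else 0.

Definition init (R : realType) (d : nat) (m : 'rV[R]_d.+1) (a : state d) : R :=
  if a.1 == 0 then m 0 a.2 else 0.

Definition is_quenched_law (R : realType) (d : nat) (w : env R d)
    (m : 'rV[R]_d.+1) (Pw : set (paths d) -> \bar R) : Prop :=
  forall (n : nat) (s : nat -> state d),
    Pw [set x | forall k, (k <= n)%N -> x k = s k] =
    (init m (s 0%N) * \prod_(k < n) trans w (s k) (s k.+1))%:E.

(* On rectangles, annealed P K (F `*` G) is the integral over F of K w G:
   see annealed_rect. *)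
Definition annealed (R : realType) (d : nat) (P : probability (env R d) R)
    (K : R.-pker env R d ~> paths d) (A : set (env R d * paths d)) : \bar R :=
  (\int[P]_w K w (xsection A w))%E.

Section annealed_measure.
Context (R : realType) (d : nat) (P : probability (env R d) R)
  (K : R.-pker env R d ~> paths d).
Local Open Scope ereal_scope.

Let annealed0 : annealed P K set0 = 0.
Proof.
by rewrite /annealed integral0_eq// => w _; rewrite xsection0 measure0.
Qed.

Let annealed_ge0 A : 0 <= annealed P K A.
Proof. by apply: integral_ge0 => w _. Qed.

Let annealed_sigma_additive : semi_sigma_additive (annealed P K).
Proof.
move=> F mF tF mUF.
have -> : annealed P K (\bigcup_n F n) = \sum_(0 <= n <oo) annealed P K (F n).
  rewrite /annealed -integral_nneseries//.
  - apply: eq_integral => w _; rewrite xsection_bigcup.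
    apply: measure_semi_bigcup => //.
    + by move=> n; exact: measurable_xsection.
    + exact: trivIset_xsection.
    + by apply: bigcup_measurable => n _; exact: measurable_xsection.
  - by move=> n; apply: measurable_fun_xsection_finite_kernel; rewrite inE.
exact: is_cvg_nneseries.
Qed.

HB.instance Definition _ := isMeasure.Build _ _ _ (annealed P K)
  annealed0 annealed_ge0 annealed_sigma_additive.

Let annealed_setT : annealed P K setT = 1.
Proof.
rewrite /annealed (eq_integral (cst 1)).
  by rewrite integral_cst// mul1e; exact: probability_setT.
move=> w _; rewrite (_ : xsection setT w = setT) ?prob_kernel//.
by apply/seteqP; split => // x _; rewrite /xsection/= inE.
Qed.

HB.instance Definition _ := Measure_isProbability.Build _ _ _ (annealed P K)
  annealed_setT.

Lemma annealed_rect (F : set (env R d)) (G : set (paths d)) :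
  measurable F -> measurable G ->
  annealed P K (F `*` G) = \int[P]_(w in F) K w G.
Proof.
move=> mF mG; rewrite /annealed [RHS]integral_mkcond.
apply: eq_integral => w _; rewrite patchE; case: ifPn => wF.
- by rewrite in_xsectionX.
- by rewrite notin_xsectionX ?measure0.
Qed.

End annealed_measure.

Definition stationary (R : realType) (d : nat) (P : probability (env R d) R) :
    Prop :=
  forall A, measurable A -> P (@shift R d @^-1` A) = P A.

Definition ergodic (R : realType) (d : nat) (P : probability (env R d) R) :
    Prop :=
  forall A, measurable A -> @shift R d @^-1` A = A ->
    P A = 0%E \/ P A = 1%E.

Definition reachable (R : realType) (d : nat) (w : env R d) (a b : state d) :
    Prop :=
  exists p : seq (state d),
    path (fun x y => 0 < trans w x y) a p /\ last a p = b.

Definition one_class (R : realType) (d : nat) (w : env R d) (n : int) : Prop :=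
  forall i j : 'I_d.+1, reachable w (n, i) (n, j).

(* In the second clause the logarithm is the extended one and 0^-1 = +oo, so
   integrability forces both norms to be < 1 almost surely. *)
Definition conditionC (R : realType) (d : nat) (P : probability (env R d) R) :
    Prop :=
  [/\ ergodic P,
      forall n : int,
        (\int[P]_w lne ((1 - mxrownorm (matR w n + matP w n))%:E^-1) < +oo)%E /\
        (\int[P]_w lne ((1 - mxrownorm (matR w n + matQ w n))%:E^-1) < +oo)%E,
      {ae P, forall w, forall (n : int) (j : 'I_d.+1),
        0 < \sum_i matQ w n i j /\ 0 < \sum_i matP w n i j}
    & (0 < P [set w | one_class w 0])%E].

Section matrices.
Context (R : realType) (d : nat) (w : env R d) (z : int -> 'M[R]_d.+1).

Definition resolvent_arg (n : int) : 'M[R]_d.+1 :=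
  1%:M - matQ w n *m z (n - 1) - matR w n.

Definition is_zeta : Prop := forall n : int,
  [/\ stochastic (z n), resolvent_arg n \in unitmx
    & z n = invmx (resolvent_arg n) *m matP w n].

Definition matA (n : int) : 'M[R]_d.+1 := invmx (resolvent_arg n) *m matQ w n.

Definition vecu (n : int) : 'cV[R]_d.+1 :=
  invmx (resolvent_arg n) *m const_mx 1.

(* A_n A_(n-1) ... A_1 *)
Definition prodA_down (n : nat) : 'M[R]_d.+1 :=
  \prod_(i < n) matA (n%:Z - i%:Z).

(* A_0 A_(-1) ... A_(-k+1) *)
Definition prodA_past (k : nat) : 'M[R]_d.+1 :=
  \prod_(i < k) matA (- i%:Z).

(* The limit, as a = n - k tends to -oo, of v_a zeta_a ... zeta_n, taken
   entrywise. *)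
Definition vecy (v : int -> 'rV[R]_d.+1) (n : int) : 'rV[R]_d.+1 :=
  \row_j limn (fun k : nat =>
    (v (n - k%:Z) *m (\prod_(i < k.+1) z (n - k%:Z + i%:Z))) 0 j).

(* y_(-1) (u_0 + A_0 u_(-1) + A_0 A_(-1) u_(-2) + ...); the series has
   nonnegative entries (when is_zeta holds) and is summed in \bar R. *)
Definition y_series (v : int -> 'rV[R]_d.+1) : \bar R :=
  (\sum_(j < d.+1) (vecy v (-1) 0 j)%:E *
     \sum_(0 <= k <oo) ((prodA_past k *m vecu (- k%:Z)) j 0)%:E)%E.

End matrices.

(* The limit is taken in \bar R, with lne 0 = -oo. *)
Definition lyapunov_neg (R : realType) (d : nat) (P : probability (env R d) R)
    (zeta : env R d -> int -> 'M[R]_d.+1) : Prop :=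
  exists2 lambda : \bar R, (lambda < 0)%E &
    {ae P, forall w,
      (fun n : nat =>
        (n%:R^-1)%:E * lne (mxrownorm (prodA_down w (zeta w) n))%:E)%E @ \oo
      --> lambda}.

(* T_1, with value +oo if layer 1 is never visited. *)
Definition hit1 (R : realType) (d : nat) (x : paths d) : \bar R :=
  ereal_inf [set t%:R%:E | t in [set t : nat | xi x t = 1]].

(* v_p = 1 / E T_1, with 1 / +oo = 0. *)
Definition speed (R : realType) (d : nat) (P : probability (env R d) R)
    (K : R.-pker env R d ~> paths d) : \bar R :=
  ((\int[annealed P K]_z hit1 R z.2)^-1)%E.

Definition transient_right (R : realType) (d : nat)
    (P : probability (env R d) R) (K : R.-pker env R d ~> paths d) : Prop :=
  {ae annealed P K, forall z, ((xi z.2 n)%:~R : R) @[n --> \oo] --> +oo}.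

(* Main.v *)
Require Import Defs.
From mathcomp Require Import all_boot all_order all_algebra.
From mathcomp Require Import all_classical all_reals all_analysis.
From mathcomp Require Import measurable_realfun.
From mathcomp Require Import ring lra zify.
Set Implicit Arguments.
Unset Strict Implicit.
Unset Printing Implicit Defensive.
Import Order.TTheory GRing.Theory Num.Theory.
Import numFieldNormedType.Exports.
Local Open Scope classical_set_scope.
Local Open Scope ring_scope.

(** The walk crosses the layers 1, 2, 3, ... one after the other. If T_n is the
    time of the first visit to layer n and E is the annealed mean of T_1, then
    T_n / n tends to E: the crossing durations T_(n+1) - T_n form a stationary
    sequence, and the asymptotic behaviour of the walk is governed by a zero-one
    law. Since steps have size at most one, T_n / n -> E gives xi_n / n -> 1 / E.
    It remains to identify E with the mean of the series. The ingredients: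

    - Loss of memory. Products zeta_a ... zeta_(m-1) dominate the probabilities
      to hit layer m at given points ([hit_prob_le_zeta_hit]). If layer 0 is one
      communication class, some such product has entries bounded below
      ([one_class_uniform_hit]), and by ergodicity almost every environment
      contains infinitely many such blocks in both directions ([recurrent_ae]).
      Hence long products of the zeta_n contract; the vectors y_n exist, are
      positive and satisfy y_n = y_(n-1) zeta_n ([vecy_cvg], [vecy_gt0],
      [vecy_succ]).

    - Mean crossing times. When E is finite, the mean e_n(i) of the time needed
      to go from (n,i) to layer n + 1 is finite. It satisfies
      e_n >= u_n + A_n e_(n-1), so it dominates the series
      s_n = u_n + A_n u_(n-1) + ...; conversely the functions built from s and
      zeta solve the equation of mean hitting times, of which the true means are
      the least nonnegative solution. So e_n = s_n
      ([trunc_time_cvg_uA_series]), and averaging over y_(-1) gives E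
      ([integral_y_series]). Finiteness also shows that every layer on the right
      is reached almost surely, so that zeta_a ... zeta_(m-1) is the hitting
      distribution of layer m ([hit_prob_cvg_zeta_hit]).

    - Stationarity. Cut a path at its first visit to layer 1 and move that layer
      to the origin. Because y_(-1) zeta_0 = y_0, the quenched law becomes that
      of the shifted environment ([restart_law]), so the annealed law is
      invariant under the simultaneous shift and cut ([advance_preserving]).

    - Zero-one law. If a path event does not change when the path is recentred
      at a later time, its probability as a function of the starting state is
      bounded and harmonic on the strip, hence constant ([harmonic_const]). The
      event is then independent of every finite piece of the path, so of itself,
      and ergodicity of the environment makes its annealed probability 0 or 1
      ([invariant_zero_one]).

    - The law of large numbers. If xi ran ahead of the line t / c with c < E,
      or its running maximum fell behind that line with c > E, with positive
      probability, this would happen almost surely, and the maximal ergodic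
      lemma ([maximal_ergodic]) applied to c - T_1, or T_1 - c, would contradict
      the value of E ([ae_not_fast], [ae_not_slow]). Away from these events
      xi_n / n -> 1 / E is elementary ([speed_limit]). *)

(** * Contraction by products of stochastic matrices *)

Section stochastic_matrices.
Context (R : realType) (d : nat).
Implicit Types (A B : 'M[R]_d.+1) (u v : 'rV[R]_d.+1) (f : 'cV[R]_d.+1).

Lemma stochasticP m (A : 'M[R]_(m, d.+1)) :
  stochastic A <-> (forall i j, 0 <= A i j) /\ (forall i, \sum_j A i j = 1).
Proof.
split=> [/andP[/forallP A0 /forallP A1]|[A0 A1]].
  by split=> [i|i]; [exact/forallP/A0|exact/eqP/A1].
by apply/andP; split; apply/forallP => i; [apply/forallP|apply/eqP].
Qed.

Lemma stochasticM m (A : 'M[R]_(m, d.+1)) B :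
  stochastic A -> stochastic B -> stochastic (A *m B).
Proof.
move=> /stochasticP[A0 A1] /stochasticP[B0 B1]; apply/stochasticP; split=> [i j|i].
  by rewrite mxE sumr_ge0// => k _; rewrite mulr_ge0.
under eq_bigr do rewrite mxE.
rewrite exchange_big/= -[RHS](A1 i); apply: eq_bigr => k _.
by rewrite -mulr_sumr B1 mulr1.
Qed.

Lemma stochastic1 : stochastic (1 : 'M[R]_d.+1).
Proof.
apply/stochasticP; split=> [i j|i]; first by rewrite mxE ler0n.
rewrite (bigD1 i)//= mxE eqxx big1 ?addr0// => j ji.
by rewrite mxE eq_sym (negbTE ji).
Qed.

(** The oscillation seminorm is used instead of a norm: constant vectors are fixed
    by stochastic matrices, and only their complement can contract. *)
Definition contracting (c : R) B : Prop :=
  forall f l, (forall i i', f i 0 - f i' 0 <= l) ->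
  forall i i', (B *m f) i 0 - (B *m f) i' 0 <= c * l.

Lemma contractingM c e A B :
  contracting c A -> contracting e B -> contracting (c * e) (A *m B).
Proof. by move=> cA eB f l fl i i'; rewrite -mulmxA -mulrA; apply/cA/eB. Qed.

(** Subtract from f its minimum, attained at j0: every row gives weight at least
    dl to the coordinate where the shifted f vanishes. *)
Lemma doeblin_contracting (dl : R) B : stochastic B -> 0 <= dl ->
  (forall i j, dl <= B i j) -> contracting (1 - dl) B.
Proof.
move=> sB dl0 Bdl f l fl i i'; have [B0 B1] := (stochasticP _).1 sB.
pose j0 := [arg min_(j < ord0) f j 0]%O.
have fj0 k : f j0 0 <= f k 0 by rewrite /j0; case: arg_minP => // j _; exact.
have E k : (B *m f) k 0 = f j0 0 + \sum_j B k j * (f j 0 - f j0 0).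
  rewrite mxE; under [X in _ = _ + X]eq_bigr do rewrite mulrBr.
  by rewrite sumrB -mulr_suml B1 mul1r addrC subrK.
rewrite !E opprD addrACA subrr add0r.
have l0 : 0 <= l by have := fl j0 j0; rewrite subrr.
rewrite -[leRHS]subr0 lerB//; last first.
  by rewrite sumr_ge0// => j _; rewrite mulr_ge0// subr_ge0.
rewrite (bigD1 j0)//= subrr mulr0 add0r.
apply: (@le_trans _ _ ((\sum_(j | j != j0) B i j) * l)).
  by rewrite mulr_suml; apply: ler_sum => j _; rewrite ler_wpM2l.
have := B1 i; rewrite (bigD1 j0)//= => H.
by rewrite ler_wpM2r// lerBrDl -H lerD2r.
Qed.

Lemma stochastic_contracting B : stochastic B -> contracting 1 B.
Proof.
move=> sB; rewrite -[1]subr0; apply: doeblin_contracting => // i j.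
by case/stochasticP: sB.
Qed.

Lemma contracting_le c e B : c <= e -> contracting c B -> contracting e B.
Proof.
move=> ce cB f l fl i i'; apply: (le_trans (cB _ _ fl _ _)).
by rewrite ler_wpM2r//; have := fl ord0 ord0; rewrite subrr.
Qed.

Lemma contracting_entry c B i i' j : contracting c B -> B i j - B i' j <= c.
Proof.
move=> cB; have := cB (delta_mx j 0) 1 _ i i'; rewrite mulr1 -colE !mxE; apply.
by move=> k k'; rewrite !mxE; case: (_ && _); case: (_ && _); rewrite ?subrr ?subr0 ?sub0r ?lerN10.
Qed.

(** Write both sides as averages over pairs of rows, so that only differences of two
    rows of B occur. *)
Lemma probvec_contracting c B u v j : stochastic u -> stochastic v ->
  contracting c B -> (u *m B) 0 j - (v *m B) 0 j <= c.
Proof.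
move=> /stochasticP[u0 u1] /stochasticP[v0 v1] cB; rewrite !mxE.
have -> : \sum_k u 0 k * B k j - \sum_k v 0 k * B k j =
          \sum_k \sum_k' u 0 k * v 0 k' * (B k j - B k' j).
  under [RHS]eq_bigr do (under eq_bigr do rewrite mulrBr); 
  under [RHS]eq_bigr do rewrite sumrB; rewrite sumrB; congr (_ - _).
    apply: eq_bigr => k _; rewrite -mulr_suml -mulr_sumr.
    by rewrite v1 mulr1.
  rewrite exchange_big; apply: eq_bigr => k _ /=; rewrite -!mulr_suml.
  by rewrite u1 mul1r.
apply: (@le_trans _ _ (\sum_k \sum_k' u 0 k * v 0 k' * c)).
  apply: ler_sum => k _; apply: ler_sum => k' _.
  by rewrite ler_wpM2l ?mulr_ge0//; apply: contracting_entry.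
under eq_bigr do rewrite -mulr_suml -mulr_sumr v1 mulr1.
by rewrite -mulr_suml u1 mul1r.
Qed.

End stochastic_matrices.

Section interval_products.
Context (R : realType) (d : nat) (z : int -> 'M[R]_d.+1).

Definition iprod (a : int) (k : nat) : 'M[R]_d.+1 := \prod_(i < k) z (a + i%:Z).

Lemma iprod0 a : iprod a 0 = 1.
Proof. by rewrite /iprod big_ord0. Qed.

Lemma iprodS a k : iprod a k.+1 = z a *m iprod (a + 1) k.
Proof.
rewrite /iprod big_ord_recl/= addr0; congr (_ * _).
by apply: eq_bigr => i _; rewrite /bump/= -addrA; congr (z (_ + _)); rewrite PoszD.
Qed.

Lemma iprod1 a : iprod a 1 = z a.
Proof. by rewrite iprodS iprod0 mulmx1. Qed.

Lemma iprodD a k l : iprod a (k + l) = iprod a k *m iprod (a + k%:Z) l.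
Proof.
elim: k a => [|k IH] a; first by rewrite iprod0 mul1mx addr0.
by rewrite addSn !iprodS IH mulmxA -addrA.
Qed.

Lemma iprodSr a k : iprod a k.+1 = iprod a k *m z (a + k%:Z).
Proof. by rewrite -[X in iprod a X]addn1 iprodD iprod1. Qed.

Hypothesis zst : forall n, stochastic (z n).

Lemma stochastic_iprod a k : stochastic (iprod a k).
Proof.
elim: k a => [|k IH] a; first by rewrite iprod0 stochastic1.
by rewrite iprodS stochasticM.
Qed.

Definition block (dl : R) (M : nat) (a : int) := forall i j, dl <= iprod a M i j.

(** Each block multiplies the contraction factor by 1 - dl, and the stochastic
    factors between blocks do not increase it. *)
Lemma contracting_future (dl : R) M : 0 <= dl <= 1 ->
  (forall a, exists n : nat, block dl M (a + n%:Z)) ->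
  forall r a, exists k0, forall k, (k0 <= k)%N ->
    contracting ((1 - dl) ^+ r) (iprod a k).
Proof.
move=> /andP[dl0 dl1] H; elim=> [|r IH] a.
  by exists 0%N => k _; rewrite expr0; apply/stochastic_contracting/stochastic_iprod.
have [k0 Hk0] := IH a.
have [n Hn] := H (a + k0%:Z).
exists (k0 + n + M)%N => k hk; rewrite -(subnKC hk).
rewrite exprSr iprodD -[_ * _]mulr1; apply: contractingM; last first.
  exact/stochastic_contracting/stochastic_iprod.
rewrite iprodD; apply: contractingM; first by apply: Hk0; rewrite leq_addr.
apply: doeblin_contracting => //; first exact: stochastic_iprod.
by rewrite PoszD addrA.
Qed.

Lemma contracting_past (dl : R) M : 0 <= dl <= 1 ->
  (forall a, exists n : nat, block dl M (a - n%:Z)) ->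
  forall r b, exists k0, forall k, (k0 <= k)%N ->
    contracting ((1 - dl) ^+ r) (iprod (b - k%:Z) k).
Proof.
move=> /andP[dl0 dl1] H; elim=> [|r IH] b.
  by exists 0%N => k _; rewrite expr0; apply/stochastic_contracting/stochastic_iprod.
have [k0 Hk0] := IH b.
have [n Hn] := H (b - k0%:Z - M%:Z).
exists (M + (n + k0))%N => k hk.
rewrite -(subnK hk) iprodD -[_ ^+ _]mul1r; apply: contractingM.
  exact/stochastic_contracting/stochastic_iprod.
rewrite iprodD exprS; apply: contractingM; last first.
  rewrite (_ : _ + _ + _ = b - (n + k0)%:Z).
    by apply: Hk0; rewrite leq_addl.
  by rewrite !PoszD; ring.
apply: doeblin_contracting => //; first exact: stochastic_iprod.
by move: Hn; rewrite (_ : b - _ - _ - _ =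
  b - (k - (M + (n + k0)) + (M + (n + k0)))%N%:Z +
    (k - (M + (n + k0)))%N%:Z)// !PoszD; ring.
Qed.

End interval_products.

Lemma cvg_sumr (R : realType) (I : finType) (F : nat -> I -> R) (l : I -> R) :
  (forall i, F n i @[n --> \oo] --> l i) ->
  \sum_i F n i @[n --> \oo] --> \sum_i l i.
Proof.
by move=> Fl; apply: cvg_big => [|i _]; [exact: add_continuous|exact: Fl].
Qed.

(** * Stopped walks on the strip *)

Section walk.
Context (R : realType) (d : nat) (w : int -> triple R d).
Implicit Types (a b : state d) (f g : state d -> R) (n m : int).

Lemma matP_ge0 n i j : 0 <= matP w n i j.
Proof. by have /and4P[/forallP/(_ i)/forallP/(_ j)] := valP (w n). Qed.

Lemma matQ_ge0 n i j : 0 <= matQ w n i j.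
Proof. by have /and4P[_ /forallP/(_ i)/forallP/(_ j)] := valP (w n). Qed.

Lemma matR_ge0 n i j : 0 <= matR w n i j.
Proof. by have /and4P[_ _ /forallP/(_ i)/forallP/(_ j)] := valP (w n). Qed.

Lemma matPQR1 n i : \sum_j (matP w n i j + matR w n i j + matQ w n i j) = 1.
Proof.
have /and4P[_ _ _ /stochasticP[_ H]] := valP (w n).
rewrite -[RHS](H i); apply: eq_bigr => j _.
by rewrite !mxE /matP /matR /matQ addrAC.
Qed.

(** The one-step expectation of f from a; the summation runs over the neighbours
    only, so it is finite. *)
Definition step f a : R :=
  \sum_j (matP w a.1 a.2 j * f (a.1 + 1, j) + matR w a.1 a.2 j * f (a.1, j)
          + matQ w a.1 a.2 j * f (a.1 - 1, j)).

Lemma ler_step f g a :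
  (forall b, b.1 <= a.1 + 1 -> f b <= g b) -> step f a <= step g a.
Proof.
move=> fg; apply: ler_sum => j _.
rewrite !lerD// ler_wpM2l ?fg ?matP_ge0 ?matQ_ge0 ?matR_ge0//=; lia.
Qed.

Lemma eq_step f g a : (forall b, f b = g b) -> step f a = step g a.
Proof. by move=> fg; apply: eq_bigr => j _; rewrite !fg. Qed.

Lemma stepD f g a : step (fun b => f b + g b) a = step f a + step g a.
Proof. by rewrite -big_split; apply: eq_bigr => j _ /=; ring. Qed.

Lemma stepZ c f a : step (fun b => c * f b) a = c * step f a.
Proof. by rewrite mulr_sumr; apply: eq_bigr => j _ /=; ring. Qed.

Lemma step_cst c a : step (fun=> c) a = c.
Proof.
rewrite -[RHS]mul1r -(matPQR1 a.1 a.2) mulr_suml.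
by apply: eq_bigr => j _; ring.
Qed.

Lemma step_sum (I : finType) (F : I -> state d -> R) a :
  step (fun b => \sum_k F k b) a = \sum_k step (F k) a.
Proof.
rewrite exchange_big; apply: eq_bigr => j _ /=.
by rewrite !mulr_sumr -!big_split.
Qed.

(** The expectation of f at time t, or at the first visit to layer m or above if that
    comes earlier. *)
Fixpoint stopped (m : int) f (t : nat) a : R :=
  if t is s.+1 then if a.1 < m then step (stopped m f s) a else f a else f a.

Lemma stopped_ge m f t a : m <= a.1 -> stopped m f t a = f a.
Proof. by case: t => //= t; rewrite ltNge => ->. Qed.

(** Comparison principle: a function that is superharmonic below layer m dominates
    the stopped expectations of any of its minorants. All comparisons below are
    instances of it or repeat its induction. *)
Lemma stopped_le m f g t : (forall a, a.1 <= m -> f a <= g a) ->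
  (forall a, a.1 < m -> step g a <= g a) ->
  forall a, a.1 <= m -> stopped m f t a <= g a.
Proof.
move=> fg gs; elim: t => [|t IH] a am /=; first exact: fg.
case: ifPn => [lt_am|_]; last exact: fg.
apply: (le_trans _ (gs _ lt_am)); apply: ler_step => b ba; apply: IH; lia.
Qed.

Lemma stopped_ge0 m f t a : (forall a, 0 <= f a) -> 0 <= stopped m f t a.
Proof.
move=> f0; elim: t a => [|t IH] a //=; case: ifP => // _.
by rewrite -[leLHS](step_cst 0 a); apply: ler_step.
Qed.

(** The probability that layer m is reached within t steps and first visited at k. *)
Definition hit_prob m (k : 'I_d.+1) := stopped m (fun a => (a == (m, k))%:R).
(** The probability that layer m is not reached within t steps. *)
Definition survival m := stopped m (fun a => ((a.1 < m)%R)%:R).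

Lemma hit_prob_ge0 m k t a : 0 <= hit_prob m k t a.
Proof. by apply: stopped_ge0 => b; rewrite ler0n. Qed.

Lemma survival_ge0 m t a : 0 <= survival m t a.
Proof. by apply: stopped_ge0 => b; rewrite ler0n. Qed.

(** A terminal function that vanishes below layer m is only seen through the hitting
    point of layer m. *)
Lemma stopped_hit_prob m f t a : (forall b, b.1 < m -> f b = 0) -> a.1 <= m ->
  stopped m f t a = \sum_k f (m, k) * hit_prob m k t a.
Proof.
move=> f0.
have B b : b.1 <= m -> f b = \sum_k f (m, k) * (b == (m, k))%:R.
  move=> bm; have [lt_bm|] := ltP b.1 m.
    rewrite f0// big1// => k _; case: eqP => [E|_]; last by rewrite mulr0.
    by move: lt_bm; rewrite E ltxx.
  move=> mb; have E : b = (m, b.2) by case: b bm mb => b1 b2 /= ? ?; congr pair; lia.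
  rewrite (bigD1 b.2)//= -E eqxx mulr1 big1 ?addr0// => k kb.
  by case: eqP => [E'|_]; [move: kb; rewrite E' eqxx|rewrite mulr0].
elim: t a => [|t IH] a am /=; first exact: B.
have [lt_am|ge_am] := ltP a.1 m; last first.
  by rewrite {1}B//; apply: eq_bigr => k _; rewrite /hit_prob /= ltNge ge_am.
rewrite (_ : step _ a = step (fun b => \sum_k f (m, k) * hit_prob m k t b) a).
  by rewrite step_sum; apply: eq_bigr => k _; rewrite stepZ /hit_prob/= lt_am.
by apply: eq_bigr => j _; rewrite !IH//=; lia.
Qed.

Lemma hit_prob_survival m t a : a.1 <= m -> \sum_k hit_prob m k t a = 1 - survival m t a.
Proof.
move=> am; apply/eqP; rewrite eq_sym subr_eq eq_sym; apply/eqP.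
pose f b : R := ((m <= b.1)%R)%:R.
have -> : \sum_k hit_prob m k t a = \sum_k f (m, k) * hit_prob m k t a.
  by apply: eq_bigr => k _; rewrite /f/= lexx mul1r.
rewrite -(stopped_hit_prob _ _ am) => [|b bm]; last by rewrite /f leNgt bm.
rewrite {}/f; elim: t a {am} => [|t IH] a; rewrite /survival/=.
  by rewrite ltNge; case: (m <= a.1); rewrite ?addr0 ?add0r.
case: ifPn => [lt_am|]; last by rewrite ltNge => /negPn ->; rewrite addr0.
by rewrite -stepD -[RHS](step_cst 1 a); apply: eq_step => b; exact: IH.
Qed.

Lemma hit_prob_ndS m k t a : hit_prob m k t a <= hit_prob m k t.+1 a.
Proof.
elim: t a => [|t IH] a /=; rewrite /hit_prob/=.
  case: ifPn => [am|//]; case: eqP => [E|_]; first by move: am; rewrite E ltxx.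
  by rewrite -[leLHS](step_cst 0 a); apply: ler_step => b _; rewrite ler0n.
by case: ifPn => // am; apply: ler_step => b _; exact: IH.
Qed.

Lemma hit_prob_nd m k t s a : (t <= s)%N -> hit_prob m k t a <= hit_prob m k s a.
Proof.
move=> /subnK <-; elim: (s - t)%N => // n IH.
by apply: (le_trans IH); rewrite addSn hit_prob_ndS.
Qed.

Lemma survival_niS m t a : survival m t.+1 a <= survival m t a.
Proof.
elim: t a => [|t IH] a /=; rewrite /survival/=.
  case: (ltP a.1 m) => [am|_]; last by rewrite lexx.
  rewrite -[leRHS](step_cst 1 a).
  by apply: ler_step => b _; rewrite lern1 leq_b1.
by case: (ltP a.1 m) => // am; apply: ler_step => b _; exact: IH.
Qed.

Lemma survival_ni m t s a : (t <= s)%N -> survival m s a <= survival m t a.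
Proof.
move=> /subnK <-; elim: (s - t)%N => // n IH.
by apply: (le_trans _ IH); rewrite addSn survival_niS.
Qed.

(** The expectation of min(T, t), T being the hitting time of layer m: the sum of the
    tail probabilities of T. *)
Definition trunc_time m (t : nat) a : R := \sum_(s < t) survival m s a.

Lemma trunc_time_ge m t a : m <= a.1 -> trunc_time m t a = 0.
Proof. by move=> ma; apply: big1 => s _; rewrite /survival stopped_ge//= ltNge ma. Qed.

Lemma trunc_timeS m t a : a.1 < m -> trunc_time m t.+1 a = 1 + step (trunc_time m t) a.
Proof.
move=> am; rewrite /trunc_time big_ord_recl [survival m _ _]/survival/= am; congr (_ + _).
by rewrite step_sum; apply: eq_bigr => s _; rewrite /survival/= am.
Qed.

Lemma trunc_time_nd m t s a : (t <= s)%N -> trunc_time m t a <= trunc_time m s a.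
Proof.
move=> /subnK <-; rewrite /trunc_time addnC big_split_ord/= lerDl.
by apply: sumr_ge0 => i _; exact: survival_ge0.
Qed.

Lemma survival_trunc_time m t a : t%:R * survival m t a <= trunc_time m t a.
Proof.
rewrite mulr_natl -[in X in _ *+ X](card_ord t) -sumr_const.
by apply: ler_sum => s _; apply: survival_ni; exact: ltnW.
Qed.

(** By monotonicity t times the probability of survival is at most the truncated mean. *)
Lemma survival_cvg0 m a (B : R) : (forall t, trunc_time m t a <= B) ->
  survival m t a @[t --> \oo] --> 0.
Proof.
move=> EB; apply/cvgrPdist_le => /= e e0.
have B0 : 0 <= B by apply: (le_trans _ (EB 0%N)); rewrite /trunc_time big_ord0.
near=> t; rewrite sub0r normrN ger0_norm ?survival_ge0//.
have t0 : 0 < t%:R :> R by rewrite ltr0n; near: t; exists 1%N.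
rewrite -(ler_pM2l t0); apply: (le_trans (survival_trunc_time _ _ _)).
apply: (le_trans (EB t)); rewrite mulrC -ler_pdivrMl// mulrC.
near: t; exact: nbhs_infty_ger.
Unshelve. all: by end_near. Qed.

Lemma trunc_time_ge0 m t a : 0 <= trunc_time m t a.
Proof. by apply: sumr_ge0 => i _; exact: survival_ge0. Qed.

(** One half of the strong Markov property at the first visit to layer n: reaching
    layer n + 1 costs the time to reach n plus the time from there. The truncation
    makes it an inequality. *)
Lemma trunc_time_concat n t s a : a.1 <= n ->
  trunc_time n t a + \sum_k trunc_time (n + 1) s (n, k) * hit_prob n k t a
    <= trunc_time (n + 1) (t + s) a.
Proof.
pose f b := if b.1 < n then 0 else trunc_time (n + 1) s b.
have -> : \sum_k trunc_time (n + 1) s (n, k) * hit_prob n k t a =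
          \sum_k f (n, k) * hit_prob n k t a.
  by apply: eq_bigr => k _; rewrite /f/= ltxx.
move=> an; rewrite -(stopped_hit_prob _ _ an) => [|b bn]; last by rewrite /f bn.
elim: t a an => [|t IH] a an.
  rewrite /trunc_time big_ord0 add0r /= /f; case: ifP => _ //; exact: trunc_time_ge0.
have [lt_an|ge_an] := ltP a.1 n.
  rewrite /= lt_an trunc_timeS// addSn trunc_timeS ?(lt_le_trans lt_an) ?lerDl//.
  rewrite -addrA -stepD lerD2l; apply: ler_step => b ba; apply: IH; lia.
rewrite trunc_time_ge// add0r stopped_ge// /f ltNge ge_an/=.
by apply: trunc_time_nd; rewrite leq_addl.
Qed.

End walk.

(** * Hitting distributions and mean crossing times in terms of zeta *)

Section zeta.
Context (R : realType) (d : nat) (w : int -> triple R d) (z : int -> 'M[R]_d.+1).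
Hypothesis zP : is_zeta w z.
Implicit Types (a b : state d) (n m : int).

Let zst n : stochastic (z n). Proof. by have [] := zP n. Qed.
Let unitD n : resolvent_arg w z n \in unitmx. Proof. by have [] := zP n. Qed.

Let z_ge0 n i j : 0 <= z n i j.
Proof. by have /stochasticP[+ _] := zst n; exact. Qed.

Lemma zeta_eq n :
  z n = matP w n + matR w n *m z n + matQ w n *m (z (n - 1) *m z n).
Proof.
have [_ u E] := zP n.
have : resolvent_arg w z n *m z n = matP w n.
  by rewrite [in LHS]E mulmxA mulmxV// mul1mx.
rewrite /resolvent_arg !mulmxBl mul1mx -mulmxA => /eqP.
by rewrite !subr_eq => /eqP.
Qed.

(** The candidate for the probability of hitting layer m at (m, k), namely the entry
    of zeta_n ... zeta_(m-1), where n is the layer of a. *)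
Definition zeta_hit m (k : 'I_d.+1) a := iprod z a.1 (absz (m - a.1)%R) a.2 k.

Lemma zeta_hit_ge0 m k a : 0 <= zeta_hit m k a.
Proof. by have /stochasticP[+ _] := stochastic_iprod zst a.1 (absz (m - a.1)%R); exact. Qed.

Lemma step_mx (F : int -> 'cV[R]_d.+1) n i :
  step w (fun b => F b.1 b.2 0) (n, i) =
  (matP w n *m F (n + 1) + matR w n *m F n + matQ w n *m F (n - 1)) i 0.
Proof. by rewrite !mxE /step/= !big_split. Qed.

(** The defining equation of zeta, in the form of [zeta_eq], says that products of
    the zeta_n are harmonic below the target layer. *)
Lemma step_zeta_hit m k a : a.1 < m -> step w (zeta_hit m k) a = zeta_hit m k a.
Proof.
case: a => n i /= nm.
pose F (p : int) : 'cV[R]_d.+1 := col k (iprod z p (absz (m - p)%R)).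
rewrite (_ : step _ _ _ = step w (fun b => F b.1 b.2 0) (n, i)); last first.
  by apply: eq_step => b; rewrite /F mxE.
have FS (p : int) : p < m -> F p = z p *m F (p + 1).
  move=> pm; rewrite /F (_ : (absz (m - p)%R) = (absz (m - (p + 1))%R).+1); last lia.
  by rewrite iprodS !colE mulmxA.
rewrite step_mx [F (n - 1)]FS; last lia.
rewrite subrK [F n]FS// !mulmxA -!mulmxDl -[RHS]/(zeta_hit m k (n, i)).
rewrite -mulmxA -zeta_eq -FS// /F mxE.
by rewrite /zeta_hit.
Qed.

Lemma zeta_hit_last m k l : zeta_hit m k (m, l) = (l == k)%:R.
Proof. by rewrite /zeta_hit/= subrr iprod0 mxE. Qed.

Lemma hit_prob_le_zeta_hit m k t a : a.1 <= m -> hit_prob w m k t a <= zeta_hit m k a.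
Proof.
move=> am; apply: stopped_le am => [b bm|b bm]; last by rewrite step_zeta_hit.
case: eqP => [->|_]; last exact: zeta_hit_ge0.
by rewrite zeta_hit_last eqxx.
Qed.

Lemma sum_zeta_hit m a : \sum_k zeta_hit m k a = 1.
Proof. by have /stochasticP[_] := stochastic_iprod zst a.1 (absz (m - a.1)%R); exact. Qed.

(** Both families are below [zeta_hit] termwise, and their sums over the target
    differ only by the survival probability. *)
Lemma hit_prob_cvg m k a : a.1 <= m -> survival w m t a @[t --> \oo] --> 0 ->
  hit_prob w m k t a @[t --> \oo] --> zeta_hit m k a.
Proof.
move=> am s0; apply: (@squeeze_cvgr _ _ _ _ (fun t => zeta_hit m k a - survival w m t a)
  (fun=> zeta_hit m k a)); last exact: cvg_cst.
- apply: nearW => t; rewrite hit_prob_le_zeta_hit// andbT lerBlDr.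
  have := hit_prob_survival w t am; rewrite (bigD1 k)//= => /(congr1 -%R).
  have := sum_zeta_hit m a; rewrite (bigD1 k)//= => E1 E2.
  have : \sum_(i | i != k) hit_prob w m i t a <= \sum_(i | i != k) zeta_hit m i a.
    by apply: ler_sum => i _; exact: hit_prob_le_zeta_hit.
  lra.
- by rewrite -[X in _ --> X]subr0; apply: cvgB => //; exact: cvg_cst.
Qed.

Let B n : 'M[R]_d.+1 := matQ w n *m z (n - 1) + matR w n.

Let B_ge0 n i j : 0 <= B n i j.
Proof.
rewrite !mxE addr_ge0 ?matR_ge0// sumr_ge0// => k _.
by rewrite mulr_ge0 ?matQ_ge0.
Qed.

Let B_le1 n i : \sum_j B n i j <= 1.
Proof.
under eq_bigr do rewrite !mxE; rewrite big_split exchange_big/=.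
have -> : \sum_k \sum_j matQ w n i k * z (n - 1) k j = \sum_k matQ w n i k.
  apply: eq_bigr => k _; rewrite -mulr_sumr.
  by have /stochasticP[_ ->] := zst (n - 1); rewrite mulr1.
rewrite -(matPQR1 w n i) !big_split/=.
have : 0 <= \sum_k matP w n i k by apply: sumr_ge0 => ? _; exact: matP_ge0.
lra.
Qed.

(** Partial sums of the Neumann series of B are bounded, because they equal
    D^-1 (1 - B^k). If an entry of D^-1 were negative, the identity
    D^-1 B^k = D^-1 - S_k with S_k >= 0 would keep that entry of every D^-1 B^k
    below a fixed negative number, and summing over k would contradict this bound. *)
Lemma resolvent_ge0 n i j : 0 <= invmx (resolvent_arg w z n) i j.
Proof.
set D := resolvent_arg w z n.
have DE : D = 1 - B n by rewrite /D /resolvent_arg /B opprD addrA.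
have Bk_ge0 k i' j' : 0 <= (B n ^+ k) i' j'.
  elim: k i' j' => [|k IH] i' j'; first by rewrite expr0 mxE ler0n.
  by rewrite exprS mxE sumr_ge0// => l _; rewrite mulr_ge0.
have Bk_le1 k i' : \sum_j' (B n ^+ k) i' j' <= 1.
  elim: k i' => [|k IH] i'.
    by rewrite expr0; have /stochasticP[_ ->] := stochastic1 R d.
  under eq_bigr do rewrite exprS mxE.
  rewrite exchange_big/= (le_trans _ (B_le1 n i'))//.
  by apply: ler_sum => l _; rewrite -mulr_sumr ler_piMr.
pose S k : 'M[R]_d.+1 := \sum_(l < k) B n ^+ l.
have SE k : S k = invmx D - invmx D *m B n ^+ k.
  have DS : D *m S k = 1 - B n ^+ k.
    by rewrite -[1 - _]opprB subrX1 -mulNr opprB -DE.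
  by rewrite -[S k](mulKmx (unitD n)) -/D DS mulmxBr mulmx1.
pose c := \sum_i' \sum_j' `|invmx D i' j'|.
have c0 : 0 <= c by rewrite sumr_ge0// => i' _; rewrite sumr_ge0.
have cE (A : 'M[R]_d.+1) e i' j' : 0 <= e -> (forall l, `|A l j'| <= e) ->
    `|(invmx D *m A) i' j'| <= c * e.
  move=> e0 Ae; rewrite mxE (le_trans (ler_norm_sum _ _ _))//.
  apply: (@le_trans _ _ (\sum_l `|invmx D i' l| * e)).
    by apply: ler_sum => l _; rewrite normrM ler_wpM2l.
  rewrite -mulr_suml ler_wpM2r// /c [leRHS](bigD1 i')//= lerDl.
  by apply: sumr_ge0 => ? _; apply: sumr_ge0.
have Bk_norm k l j' : `|(B n ^+ k) l j'| <= 1.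
  rewrite ger0_norm// (le_trans _ (Bk_le1 k l))// (bigD1 j')//= lerDl.
  by rewrite sumr_ge0.
have S_le k l j' : `|S k l j'| <= c + c.
  rewrite SE 2!mxE (le_trans (ler_normB _ _))// lerD//.
    by have := cE 1 1 l j'; rewrite mulmx1 mulr1; apply => // l'; rewrite -(expr0 (B n)).
  by have := cE (B n ^+ k) 1 l j'; rewrite mulr1; apply.
rewrite leNgt; apply/negP => neg.
have up k : (invmx D *m S k) i j <= k%:R * invmx D i j.
  elim: k => [|k IH]; first by rewrite /S big_ord0 mulmx0 mxE mul0r.
  rewrite /S big_ord_recr/= -/(S k) mulmxDr mxE -natr1 mulrDl mul1r lerD//.
  have /(congr1 (fun A : 'M[R]_d.+1 => A i j)) := SE k.
  rewrite 2!mxE; have : 0 <= S k i j; last lra.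
  by rewrite summxE sumr_ge0.
have lo k : - (c * (c + c)) <= (invmx D *m S k) i j.
  rewrite lerNl (le_trans (ler_norm _))// normrN; apply: cE => [|l]; last exact: S_le.
  by rewrite addr_ge0.
have := archi_boundP (normr_ge0 (c * (c + c) / invmx D i j)).
set k := Num.bound _ => hk; have := le_trans (lo k) (up k).
apply/negP; rewrite -ltNge ltrNr -mulrN -ltr_pdivrMr ?oppr_gt0//.
by rewrite (le_lt_trans _ hk)// invrN mulrN -normrN ler_norm.
Qed.

Section mean_crossing_time.
Hypothesis Ebound : forall n i, exists C : R, forall t, trunc_time w (n + 1) t (n, i) <= C.

(** The mean time needed to go from layer n to layer n + 1, by its starting point. *)
Definition mean_crossing n : 'cV[R]_d.+1 :=
  \col_i limn (fun t => trunc_time w (n + 1) t (n, i)).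

Lemma mean_crossing_cvg n i :
  trunc_time w (n + 1) t (n, i) @[t --> \oo] --> mean_crossing n i 0.
Proof.
have [C hC] := Ebound n i; rewrite mxE; apply: nondecreasing_is_cvgn.
  by move=> s t st; exact: trunc_time_nd.
by exists C => _ [t _ <-]; exact: hC.
Qed.

Lemma mean_crossing_ge n i t : trunc_time w (n + 1) t (n, i) <= mean_crossing n i 0.
Proof.
have E := @mean_crossing_cvg n i; rewrite -(cvg_lim _ E)//.
apply: nondecreasing_cvgn_le; last exact: cvgP E.
by move=> s s' st; exact: trunc_time_nd.
Qed.

Lemma mean_crossing_ge0 n i : 0 <= mean_crossing n i 0.
Proof. exact: le_trans (trunc_time_ge0 _ _ _ _) (mean_crossing_ge n i 0). Qed.

Lemma survival1_cvg n i : survival w (n + 1) t (n, i) @[t --> \oo] --> 0.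
Proof. by have [C hC] := Ebound n i; exact: survival_cvg0 hC. Qed.

Lemma hit_prob1_cvg n i k : hit_prob w (n + 1) k t (n, i) @[t --> \oo] --> z n i k.
Proof.
have := @hit_prob_cvg (n + 1) k (n, i) _ (survival1_cvg n i).
rewrite /zeta_hit/= (_ : absz _ = 1%N) ?iprod1; last lia.
by apply; rewrite /=; lia.
Qed.

(** First-step analysis: a step to the left has to be followed by a crossing of
    layer n - 1 and then, from a point distributed according to zeta, by a crossing
    of layer n. *)
Lemma mean_crossing_superharmonic n i :
  1 + (matR w n *m mean_crossing n +
       matQ w n *m (mean_crossing (n - 1) + z (n - 1) *m mean_crossing n)) i 0
   <= mean_crossing n i 0.
Proof.
set q : nat -> R := fun t => 1 + \sum_j (matR w n i j * trunc_time w (n + 1) t (n, j) +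
  matQ w n i j * (trunc_time w n t (n - 1, j) +
    \sum_k trunc_time w (n + 1) t (n, k) * hit_prob w n k t (n - 1, j))).
have Hq : q @ \oo -->
    1 + (matR w n *m mean_crossing n +
         matQ w n *m (mean_crossing (n - 1) + z (n - 1) *m mean_crossing n)) i 0.
  rewrite /q; apply: cvgD; first exact: cvg_cst.
  rewrite !mxE -big_split/=; apply: cvg_big => [|j _]; first exact: add_continuous.
  apply: cvgD; first by apply: cvgM; [exact: cvg_cst|exact: mean_crossing_cvg].
  apply: cvgM; first exact: cvg_cst.
  rewrite !mxE; apply: cvgD.
    have := @mean_crossing_cvg (n - 1) j; rewrite mxE subrK; exact.
  under [X in _ --> X]eq_bigr do rewrite mulrC.
  apply: cvg_sumr => k; apply: cvgM; first exact: mean_crossing_cvg.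
  by have := @hit_prob1_cvg (n - 1) j k; rewrite subrK; exact.
apply: (ler_cvg_to Hq (@cvg_cst _ (mean_crossing n i 0) _ \oo _)).
apply: nearW => t; rewrite (le_trans _ (mean_crossing_ge n i (t + t).+1))//.
rewrite trunc_timeS/=; last lia.
rewrite lerD2l /step/=; apply: ler_sum => j _.
rewrite [trunc_time _ _ _ (n + 1, j)]trunc_time_ge//= mulr0 add0r lerD//.
  by rewrite ler_wpM2l ?matR_ge0// trunc_time_nd// leq_addr.
by rewrite ler_wpM2l ?matQ_ge0// trunc_time_concat//=; lia.
Qed.

Lemma invmx_resolvent_le n (x y : 'cV[R]_d.+1) :
  (forall i, x i 0 <= y i 0) ->
  forall i, (invmx (resolvent_arg w z n) *m x) i 0 <=
            (invmx (resolvent_arg w z n) *m y) i 0.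
Proof.
by move=> xy i; rewrite !mxE; apply: ler_sum => j _; rewrite ler_wpM2l// resolvent_ge0.
Qed.

Lemma matA_ge0 n i j : 0 <= matA w z n i j.
Proof.
by rewrite mxE sumr_ge0// => k _; rewrite mulr_ge0 ?resolvent_ge0 ?matQ_ge0.
Qed.

Lemma vecu_ge0 n i : 0 <= vecu w z n i 0.
Proof. by rewrite mxE sumr_ge0// => k _; rewrite mulr_ge0 ?resolvent_ge0 ?mxE. Qed.

(** Apply the nonnegative inverse of the resolvent to [mean_crossing_superharmonic]. *)
Lemma mean_crossing_ge_uA n i :
  (vecu w z n + matA w z n *m mean_crossing (n - 1)) i 0 <= mean_crossing n i 0.
Proof.
rewrite /vecu /matA -mulmxA -mulmxDr.
rewrite -[X in _ <= (X : 'cV_d.+1) i 0](mulKmx (unitD n)).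
apply: invmx_resolvent_le => j.
have := mean_crossing_superharmonic n j.
rewrite /resolvent_arg !mulmxBl mul1mx mulmxDr -mulmxA.
move: (_ *m (_ *m _)) (_ *m _) (_ *m _) => x y y'.
by rewrite !mxE; lra.
Qed.

(** The partial sums of u_n + A_n u_(n-1) + A_n A_(n-1) u_(n-2) + ... *)
Fixpoint uA_partial (k : nat) n : 'cV[R]_d.+1 :=
  if k is k'.+1 then vecu w z n + matA w z n *m uA_partial k' (n - 1) else 0.

Lemma uA_partial_ndS k n i : uA_partial k n i 0 <= uA_partial k.+1 n i 0.
Proof.
elim: k n i => [|k IH] n i.
  by rewrite /= mulmx0 addr0 !mxE; have := vecu_ge0 n i; rewrite !mxE.
rewrite ![in X in X <= _]/= ![in X in _ <= X]/= !mxE lerD2l.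
by apply: ler_sum => j _; rewrite ler_wpM2l ?matA_ge0//; exact: IH.
Qed.

Lemma uA_partial_le k n i : uA_partial k n i 0 <= mean_crossing n i 0.
Proof.
elim: k n i => [|k IH] n i; first by rewrite mxE mean_crossing_ge0.
rewrite (le_trans _ (mean_crossing_ge_uA n i))//= !mxE lerD2l.
by apply: ler_sum => j _; rewrite ler_wpM2l ?matA_ge0.
Qed.

Definition uA_series n : 'cV[R]_d.+1 := \col_i limn (fun k => uA_partial k n i 0).

Lemma uA_series_cvg n i : uA_partial k n i 0 @[k --> \oo] --> uA_series n i 0.
Proof.
rewrite mxE; apply: nondecreasing_is_cvgn.
  by apply/nondecreasing_seqP => k; exact: uA_partial_ndS.
by exists (mean_crossing n i 0) => _ [k _ <-]; exact: uA_partial_le.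
Qed.

Lemma uA_series_eq n : uA_series n = vecu w z n + matA w z n *m uA_series (n - 1).
Proof.
apply/colP => i.
have H1 : uA_partial k.+1 n i 0 @[k --> \oo] --> uA_series n i 0.
  by have := @uA_series_cvg n i; rewrite -cvg_shiftS.
have H2 : uA_partial k.+1 n i 0 @[k --> \oo] -->
    (vecu w z n + matA w z n *m uA_series (n - 1)) i 0.
  rewrite /= !(mxE, @mxE) /=.
  under eq_cvg do rewrite mxE [X in _ + X]mxE.
  apply: cvgD; first by rewrite mxE; exact: cvg_cst.
  by apply: cvg_sumr => j; apply: cvgM; [exact: cvg_cst|exact: uA_series_cvg].
exact: (cvg_unique _ H1 H2).
Qed.

Lemma uA_series_le n i : uA_series n i 0 <= mean_crossing n i 0.
Proof.
apply: (ler_cvg_to (@uA_series_cvg n i) (@cvg_cst _ (mean_crossing n i 0) _ \oo _)).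
by apply: nearW => k; exact: uA_partial_le.
Qed.

(** The equation that exact mean crossing times satisfy by first-step analysis. *)
Lemma uA_series_resolvent n : uA_series n = const_mx 1 + matR w n *m uA_series n +
  matQ w n *m (uA_series (n - 1) + z (n - 1) *m uA_series n).
Proof.
have : resolvent_arg w z n *m uA_series n = const_mx 1 + matQ w n *m uA_series (n - 1).
  rewrite {1}uA_series_eq /vecu /matA -mulmxA -mulmxDr mulmxA mulmxV//.
  by rewrite mul1mx.
rewrite /resolvent_arg !mulmxBl mul1mx -mulmxA mulmxDr.
move=> /eqP; rewrite !subr_eq => /eqP {1}->.
by rewrite -!addrA; congr (_ + _); rewrite addrCA.
Qed.

(** Concatenation of mean crossings: the mean time to reach layer m from layer m - k,
    with the series in the role of the mean crossing times. *)
Fixpoint hitting (m : int) (k : nat) : 'cV[R]_d.+1 :=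
  if k is k'.+1 then uA_series (m - k%:Z) + z (m - k%:Z) *m hitting m k' else 0.

Let F (m p : int) := hitting m (absz (m - p)%R).

Let F_eq m (p : int) : p < m -> F m p = uA_series p + z p *m F m (p + 1).
Proof.
move=> pm; rewrite /F (_ : absz (m - p)%R = (absz (m - (p + 1))%R).+1); last lia.
by rewrite /= (_ : m - _ = p); last lia.
Qed.

Let F_step m n i : n < m -> 1 + step w (fun b => F m b.1 b.2 0) (n, i) = F m n i 0.
Proof.
move=> nm; rewrite step_mx [F m (n - 1)]F_eq; last lia.
rewrite subrK [F m n]F_eq// {3}uA_series_resolvent {3}zeta_eq.
rewrite !(mulmxDr, mulmxDl) !mulmxA.
repeat match goal with |- context [@mulmx ?R ?m ?n ?p ?a ?b] =>
  generalize (@mulmx R m n p a b) => ? end.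
by rewrite !mxE; ring.
Qed.

Lemma uA_series_ge0 n i : 0 <= uA_series n i 0.
Proof.
apply: (ler_cvg_to (@cvg_cst _ (0 : R) _ \oo _) (@uA_series_cvg n i)).
apply: nearW => k; have -> : 0 = uA_partial 0 n i 0 by rewrite mxE.
by elim: k => // k IH; exact: le_trans IH (uA_partial_ndS _ _ _).
Qed.

Lemma hitting_ge0 m k i : 0 <= hitting m k i 0.
Proof.
elim: k i => [|k IH] i /=; first by rewrite mxE.
by rewrite !mxE addr_ge0 ?sumr_ge0// => [|j _];
  [have := uA_series_ge0 (m - k.+1%:Z) i; rewrite mxE|exact: mulr_ge0].
Qed.

(** The function [hitting] solves the equation of mean hitting times, and truncated
    means increase to the least nonnegative solution. *)
Lemma trunc_time_le m t a : a.1 <= m -> trunc_time w m t a <= F m a.1 a.2 0.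
Proof.
elim: t a => [|t IH] a am; first by rewrite /trunc_time big_ord0; exact: hitting_ge0.
have [lt_am|ma] := ltP a.1 m; last first.
  by rewrite trunc_time_ge//; exact: hitting_ge0.
rewrite trunc_timeS// -F_step// lerD2l -surjective_pairing.
by apply: ler_step => b ba; apply: IH; lia.
Qed.

Lemma survival_cvg m a : a.1 <= m -> survival w m t a @[t --> \oo] --> 0.
Proof. by move=> am; apply: survival_cvg0 => t; exact: trunc_time_le. Qed.

Lemma hit_prob_cvg_zeta_hit m k a : a.1 <= m -> hit_prob w m k t a @[t --> \oo] --> zeta_hit m k a.
Proof. by move=> am; apply: hit_prob_cvg => //; exact: survival_cvg. Qed.

(** The series is the mean crossing time: it is a lower bound by
    [mean_crossing_ge_uA] and an upper bound by [trunc_time_le]. *)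
Lemma trunc_time_cvg_uA_series n i :
  trunc_time w (n + 1) t (n, i) @[t --> \oo] --> uA_series n i 0.
Proof.
rewrite (_ : uA_series n i 0 = mean_crossing n i 0); first exact: mean_crossing_cvg.
apply/le_anti; rewrite uA_series_le/=.
apply: (ler_cvg_to (@mean_crossing_cvg n i) (@cvg_cst _ (uA_series n i 0) _ \oo _)).
apply: nearW => t; have := @trunc_time_le (n + 1) t (n, i).
rewrite F_eq/=; last lia.
rewrite /F subrr/= mulmx0 addr0; apply; lia.
Qed.

Lemma uA_partialE k n : uA_partial k n =
  \sum_(l < k) (\prod_(i < l) matA w z (n - i%:Z)) *m vecu w z (n - l%:Z).
Proof.
elim: k n => [|k IH] n; first by rewrite big_ord0.
rewrite big_ord_recl big_ord0 mul1mx subr0 /= IH mulmx_sumr; congr (_ + _).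
apply: eq_bigr => l _; rewrite big_ord_recl subr0 mulmxA /=.
congr (_ *m _ *m vecu _ _ _); last by rewrite /bump/=; lia.
by apply: eq_bigr => i _; congr matA; rewrite /bump/=; lia.
Qed.

Lemma uA_series_past_cvg i :
  \sum_(l < k) (prodA_past w z l *m vecu w z (- l%:Z)) i 0 @[k --> \oo]
  --> uA_series 0 i 0.
Proof.
have := @uA_series_cvg 0 i; apply: cvg_trans; apply: near_eq_cvg.
apply: nearW => k; rewrite uA_partialE summxE; apply: eq_bigr => l _.
rewrite sub0r; congr ((_ *m _) _ _); apply: eq_bigr => j _; by rewrite sub0r.
Qed.

End mean_crossing_time.
End zeta.

(** * Shifted environments *)

Section environment_shift.
Context (R : realType) (d : nat).
Implicit Types (w : env R d) (f : state d -> R) (m n : int).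

Definition shiftn m w : env R d := fun n => w (n + m).

Lemma shiftnD m n w : shiftn m (shiftn n w) = shiftn (m + n) w.
Proof. by apply/funext => k; rewrite /shiftn addrA. Qed.

Lemma shiftn0 w : shiftn 0 w = w.
Proof. by apply/funext => k; rewrite /shiftn addr0. Qed.

Lemma shift_shiftn w : Defs.shift w = shiftn 1 w. Proof. by []. Qed.

Lemma step_shiftn m w f a : step (shiftn m w) f a =
  step w (fun b => f (b.1 - m, b.2)) (a.1 + m, a.2).
Proof.
apply: eq_bigr => j _ /=; rewrite /matP /matQ /matR /shiftn.
congr (_ * f _ + _ * f _ + _ * f _); congr pair; ring.
Qed.

Lemma stopped_shiftn m w M f t a : stopped (shiftn m w) M f t a =
  stopped w (M + m) (fun b => f (b.1 - m, b.2)) t (a.1 + m, a.2).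
Proof.
elim: t a => [|t IH] a /=; first by rewrite addrK -surjective_pairing.
rewrite ltrD2r addrK -surjective_pairing; case: ifP => // _.
rewrite step_shiftn; apply: eq_step => b; rewrite IH/= subrK -surjective_pairing//.
Qed.

Lemma eq_stopped w M f g t a : f =1 g -> stopped w M f t a = stopped w M g t a.
Proof. by move=> /funext ->. Qed.

Lemma hit_prob_shiftn m w M k t n i :
  hit_prob (shiftn m w) M k t (n, i) = hit_prob w (M + m) k t (n + m, i).
Proof.
rewrite /hit_prob stopped_shiftn; apply: eq_stopped => -[b j]/=.
by rewrite !xpair_eqE subr_eq.
Qed.

Lemma survival_shiftn m w M t n i :
  survival (shiftn m w) M t (n, i) = survival w (M + m) t (n + m, i).
Proof.
rewrite /survival stopped_shiftn; apply: eq_stopped => -[b j]/=.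
by rewrite ltrBlDr.
Qed.

Lemma trunc_time_shiftn m w M t n i :
  trunc_time (shiftn m w) M t (n, i) = trunc_time w (M + m) t (n + m, i).
Proof. by apply: eq_bigr => s _; rewrite survival_shiftn. Qed.

Lemma trans_shiftn m w a b :
  trans (shiftn m w) a b = trans w (a.1 + m, a.2) (b.1 + m, b.2).
Proof.
rewrite /trans /= /matP /matQ /matR /shiftn.
by rewrite [a.1 + m + 1]addrAC [a.1 + m - 1]addrAC !(inj_eq (addIr m)).
Qed.

Lemma trans_le_step w f a b : (forall c, 0 <= f c) -> trans w a b * f b <= step w f a.
Proof.
move=> f0; rewrite /step (bigD1 b.2)//=.
set s := \sum_(_ < _ | _) _.
have s0 : 0 <= s.
  by apply: sumr_ge0 => j _; rewrite !addr_ge0 ?mulr_ge0 ?matP_ge0 ?matQ_ge0 ?matR_ge0.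
have p0 := mulr_ge0 (matP_ge0 w a.1 a.2 b.2) (f0 (a.1 + 1, b.2)).
have q0 := mulr_ge0 (matQ_ge0 w a.1 a.2 b.2) (f0 (a.1 - 1, b.2)).
have r0 := mulr_ge0 (matR_ge0 w a.1 a.2 b.2) (f0 (a.1, b.2)).
rewrite /trans; case: eqP => [E|_]; first by rewrite {2}[b]surjective_pairing E; lra.
case: eqP => [E|_]; first by rewrite {2}[b]surjective_pairing E; lra.
case: eqP => [E|_]; first by rewrite {2}[b]surjective_pairing E; lra.
by rewrite mul0r; lra.
Qed.

End environment_shift.

(** * Uniform hitting probabilities from a communicating layer *)

Section communication.
Context (R : realType) (d : nat) (w : env R d).
Hypothesis colP : forall (n : int) (j : 'I_d.+1), 0 < \sum_i matP w n i j.

Lemma col_witness n j : exists i, 0 < matP w n i j.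
Proof.
apply: contrapT => /forallNP H; have := colP n j; rewrite big1 ?ltxx// => i _.
by apply/eqP; rewrite eq_le matP_ge0 andbT leNgt; apply/negP/H.
Qed.

(** A possible step from a to b carries a positive hitting probability back to a. *)
Lemma hit_back m j a b : a.1 < m -> 0 < trans w a b ->
  (exists t, 0 < hit_prob w m j t b) -> exists t, 0 < hit_prob w m j t a.
Proof.
move=> am ab [t bt]; exists t.+1; rewrite /hit_prob/= am.
apply: (lt_le_trans (mulr_gt0 ab bt)); apply: trans_le_step => c; exact: hit_prob_ge0.
Qed.

(** Every point of layer m can be reached from any layer to its left, because no
    column of a matrix P vanishes. *)
Lemma hit_col m j k : exists i, exists t, 0 < hit_prob w m j t (m - k%:Z, i).
Proof.
elim: k => [|k [i Hi]].
  by exists j, 0%N; rewrite /hit_prob/= subr0 eqxx.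
have [i' Hi'] := col_witness (m - k.+1%:Z) i.
exists i'; apply: hit_back Hi; first by rewrite /=; lia.
by rewrite /trans/= (_ : m - k%:Z == m - k.+1%:Z + 1)//; apply/eqP; lia.
Qed.

Lemma hit_path m j p a : all (fun b => b.1 < m) (a :: p) ->
  path (fun x y => 0 < trans w x y) a p ->
  (exists t, 0 < hit_prob w m j t (last a p)) -> exists t, 0 < hit_prob w m j t a.
Proof.
elim: p a => [|b p IH] a //= /and3P[am bm pm] /andP[ab pp] H.
by apply: (hit_back am ab); apply: IH H => //=; rewrite bm.
Qed.

(** From every point of layer 0, every point of layer M is hit within N steps with
    probability at least 1 / (N + 1); a single N bounds the time and the probability,
    which leaves only countably many such events. *)
Definition uniform_hit (w : env R d) (M N : nat) : Prop :=
  forall i j, N.+1%:R^-1 <= hit_prob w M%:Z j N (0, i).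

(** Let M exceed the layers visited by the connecting paths inside layer 0. From
    (0, i) go to a point of layer 0 from which the prescribed point of layer M can be
    hit; the connecting path does not touch layer M, so it can be prefixed. *)
Lemma one_class_uniform_hit : one_class w 0 -> exists M N, uniform_hit w M N.
Proof.
move=> oc.
have [p Hp] : {p : 'I_d.+1 * 'I_d.+1 -> seq (state d) & forall ij,
    path (fun x y => 0 < trans w x y) (0, ij.1) (p ij) /\
    last (0, ij.1) (p ij) = (0, ij.2)}.
  by apply: (@choice _ _ (fun ij p => path (fun x y => 0 < trans w x y) (0, ij.1) p /\
    last (0, ij.1) p = (0, ij.2))) => ij; exact: oc.
(* Strictly to the right of all connecting paths. *)
pose M := (\max_ij \max_(s <- p ij) absz s.1).+1.
have pM ij : all (fun b => b.1 < M%:Z) ((0, ij.1) :: p ij).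
  apply/andP; split; first by rewrite /M.
  apply/allP => s sp.
  rewrite (le_lt_trans (ler_norm _))//.
  rewrite -abszE ltz_nat ltnS (leq_trans _ (leq_bigmax ij))//.
  by apply: (@leq_bigmax_seq _ _ xpredT (fun s : state d => absz s.1)).
have hit ij : exists N, N.+1%:R^-1 <= hit_prob w M%:Z ij.2 N (0, ij.1).
  have [i'] := hit_col M%:Z ij.2 M; rewrite subrr => Hi'.
  have [p1 p2] := Hp (ij.1, i').
  have [t Ht] : exists t, 0 < hit_prob w M%:Z ij.2 t (0, ij.1).
    by apply: (hit_path (pM (ij.1, i')) p1); rewrite p2.
  exists (maxn t (Num.bound (hit_prob w M%:Z ij.2 t (0, ij.1))^-1)).
  rewrite (le_trans _ (hit_prob_nd _ _ _ _ (leq_maxl _ _)))//.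
  rewrite invf_ple ?posrE ?ltr0n//.
  rewrite (le_trans (ltW (archi_boundP _)))// ?invr_ge0 ?(ltW Ht)// ler_nat.
  by rewrite (leq_trans (leq_maxr t _)).
have [N HN] := choice hit.
exists M, (\max_ij N ij) => i j.
have le_N : (N (i, j) <= \max_ij N ij)%N := leq_bigmax (i, j).
rewrite (le_trans _ (hit_prob_nd _ _ _ _ le_N))// (le_trans _ (HN (i, j)))//.
by rewrite lef_pV2 ?posrE ?ltr0n// ler_nat ltnS.
Qed.

End communication.

(** * The vectors y *)

Section forgetting.
Context (R : realType) (d : nat).
Implicit Types (z : int -> 'M[R]_d.+1) (v : int -> 'rV[R]_d.+1).

Definition forgets_past z : Prop := forall e : R, 0 < e -> forall b,
  exists k0, forall k, (k0 <= k)%N -> contracting e (iprod z (b - k%:Z) k).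

Definition forgets_future z : Prop := forall e : R, 0 < e -> forall a,
  exists k0, forall k, (k0 <= k)%N -> contracting e (iprod z a k).

Lemma expr_small (c e : R) : 0 <= c < 1 -> 0 < e -> exists r, c ^+ r <= e.
Proof.
move=> /andP[c0 c1] e0.
have /cvgrPdist_le/(_ e e0)[r _ /(_ r (leqnn r))] : c ^+ n @[n --> \oo] --> 0.
  by apply: cvg_expr; rewrite ger0_norm.
by rewrite /= sub0r normrN ger0_norm ?exprn_ge0// => H; exists r.
Qed.

Lemma vecyE z v n j : vecy z v n 0 j =
  limn (fun k : nat => (v (n - k%:Z) *m iprod z (n - k%:Z) k.+1) 0 j).
Proof. by rewrite mxE. Qed.

(** Products over longer intervals are averages of the rows of products over shorter
    ones, so contraction makes the sequence Cauchy; it also makes the initial vectors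
    irrelevant. *)
Lemma vecy_cvg z v n : (forall n, stochastic (z n)) -> forgets_past z ->
  (forall a, probvec (v a)) -> forall (u : nat -> 'rV[R]_d.+1) j,
  (forall k, probvec (u k)) ->
  (u k *m iprod z (n - k%:Z) k.+1) 0 j @[k --> \oo] --> vecy z v n 0 j.
Proof.
move=> zst fz vp u j up.
pose p (u : nat -> 'rV[R]_d.+1) k := (u k *m iprod z (n - k%:Z) k.+1) 0 j.
have close (u1 u2 : nat -> 'rV[R]_d.+1) : (forall k, probvec (u1 k)) ->
    (forall k, probvec (u2 k)) -> forall e, 0 < e ->
    exists k0, forall k l, (k0 <= k)%N -> (k <= l)%N -> `|p u1 k - p u2 l| <= e.
  move=> u1p u2p e e0; have [k0 Hk0] := fz e e0 (n + 1).
  exists k0 => k l hk hl.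
  have C : contracting e (iprod z (n - k%:Z) k.+1).
    have := Hk0 k.+1 (leq_trans hk (leqnSn k)).
    by rewrite (_ : n + 1 - _ = n - k%:Z)//; lia.
  have -> : p u2 l = (u2 l *m iprod z (n - l%:Z) (l - k) *m iprod z (n - k%:Z) k.+1) 0 j.
    rewrite -mulmxA /p (_ : n - k%:Z = n - l%:Z + (l - k)%N%:Z); last lia.
    by rewrite -iprodD addnS subnK.
  have u2s : stochastic (u2 l *m iprod z (n - l%:Z) (l - k)).
    by apply: stochasticM; [exact: u2p|exact: stochastic_iprod].
  rewrite ler_norml lerNl opprB.
  by apply/andP; split; apply: probvec_contracting => //; exact: u1p.
have cv : cvg (p (fun k => v (n - k%:Z)) k @[k --> \oo]).
  apply/(@cauchy_cvgP R)/cauchy_exP => e e0.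
  have e20 : 0 < e / 2 by rewrite divr_gt0.
  have [k0 Hk0] := close (fun k => v (n - k%:Z)) (fun k => v (n - k%:Z)) (fun k => vp _) (fun k => vp _) _ e20.
  exists (p (fun k => v (n - k%:Z)) k0); exists k0 => // l /= hl.
  rewrite /ball/= (le_lt_trans (Hk0 _ _ (leqnn _) hl))//.
  by rewrite ltr_pdivrMr// ltr_pMr// ltr1n.
rewrite vecyE.
have d0 : p u k - p (fun k => v (n - k%:Z)) k @[k --> \oo] --> 0.
  apply/cvgrPdist_le => /= e e0.
  have [k0 Hk0] := close _ (fun k => v (n - k%:Z)) up (fun k => vp _) _ e0.
  by exists k0 => // l /= hl; rewrite sub0r normrN Hk0.
set y := limn _; have {}cv : p (fun k => v (n - k%:Z)) k @[k --> \oo] --> y by exact: cv.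
rewrite -[y]add0r (_ : (fun k => _) = fun k => p u k - p (fun k => v (n - k%:Z)) k
  + p (fun k => v (n - k%:Z)) k); first exact: (cvgD d0 cv).
by apply/funext => k; rewrite subrK.
Qed.

(** If z' is the shift of z, both sides are limits of products over the same intervals
    ending with z 0, started from different probability vectors. *)
Lemma vecy_succ z z' v v' : (forall n, stochastic (z n)) -> forgets_past z ->
  forgets_past z' -> (forall n, z' n = z (n + 1)) ->
  (forall a, probvec (v a)) -> (forall a, probvec (v' a)) ->
  vecy z' v' (-1) = vecy z v (-1) *m z 0.
Proof.
move=> zst fz fz' zz' vp v'p.
have z'st n : stochastic (z' n) by rewrite zz'.
apply/rowP => j.
pose u (k : nat) := (v (- 1 - k%:Z) *m iprod z (- 1 - k%:Z) k.+1 *m z 0) 0 j.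
have H1 : u k @[k --> \oo] --> (vecy z v (-1) *m z 0) 0 j.
  rewrite /u mxE; under eq_cvg do rewrite mxE.
  apply: cvg_sumr => i; apply: cvgM; last exact: cvg_cst.
  exact: (@vecy_cvg z v (-1) zst fz vp (fun k => v (- 1 - k%:Z)) i (fun k => vp _)).
have H2 : u k @[k --> \oo] --> vecy z' v' (-1) 0 j.
  have := @vecy_cvg z' v' (-1) z'st fz' v'p (fun k => v (- k%:Z)) j (fun k => vp _).
  rewrite -cvg_shiftS; apply: cvg_trans; apply: near_eq_cvg; apply: nearW => k /=.
  rewrite /u -mulmxA (_ : z 0 = z (- 1 - k%:Z + k.+1%:Z)); last by congr z; lia.
  rewrite -iprodSr; congr ((v _ *m _) _ _); first lia.
  by apply: eq_bigr => i _; rewrite zz'; congr z; lia.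
exact: cvg_unique H2 H1.
Qed.

Lemma iprod_col z a k j : (forall n i j, 0 <= z n i j) ->
  (forall n j, exists i, 0 < z n i j) -> exists i, 0 < iprod z a k i j.
Proof.
move=> z0 zc; have p0 b l i i' : 0 <= iprod z b l i i'.
  elim: l b i i' => [|l IH] b i i'; first by rewrite iprod0 mxE ler0n.
  by rewrite iprodS mxE sumr_ge0// => ? _; rewrite mulr_ge0.
elim: k a => [|k IH] a; first by exists j; rewrite iprod0 mxE eqxx.
have [i Hi] := IH (a + 1); have [i' Hi'] := zc a i; exists i'.
rewrite iprodS mxE (bigD1 i)//= ltr_wpDr ?mulr_gt0// sumr_ge0// => l _.
by rewrite mulr_ge0.
Qed.

(** A uniform block followed by matrices without zero columns bounds the entries of
    all longer products from below. *)
Lemma vecy_gt0 z v (dl : R) M : (forall n, stochastic (z n)) -> forgets_past z ->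
  (forall a, probvec (v a)) -> 0 < dl ->
  (forall n j, exists i, 0 < z n i j) ->
  (forall a, exists n : nat, block z dl M (a - n%:Z)) ->
  forall j, 0 < vecy z v (-1) 0 j.
Proof.
move=> zst fz vp dl0 zc zb j.
have z0 n i i' : 0 <= z n i i' by have /stochasticP[+ _] := zst n; exact.
have [n Hn] := zb (- M%:Z).
have [i0 Hi0] := iprod_col (- M%:Z - n%:Z + M%:Z) n j z0 zc.
set e := dl * iprod z (- M%:Z - n%:Z + M%:Z) n i0 j.
have e0 : 0 < e by rewrite mulr_gt0.
have lo i : e <= iprod z (- (M + n)%N%:Z) (M + n) i j.
  rewrite (_ : - (M + n)%N%:Z = - M%:Z - n%:Z); last lia.
  rewrite iprodD mxE (bigD1 i0)//=.
  apply: (@le_trans _ _ (iprod z (- M%:Z - n%:Z) M i i0 *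
    iprod z (- M%:Z - n%:Z + M%:Z) n i0 j)); first by apply: ler_wpM2r; [exact: ltW|exact: Hn].
  rewrite lerDl sumr_ge0// => l _.
  have p0 b k i1 i2 : 0 <= iprod z b k i1 i2.
    by have /stochasticP[+ _] := stochastic_iprod zst b k; exact.
  by rewrite mulr_ge0.
apply: (lt_le_trans e0).
apply: (ler_cvg_to (@cvg_cst _ e _ \oo _)
  (@vecy_cvg z v (-1) zst fz vp (fun k => v (- 1 - k%:Z)) j (fun k => vp _))).
exists (M + n)%N => // k /= hk.
rewrite -(subnK (leqW hk)) iprodD mulmxA mxE.
set u : 'rV_d.+1 := v _ *m _.
have /stochasticP[u0 u1] : stochastic u.
  by apply: stochasticM; [exact: vp|exact: stochastic_iprod].
rewrite -[leLHS]mul1r -(u1 0) mulr_suml; apply: ler_sum => i _.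
rewrite ler_wpM2l// (_ : - 1 - k%:Z + (k.+1 - (M + n))%N%:Z = - (M + n)%N%:Z) ?lo//.
by move: hk; lia.
Qed.

End forgetting.

(** * The path space *)

Section path_space.
Context (R : realType) (d : nat).
Implicit Types (s : nat -> state d) (B : set (state d)) (x : paths d).
Let T0 := (int * 'I_d.+1)%type.

Definition cyl (n : nat) s : set (paths d) := [set x | forall k, (k <= n)%N -> x k = s k].

Lemma bigcup_countType (I : countType) d0 (T : measurableType d0) (F : I -> set T) :
  (forall i, measurable (F i)) -> measurable (\bigcup_i F i).
Proof. by move=> mF; apply: countable_bigcupT_measurable => //; exact: countableP. Qed.

Lemma measurable_coord t B : measurable [set x : paths d | B (x t)].
Proof.
rewrite (_ : [set x | _] = \bigcup_(s : T0) ([set x : paths d | x t = s] `&` [set _ | B s])).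
  apply: (@bigcup_countType T0) => s; apply: measurableI.
    by apply: sub_sigma_algebra; exists t, s.
  have [Bs|Bs] := pselect (B s).
    by rewrite (_ : [set _ | _] = setT)//; apply/seteqP; split.
  by rewrite (_ : [set _ | _] = set0)//; apply/seteqP; split.
apply/seteqP; split => [x /= Bx|x [s _ [/= -> //]]].
by exists (x t : T0).
Qed.

Lemma measurable_coords (B : nat -> set (state d)) :
  measurable [set x : paths d | forall t, B t (x t)].
Proof.
rewrite (_ : [set x | _] = \bigcap_t [set x : paths d | B t (x t)]).
  by apply: bigcapT_measurable => t; exact: measurable_coord.
by apply/seteqP; split => [x Bx t _|x Bx t]; exact: Bx.
Qed.

Lemma measurable_cyl n s : measurable (cyl n s).
Proof. exact: (measurable_coords (fun k b => (k <= n)%N -> b = s k)). Qed.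

(** Cylinders over initial segments, together with the empty set, form the pi-system
    on which the quenched law is prescribed. *)
Definition cyls : set (set (paths d)) :=
  [set A | A = set0 \/ exists n s, A = cyl n s].

Lemma cyl_subI n m s s' : (n <= m)%N ->
  cyl n s `&` cyl m s' = if `[<forall k, (k <= n)%N -> s k = s' k>] then cyl m s' else set0.
Proof.
move=> nm; case: asboolP => [H|H]; apply/seteqP; split => x //=.
- by case.
- move=> xs'; split => // k kn; rewrite xs' ?H//; exact: leq_trans nm.
- case=> xs xs'; apply: H => k kn; rewrite -xs// xs'//; exact: leq_trans nm.
Qed.

Lemma cyls_setI : setI_closed cyls.
Proof.
move=> A B [->|[n [s ->]]]; first by rewrite set0I; left.
move=> [->|[m [s' ->]]]; first by rewrite setI0; left.
case: (leqP n m) => [nm|/ltnW mn].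
  by rewrite cyl_subI//; case: ifP => _; [right; exists m, s'|left].
by rewrite setIC cyl_subI//; case: ifP => _; [right; exists n, s|left].
Qed.

(** A one-coordinate cylinder is a countable union of initial-segment cylinders. *)
Lemma cyls_generate : @measurable _ (paths d) = <<s cyls >>.
Proof.
apply/seteqP; split; last first.
  apply: smallest_sub; first exact: sigma_algebra_measurable.
  by move=> A [->|[n [s ->]]]; [exact: measurable0|exact: measurable_cyl].
apply: smallest_sub; first exact: smallest_sigma_algebra.
move=> A [t [s ->]].
pose F (l : seq T0) : set (paths d) := if nth (s : T0) l t == s then cyl t (nth (s : T0) l) else set0.
rewrite (_ : [set x | _] = \bigcup_l F l).
  have [_ _ H] := smallest_sigma_algebra setT cyls.
  pose G k := if (unpickle k : option (seq T0)) is Some l then F l else set0.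
  rewrite (_ : \bigcup_l _ = \bigcup_k G k).
    apply: H => k; apply: sub_sigma_algebra; rewrite /G.
    case: (unpickle k : option (seq T0)) => [l|]; last by left.
    by rewrite /F; case: eqP => _; [right; exists t, (nth (s : T0) l)|left].
  apply/seteqP; split => [x [l _ xl]|x [k _]].
    by exists (pickle l); [by []|rewrite /G pickleK].
  by rewrite /G; case: (unpickle k : option (seq T0)) => // l xl; exists l.
apply/seteqP; split => [x /= xt|x [l _]]; last first.
  by rewrite /F; case: eqP => // ls xl /=; rewrite xl.
exists (mkseq (x : nat -> T0) t.+1) => //.
rewrite /F nth_mkseq// xt eqxx => k kt; rewrite nth_mkseq// ltnS.
Qed.

Lemma paths_measure_unique (m1 m2 : {measure set (paths d) -> \bar R}) :
  (forall n s, m1 (cyl n s) = m2 (cyl n s)) -> (m1 setT < +oo)%E ->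
  forall D, measurable D -> m1 D = m2 D.
Proof.
move=> m12 fin; pose g k : set (paths d) :=
  if (unpickle k : option T0) is Some a then cyl 0 (fun=> a) else set0.
have mg k : measurable (g k).
  by rewrite /g; case: (unpickle k : option T0) => // a; exact: measurable_cyl.
apply: (measure_unique cyls g).
- exact: cyls_generate.
- exact: cyls_setI.
- by move=> k; rewrite /g; case: unpickle => [a|]; [right; exists 0%N, (fun=> a)|left].
- apply/seteqP; split => // x _; exists (pickle (x 0%N : T0)) => //.
  by rewrite /g pickleK => k; rewrite leqn0 => /eqP ->.
- by move=> A [->|[n [s ->]]]; rewrite ?measure0.
- move=> k; apply: le_lt_trans fin; apply: le_measure; rewrite ?inE//.
Qed.

Definition recenter (n : nat) (a : int) (x : paths d) : paths d :=
  fun k => ((x (n + k)%N).1 - a, (x (n + k)%N).2).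

Lemma measurable_recenter n a : measurable_fun setT (recenter n a).
Proof.
apply: (@measurability _ _ (paths d) (paths d) setT (recenter n a) (@path_cylinders d)) => //.
move=> _ [_ [t [s ->]] <-]; rewrite setTI.
exact: (measurable_coord (n + t) (fun b => (b.1 - a, b.2) = s)).
Qed.

Lemma measurable_recenter_pre n a (D : set (paths d)) :
  measurable D -> measurable (recenter n a @^-1` D).
Proof. by move=> mD; rewrite -[X in measurable X]setTI; exact: measurable_recenter. Qed.

End path_space.

(** * The Markov property of the quenched law *)

Section markov.
Context (R : realType) (d : nat).
Implicit Types (s : nat -> state d) (w : env R d) (x : paths d).

Definition splice (n : nat) s (a : int) (t : nat -> state d) : nat -> state d :=
  fun k => if (k <= n)%N then s k else ((t (k - n)%N).1 + a, (t (k - n)%N).2).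

Lemma quenched_cylE w m (mu : set (paths d) -> \bar R) n s : is_quenched_law w m mu ->
  mu (cyl n s) = (init m (s 0%N) * \prod_(k < n) trans w (s k) (s k.+1))%:E.
Proof. exact. Qed.

Lemma quenched_cyl_fin w m (mu : set (paths d) -> \bar R) n s : is_quenched_law w m mu ->
  mu (cyl n s) = (fine (mu (cyl n s)))%:E.
Proof. by move=> h; rewrite (quenched_cylE n s h). Qed.

Lemma markov_cyl w m m' (mu nu : {measure set (paths d) -> \bar R}) n s a j :
  is_quenched_law w m mu -> is_quenched_law (shiftn a w) m' nu -> s n = (a, j) ->
  forall l t, (mu (cyl n s `&` recenter n a @^-1` cyl l t) * (m' 0 j)%:E =
    mu (cyl n s) * nu (cyl l t `&` [set x | x 0%N = (0 : int, j)]))%E.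
Proof.
move=> hmu hnu sn l t; case: (t 0%N =P (0 : int, j)) => [t0|t0]; last first.
  rewrite (_ : _ `&` _ = set0); last first.
    apply/seteqP; split => // x [/(_ n (leqnn n)) xn /(_ 0%N isT)].
    by rewrite /recenter addn0 xn sn/= subrr => /esym.
  rewrite (_ : cyl l t `&` _ = set0) ?measure0 ?mule0 ?mul0e//.
  by apply/seteqP; split => // x [/(_ 0%N isT) xt /= x0]; apply: t0; rewrite -xt.
rewrite (_ : cyl l t `&` _ = cyl l t); last first.
  by apply/seteqP; split => [x []//|x xt]; split => //=; rewrite -t0; exact: xt.
rewrite (_ : _ `&` _ = cyl (n + l) (splice n s a t)); last first.
  apply/seteqP; split => x.
    move=> [xs xt] k kl; rewrite /splice; case: leqP => [kn|nk]; first exact: xs.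
    rewrite -xt ?leq_subLR// /recenter/= subnKC ?(ltnW nk)// subrK.
    by rewrite -surjective_pairing.
  move=> xg; split => k kn.
    by rewrite xg ?(leq_trans kn (leq_addr _ _))// /splice kn.
  rewrite /recenter; case: k kn => [|k] kn.
    by rewrite addn0 xg ?leq_addr// /splice leqnn sn t0/= subrr.
  rewrite xg ?leq_add2l// /splice leqNgt addnS ltnS leq_addr/= addrK.
  by rewrite -addnS addKn -surjective_pairing.
rewrite !(quenched_cylE _ _ hmu) (quenched_cylE _ _ hnu) -!EFinM; congr EFin.
have -> : init m' (t 0%N) = m' 0 j by rewrite t0 /init eqxx.
rewrite big_split_ord/=.
have -> : \prod_(k < n) trans w (splice n s a t k) (splice n s a t k.+1) =
          \prod_(k < n) trans w (s k) (s k.+1).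
  by apply: eq_bigr => k _; rewrite /splice ltn_ord ltnW.
have -> : \prod_(k < l) trans w (splice n s a t (n + k)%N) (splice n s a t (n + k).+1) =
          \prod_(k < l) trans (shiftn a w) (t k) (t k.+1).
  apply: eq_bigr => k _; rewrite trans_shiftn; congr trans; last first.
    by rewrite /splice leqNgt ltnS leq_addr/= -addnS addKn.
  rewrite /splice; case: leqP => [|_]; last by rewrite addKn.
  rewrite -[X in (_ <= X)%N]addn0 leq_add2l leqn0 => /eqP k0.
  by rewrite k0 addn0 sn t0/= add0r.
by rewrite /splice/=; ring.
Qed.

(** Both sides are finite measures in D, and they agree on cylinders by the product
    formula. Multiplication by the initial weight avoids a division that would need
    it to be positive. *)
Lemma markov_property w m m' (mu nu : {measure set (paths d) -> \bar R}) n s a j :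
  is_quenched_law w m mu -> is_quenched_law (shiftn a w) m' nu ->
  nu setT = 1%E -> 0 <= m' 0 j -> s n = (a, j) ->
  forall D, measurable D -> (mu (cyl n s `&` recenter n a @^-1` D) * (m' 0 j)%:E =
    mu (cyl n s) * nu (D `&` [set x | x 0%N = (0 : int, j)]))%E.
Proof.
move=> hmu hnu nu1 m'0 sn.
have mc := measurable_cyl n s.
have m0 : measurable [set x : paths d | x 0%N = (0 : int, j)].
  exact: (measurable_coord 0 (fun b => b = _)).
have c0 : 0 <= fine (mu (cyl n s)) by rewrite fine_ge0.
pose m1 := mscale (NngNum m'0) (measure_function_pushforward__canonical__measure_function_Measure
  (mrestr mu mc) (@measurable_recenter d n a)).
pose m2 := mscale (NngNum c0) (mrestr nu m0).
have E : forall D, measurable D -> m1 D = m2 D.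
  apply: paths_measure_unique => [l t|].
    rewrite /m1 /m2 /= /mscale /= /pushforward /mrestr setIC muleC.
    by rewrite (markov_cyl hmu hnu sn) (quenched_cyl_fin n s hmu) setIC.
  rewrite /m1 /= /mscale/= /pushforward /mrestr preimage_setT setTI.
  by rewrite (quenched_cyl_fin n s hmu) -EFinM ltry.
move=> D mD; have := E D mD.
rewrite /m1 /m2 /= /mscale /= /pushforward /mrestr setIC muleC => ->.
by rewrite -(quenched_cyl_fin n s hmu) setIC.
Qed.

End markov.

Section neighbours.
Context (R : realType) (d : nat) (w : env R d).
Implicit Types (s : nat -> state d).

(** The 3 (d + 1) possible successors of a: the first index minus one is the change
    of layer. *)
Definition nbr (a : state d) (p : 'I_3 * 'I_d.+1) : state d :=
  (a.1 + (p.1 : nat)%:Z - 1, p.2).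

Lemma nbr_inj a : injective (nbr a).
Proof.
move=> [p i] [q j] [/eqP]; rewrite subr_eq subrK (inj_eq (addrI _)) => /eqP [/ord_inj ->].
by move=> ->.
Qed.

Lemma step_nbr (f : state d -> R) a :
  step w f a = \sum_p trans w a (nbr a p) * f (nbr a p).
Proof.
rewrite -(pair_big xpredT xpredT (fun p j => trans w a (nbr a (p, j)) * f (nbr a (p, j))))/=.
rewrite (big_ord_recl 2) (big_ord_recl 1) (big_ord_recl 0) big_ord0 addr0.
rewrite /step !big_split/=.
rewrite addrC [X in _ + X = _]addrC; congr (_ + (_ + _)); apply: eq_bigr => j _;
  rewrite /nbr /trans /= /bump /=.
- rewrite (_ : a.1 + _ - 1 = a.1 - 1) ?eqxx; last lia.
  rewrite (_ : (a.1 - 1 == a.1 + 1) = false); last by apply/eqP; lia.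
  by rewrite (_ : (a.1 - 1 == a.1) = false)//; apply/eqP; lia.
- rewrite (_ : a.1 + _ - 1 = a.1) ?eqxx; last lia.
  by rewrite (_ : (a.1 == a.1 + 1) = false)//; apply/eqP; lia.
- by rewrite (_ : a.1 + _ - 1 = a.1 + 1) ?eqxx//; lia.
Qed.

Lemma trans_sum1 a : \sum_p trans w a (nbr a p) = 1.
Proof.
rewrite -[RHS](step_cst w 1 a) step_nbr; apply: eq_bigr => p _.
by rewrite mulr1.
Qed.

Definition extend n s (b : state d) : nat -> state d :=
  fun k => if (k <= n)%N then s k else b.

Lemma extend_last n s b : extend n s b n.+1 = b.
Proof. by rewrite /extend ltnn. Qed.

Lemma cyl_extend n s b : cyl n.+1 (extend n s b) = cyl n s `&` [set x | x n.+1 = b].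
Proof.
apply/seteqP; split => x /=.
  move=> xe; split => [k kn|]; first by rewrite (xe k (leqW kn)) /extend kn.
  by rewrite (xe _ (leqnn _)) extend_last.
move=> [xs xb] k; rewrite leq_eqVlt => /orP[/eqP ->|]; first by rewrite extend_last.
by rewrite ltnS => kn; rewrite /extend kn (xs k kn).
Qed.

Definition near_step (x : paths d) : Prop :=
  forall k, (x k.+1).1 - 1 <= (x k).1 <= (x k.+1).1 + 1.

Lemma measurable_near_step k :
  measurable [set x : paths d | ~ ((x k.+1).1 - 1 <= (x k).1 <= (x k.+1).1 + 1)].
Proof.
have -> : [set x : paths d | ~ ((x k.+1).1 - 1 <= (x k).1 <= (x k.+1).1 + 1)] =
  \bigcup_(b : int * 'I_d.+1) ([set x : paths d | x k.+1 = b] `&`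
    [set x : paths d | ~ (b.1 - 1 <= (x k).1 <= b.1 + 1)]).
  apply/seteqP; split => [x /= H|x [b _ /= [-> //]]].
  by exists (x k.+1 : int * 'I_d.+1).
apply: (@bigcup_countType (int * 'I_d.+1)%type) => b; apply: measurableI.
  exact: (measurable_coord k.+1 (fun c => c = b)).
exact: (measurable_coord k (fun c => ~ (b.1 - 1 <= c.1 <= b.1 + 1))).
Qed.

End neighbours.

Section stopped_walk.
Context (R : realType) (d : nat) (w : env R d) (m : 'rV[R]_d.+1).
Context (mu : {measure set (paths d) -> \bar R}).
Hypothesis hmu : is_quenched_law w m mu.
Hypothesis mu1 : mu setT = 1%E.
Hypothesis mp : probvec m.
Implicit Types (s : nat -> state d).

Lemma quenched_extend n s b :
  mu (cyl n.+1 (extend n s b)) = (mu (cyl n s) * (trans w (s n) b)%:E)%E.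
Proof.
rewrite !(quenched_cylE _ _ hmu) big_ord_recr/= -EFinM mulrA extend_last.
rewrite /extend leq0n leqnn; congr (EFin (_ * _ * _)).
by apply: eq_bigr => k _; rewrite ltn_ord ltnW.
Qed.

(** The part of C not covered by the A i is null, so it may be ignored on any E. *)
Lemma mass_partition (I : finType) (C E : set (paths d)) (A : I -> set (paths d)) :
  measurable C -> measurable E -> (forall i, measurable (A i)) ->
  (forall i, A i `<=` C) -> (forall i j x, A i x -> A j x -> i = j) ->
  mu C = (\sum_i mu (A i))%E ->
  mu (C `&` E) = (\sum_i mu (A i `&` E))%E.
Proof.
move=> mC mE mA AC dA CE.
have bU (B : I -> set (paths d)) : (forall i, measurable (B i)) ->
    (forall i j x, B i x -> B j x -> i = j) ->
    mu (\bigcup_i B i) = (\sum_i mu (B i))%E.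
  move=> mB dB; rewrite [RHS]fsbig_seq ?index_enum_uniq//.
  rewrite (_ : [set` index_enum I] = setT); last first.
    by apply/seteqP; split => // i _ /=; rewrite mem_index_enum.
  rewrite measure_fin_bigcup //; first exact: finite_finset.
  by move=> i j _ _ [x [Bi Bj]]; exact: dB Bi Bj.
have mUA : measurable (\bigcup_i A i).
  by apply: (@bigcup_countType I) => i.
have N0 : mu (C `\` \bigcup_i A i) = 0%E.
  rewrite measureD//; last by rewrite (le_lt_trans _ _ (y := mu setT)) ?le_measure ?inE// mu1 ltry.
  rewrite (setIidr (bigcup_sub _)); last by move=> i _; exact: AC.
  transitivity (mu C - mu C)%E; first by congr (_ - _)%E; rewrite CE; exact: bU.
  rewrite subee// ge0_fin_numE// (le_lt_trans _ (ltry 1))// -mu1 le_measure ?inE//.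
have mCE : measurable (C `&` E) by exact: measurableI.
have -> : mu (C `&` E) = (mu ((C `&` E) `\` \bigcup_i A i) + mu ((C `&` E) `&` \bigcup_i A i))%E.
  exact: measureDI.
rewrite (_ : mu (_ `\` _) = 0%E) ?add0e; last first.
  apply/eqP; rewrite eq_le measure_ge0 andbT -N0.
  apply: le_measure; rewrite ?inE; [exact: measurableD|exact: measurableD|].
  by move=> x [[Cx Ex] nU].
rewrite -(bU (fun i => A i `&` E)) => [|i|i j x [Ai _] [Aj _]]; [|exact: measurableI|exact: dA Ai Aj].
congr (mu _); apply/seteqP; split => [x [[Cx Ex] [i _ Ai]]|x [i _ [Ai Ex]]].
  by exists i.
by split; [split => //; exact: AC Ai|exists i].
Qed.

(** The neighbours carry all the mass by [trans_sum1]. *)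
Lemma quenched_step n s (E : set (paths d)) : measurable E ->
  mu (cyl n s `&` E) = (\sum_p mu (cyl n.+1 (extend n s (nbr (s n) p)) `&` E))%E.
Proof.
move=> mE; apply: mass_partition => //; try exact: measurable_cyl.
- by move=> p; exact: measurable_cyl.
- by move=> p; rewrite cyl_extend => x [].
- move=> p q x; rewrite !cyl_extend => -[_ /= ->] [_ /= /nbr_inj]; exact.
- under eq_bigr do rewrite quenched_extend (quenched_cyl_fin n s hmu) -EFinM.
  by rewrite sumEFin -mulr_sumr trans_sum1 mulr1 -(quenched_cyl_fin n s hmu).
Qed.

Lemma quenched_start (E : set (paths d)) : measurable E ->
  mu E = (\sum_i mu (cyl 0 (fun=> (0 : int, i)) `&` E))%E.
Proof.
move=> mE; rewrite -[in LHS](setTI E); apply: mass_partition => //.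
- by move=> p; exact: measurable_cyl.
- by move=> i j x /(_ 0%N isT) xi /(_ 0%N isT); rewrite xi => -[].
- under eq_bigr do rewrite (quenched_cylE _ _ hmu) big_ord0 mulr1 /init/=.
  by have /stochasticP[_ /(_ 0) m1] := mp; rewrite sumEFin m1 mu1.
Qed.

(** The path counterpart of [stopped]: Ev is tested at time n + t, or at the first
    time after n at which layer M is reached. *)
Fixpoint stopped_event (M : int) (Ev : nat -> set (paths d)) (t n : nat) : set (paths d) :=
  if t is t'.+1 then
    [set x | ((x n).1 < M /\ stopped_event M Ev t' n.+1 x) \/ (M <= (x n).1 /\ Ev n x)]
  else Ev n.

Lemma measurable_stopped_event M Ev t n : (forall k, measurable (Ev k)) ->
  measurable (stopped_event M Ev t n).
Proof.
move=> mE; elim: t n => [|t IH] n //=.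
apply: measurableU; apply: measurableI => //.
  exact: (measurable_coord n (fun b => b.1 < M)).
exact: (measurable_coord n (fun b => M <= b.1)).
Qed.

(** If the conditional probability of Ev n given the past depends only on the current
    state, through f, then stopping turns f into [stopped M f]. *)
Lemma quenched_stopped M Ev (f : state d -> R) : (forall k, measurable (Ev k)) ->
  (forall n s, mu (cyl n s `&` Ev n) = (mu (cyl n s) * (f (s n))%:E)%E) ->
  forall t n s, mu (cyl n s `&` stopped_event M Ev t n) =
    (mu (cyl n s) * (stopped w M f t (s n))%:E)%E.
Proof.
move=> mE hE; elim=> [|t IH] n s //=.
have [lt_sM|ge_sM] := ltP (s n).1 M.
  rewrite (_ : _ `&` _ = cyl n s `&` stopped_event M Ev t n.+1); last first.
    apply/seteqP; split => x [xs xE]; split => //; last by left; rewrite xs.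
    by move: xE; rewrite /= xs// leNgt lt_sM => -[[]|[]].
  rewrite quenched_step; last exact: measurable_stopped_event.
  under eq_bigr do rewrite IH quenched_extend extend_last (quenched_cyl_fin n s hmu) -!EFinM -mulrA.
  by rewrite sumEFin -mulr_sumr -step_nbr EFinM -(quenched_cyl_fin n s hmu).
rewrite -hE; congr (mu _); apply/seteqP; split => x [xs xE]; split => //.
  by move: xE; rewrite /= xs// ltNge ge_sM => -[[]|[]].
by right; rewrite xs.
Qed.

Lemma quenched_stopped0 M Ev (f : state d -> R) : (forall k, measurable (Ev k)) ->
  (forall n s, mu (cyl n s `&` Ev n) = (mu (cyl n s) * (f (s n))%:E)%E) ->
  forall t, mu (stopped_event M Ev t 0) =
    (\sum_i m 0 i * stopped w M f t (0, i))%:E.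
Proof.
move=> mE hE t; rewrite quenched_start; last exact: measurable_stopped_event.
rewrite -sumEFin; apply: eq_bigr => i _; rewrite (quenched_stopped M mE hE).
by rewrite (quenched_cylE _ _ hmu) big_ord0 mulr1 /init/= -EFinM.
Qed.

(** There are only countably many initial segments. *)
Lemma null_of_cyl n (E : set (paths d)) : measurable E ->
  (forall s, mu (cyl n s `&` E) = 0%E) -> mu.-negligible E.
Proof.
move=> mE h; pose T0 := (int * 'I_d.+1)%type; pose a0 : T0 := (0, ord0).
pose F k := if (unpickle k : option (seq T0)) is Some l then cyl n (nth a0 l) `&` E else set0.
apply: (@negligibleS _ _ _ _ (\bigcup_k F k)).
  move=> x Ex; pose l : seq T0 := mkseq (x : nat -> T0) n.+1.
  exists (pickle l) => //; rewrite /F pickleK; split => // k kn.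
  by rewrite nth_mkseq// ltnS.
apply: negligible_bigcup => k; rewrite /F; case: (unpickle k : option (seq T0)) => [l|].
  apply/negligibleP; last exact: h.
  by apply: measurableI => //; exact: measurable_cyl.
exact: negligible_set0.
Qed.

(** Given an initial segment, all mass lies on the neighbours of its endpoint. *)
Lemma quenched_near_step : {ae mu, forall x, near_step x}.
Proof.
apply: (@ae_foralln _ _ _ mu (fun k x => (x k.+1).1 - 1 <= (x k).1 <= (x k.+1).1 + 1)) => k.
apply: (@null_of_cyl k); first exact: measurable_near_step.
move=> s; rewrite quenched_step; last exact: measurable_near_step.
apply: big1 => p _; rewrite (_ : _ `&` _ = set0) ?measure0//.
apply/seteqP; split => // x [xe /=]; apply.
have -> : x k = s k by rewrite (xe k (leqnSn k)) /extend leqnn.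
have -> : x k.+1 = nbr (s k) p by rewrite (xe k.+1 (leqnn _)) extend_last.
have : (p.1 < 3)%N := ltn_ord p.1.
by rewrite /nbr/=; lia.
Qed.

Lemma quenched_start0 : {ae mu, forall x, (x 0%N).1 = 0}.
Proof.
have mE : measurable [set x : paths d | (x 0%N).1 != 0].
  exact: (measurable_coord 0 (fun b => b.1 != 0)).
exists [set x : paths d | (x 0%N).1 != 0]; split => //; last by move=> x /eqP.
rewrite quenched_start//; apply: big1 => i _.
rewrite (_ : _ `&` _ = set0) ?measure0//; apply/seteqP; split => // x.
by move=> [/(_ 0%N isT) x0 /=]; rewrite x0.
Qed.

(** An event that forces the layer to be at least M can only occur at the time of the
    first visit to M or above. *)
Lemma stopped_eventP M Ev t n (x : paths d) : (forall k, Ev k x -> M <= (x k).1) ->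
  stopped_event M Ev t n x <->
  exists2 k, (k <= t)%N & (forall i, (i < k)%N -> (x (n + i)%N).1 < M) /\ Ev (n + k)%N x.
Proof.
move=> hE; elim: t n => [|t IH] n.
  split=> [nx|[k]]; last by rewrite leqn0 => /eqP -> []; rewrite addn0.
  by exists 0%N => //; rewrite addn0.
split=> [/= [[nx /IH[k kt [ik Ek]]]|[Mx En]]|].
- exists k.+1 => //; split; last by rewrite addnS -addSn.
  by case=> [|i] ki; rewrite ?addn0// addnS -addSn; exact: ik.
- by exists 0%N => //; rewrite addn0.
move=> [[|k] kt [ik Ek]] /=; first by right; rewrite addn0 in Ek; split => //; exact: hE.
left; split; first by have := ik 0%N isT; rewrite addn0.
by apply/IH; exists k => //; split=> [i lt_ik|]; rewrite addSn -addnS//; exact: ik.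
Qed.

Lemma quenched_survival M t :
  mu [set x | forall k, (k <= t)%N -> (x k).1 < M] =
  (\sum_i m 0 i * survival w M t (0, i))%:E.
Proof.
pose Ev n := [set x : paths d | (x n).1 < M].
rewrite -(@quenched_stopped0 M Ev).
- congr (mu _).
  have E n x : stopped_event M Ev t n x <-> forall k, (k <= t)%N -> (x (n + k)%N).1 < M.
    elim: t n => [|t IH] n /=.
      by split=> [nx k|/(_ 0%N isT)]; rewrite ?addn0// leqn0 => /eqP ->; rewrite addn0.
    split=> [[[nx /IH h]|[]]|h].
    + by case=> [|k] kt; rewrite ?addn0// addnS -addSn; exact: h.
    + by rewrite /Ev/= => ge /(le_lt_trans ge); rewrite ltxx.
    + left; split; first by have := h 0%N isT; rewrite addn0.
      by apply/IH => k kt; rewrite addSn -addnS; exact: h.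
  by apply/seteqP; split => x h; [apply/(E 0%N)|exact: (E 0%N x).1 h].
- by move=> k; exact: (measurable_coord k (fun b => b.1 < M)).
move=> n s; rewrite (_ : cyl n s `&` _ = if (s n).1 < M then cyl n s else set0); last first.
  apply/seteqP; split => x; first by move=> [xs]; rewrite /Ev/= xs// => ->.
  by case: ifP => // sM xs; split => //; rewrite /Ev/= xs.
by case: ifP => _; rewrite ?mule1// measure0 mule0.
Qed.

End stopped_walk.

(** * The first crossing to layer 1 *)

Section first_crossing.
Context (R : realType) (d : nat).
Implicit Types (x : paths d).

Definition crosses_at x (k : nat) : Prop :=
  (forall i, (i < k)%N -> (x i).1 < 1) /\ 1 <= (x k).1.

(** The time of the first visit to layer 1 or above; 0 is a default value for paths
    that stay below layer 1. *)
Definition tau x : nat :=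
  if pselect (exists k, 1 <= (x k).1) is left h then ex_minn h else 0%N.

Lemma tauP x : (exists k, 1 <= (x k).1) -> crosses_at x (tau x).
Proof.
rewrite /tau; case: pselect => // h _; case: ex_minnP => k xk min; split => // i ik.
by rewrite ltNge; apply/negP => /min; rewrite leqNgt ik.
Qed.

Lemma tauE x k : crosses_at x k -> tau x = k.
Proof.
move=> [xk k1]; have [xt t1] := tauP (ex_intro _ k k1).
case: (ltngtP (tau x) k) => // h.
  by have := xk _ h; rewrite ltNge t1.
by have := xt _ h; rewrite ltNge k1.
Qed.

Definition restart x : paths d := recenter (tau x) 1 x.

Lemma measurable_crosses_at k : measurable [set x | crosses_at x k].
Proof.
rewrite (_ : [set x | _] = [set x : paths d | forall i,
    if (i < k)%N then (x i).1 < 1 else (i == k) ==> (1 <= (x i).1)]).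
  exact: (measurable_coords (fun i b => if (i < k)%N then b.1 < 1 else (i == k) ==> (1 <= b.1))).
apply/seteqP; split => x /=.
  by move=> [xk k1] i; case: ltngtP => [/xk||->].
move=> h; split=> [i ik|]; first by have := h i; rewrite ik.
by have := h k; rewrite ltnn eqxx.
Qed.

Lemma restart_preE (D : set (paths d)) : restart @^-1` D =
  (\bigcup_k ([set x | crosses_at x k] `&` recenter k 1 @^-1` D)) `|`
  (~` (\bigcup_k [set x | crosses_at x k]) `&` recenter 0 1 @^-1` D).
Proof.
apply/seteqP; split => x.
  have [h|h] := pselect (exists k, 1 <= (x k).1).
    by move=> Dx; left; exists (tau x) => //; split => //; exact: tauP.
  rewrite /restart /=; have -> : tau x = 0%N by rewrite /tau; case: pselect.
  move=> Dx; right; split => // -[k _ [_ k1]]; apply: h; by exists k.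
case=> [[k _ [/tauE <- //]]|[h Dx]].
rewrite /restart/=; have -> // : tau x = 0%N.
by rewrite /tau; case: pselect => // h'; case: h; exists (tau x) => //; exact: tauP.
Qed.

Lemma measurable_restart : measurable_fun setT restart.
Proof.
move=> _ D mD; rewrite setTI restart_preE; apply: measurableU.
  apply: bigcupT_measurable => k; apply: measurableI; first exact: measurable_crosses_at.
  exact: measurable_recenter_pre.
apply: measurableI; last exact: measurable_recenter_pre.
by apply: measurableC; apply: bigcupT_measurable => k; exact: measurable_crosses_at.
Qed.

End first_crossing.

Section strong_markov.
Context (R : realType) (d : nat) (w : env R d) (m m' : 'rV[R]_d.+1) (Z : 'M[R]_d.+1).
Context (mu nu : {measure set (paths d) -> \bar R}).
Hypothesis hmu : is_quenched_law w m mu.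
Hypothesis mu1 : mu setT = 1%E.
Hypothesis mp : probvec m.
Hypothesis hnu : is_quenched_law (shiftn 1 w) m' nu.
Hypothesis nu1 : nu setT = 1%E.
Hypothesis m'p : probvec m'.
Hypothesis m'_gt0 : forall j, 0 < m' 0 j.
Hypothesis hitZ : forall i k, hit_prob w 1 k t (0, i) @[t --> \oo] --> Z i k.
Hypothesis mZ : m *m Z = m'.

Let Ev (D : set (paths d)) n := [set x : paths d | (x n).1 = 1] `&` recenter n 1 @^-1` D.

Let mEv D n : measurable D -> measurable (Ev D n).
Proof.
move=> mD; apply: measurableI; last exact: measurable_recenter_pre.
exact: (measurable_coord n (fun b => b.1 = 1)).
Qed.

Let nuF (D : set (paths d)) : measurable D -> nu D = (fine (nu D))%:E.
Proof.
move=> mD; rewrite fineK// ge0_fin_numE// (le_lt_trans _ (ltry 1))// -nu1.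
by apply: le_measure; rewrite ?inE.
Qed.

Let m0 j : measurable [set x : paths d | x 0%N = (0 : int, j)].
Proof. exact: (measurable_coord 0 (fun b => b = _)). Qed.

Let f D (b : state d) : R := if b.1 == 1 then
  fine (nu (D `&` [set x | x 0%N = (0 : int, b.2)])) / m' 0 b.2 else 0.

Lemma hit_after (D : set (paths d)) : measurable D -> forall n s,
  mu (cyl n s `&` Ev D n) = (mu (cyl n s) * (f D (s n))%:E)%E.
Proof.
move=> mD n s; rewrite /f; case: eqP => [s1|s1]; last first.
  rewrite mule0 (_ : _ `&` _ = set0) ?measure0//.
  by apply/seteqP; split => // x [/(_ n (leqnn n)) xs [/= x1 _]]; apply: s1; rewrite -xs.
have sn : s n = (1, (s n).2) by rewrite -s1 -surjective_pairing.
have := markov_property hmu hnu nu1 (ltW (m'_gt0 _)) sn mD.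
rewrite (_ : cyl n s `&` Ev D n = cyl n s `&` recenter n 1 @^-1` D); last first.
  apply/seteqP; split => x [xs]; first by move=> [].
  by move=> Dx; split => //; split => //=; rewrite xs.
have mc : measurable (cyl n s `&` recenter n 1 @^-1` D).
  by apply: measurableI; [exact: measurable_cyl|exact: measurable_recenter_pre].
have fin : mu (cyl n s `&` recenter n 1 @^-1` D) \is a fin_num.
  rewrite ge0_fin_numE// (le_lt_trans _ (ltry 1))// -mu1.
  by apply: le_measure; rewrite ?inE.
rewrite -(fineK fin) (quenched_cyl_fin n s hmu) nuF; last exact: measurableI.
rewrite -!EFinM => -[] E; congr EFin.
by rewrite mulrA -E mulfK// gt_eqF.
Qed.

(** The hitting probabilities of the points of layer 1 add up to m', and f D is the
    conditional probability of D given the hitting point. *)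
Lemma hit_after_total (D : set (paths d)) : measurable D ->
  mu (\bigcup_t stopped_event 1 (Ev D) t 0) = nu D.
Proof.
move=> mD.
have mS t : measurable (stopped_event 1 (Ev D) t 0).
  by apply: measurable_stopped_event => k; exact: mEv.
have EvP x k : Ev D k x -> 1 <= (x k).1 by case=> /= ->.
have H1 : mu (stopped_event 1 (Ev D) t 0) @[t --> \oo] -->
          mu (\bigcup_t stopped_event 1 (Ev D) t 0).
  apply: nondecreasing_cvg_mu => //; first exact: bigcupT_measurable.
  move=> s t st; apply/subsetPset => x.
  move=> /(stopped_eventP _ _ (EvP x)) [k ks h].
  by apply/(stopped_eventP _ _ (EvP x)); exists k => //; exact: leq_trans st.
have H2 : mu (stopped_event 1 (Ev D) t 0) @[t --> \oo] --> nu D.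
  under eq_cvg do rewrite (quenched_stopped0 hmu mu1 mp 1 (fun k => mEv k mD) (hit_after mD)).
  have -> : nu D = (\sum_k f D (1, k) * m' 0 k)%:E.
    rewrite (quenched_start hnu nu1 m'p mD) -sumEFin; apply: eq_bigr => k _.
    rewrite /f eqxx/= divfK ?gt_eqF// -nuF; last exact: measurableI.
    congr (nu _); apply/seteqP; split => x /=.
      by move=> [/(_ 0%N isT) /= x0 Dx].
    by move=> [Dx x0]; split => // i; rewrite leqn0 => /eqP ->.
  apply/fine_cvgP; split; first by apply: nearW.
  rewrite [fine \o _](_ : _ = fun t => \sum_i \sum_k m 0 i * (f D (1, k) * hit_prob w 1 k t (0, i))); last first.
    apply/funext => t /=; apply: eq_bigr => i _; rewrite -mulr_sumr; congr (_ * _).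
    apply: stopped_hit_prob => // b b1; rewrite /f; case: eqP => // E.
    by move: b1; rewrite E ltxx.
  rewrite (_ : \sum_k _ = \sum_i \sum_k m 0 i * (f D (1, k) * Z i k)); last first.
    rewrite exchange_big; apply: eq_bigr => k _ /=; rewrite -mZ mxE mulr_sumr.
    by apply: eq_bigr => i _; ring.
  apply: cvg_sumr => i; apply: cvg_sumr => k.
  apply: cvgM; first exact: cvg_cst.
  by apply: cvgM; [exact: cvg_cst|exact: hitZ].
exact: cvg_unique H1 H2.
Qed.

Let H := \bigcup_t stopped_event 1 (Ev setT) t 0.

Let mH : measurable H.
Proof. by apply: bigcupT_measurable => t; apply: measurable_stopped_event => k; exact: mEv. Qed.

Let HC0 : mu (~` H) = 0%E.
Proof.
have -> : mu (~` H) = (mu setT - mu (setT `&` H))%E.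
  rewrite -setTD; apply: measureD => //.
  by rewrite [X in (X < _)%E]mu1 ltry.
by rewrite setTI hit_after_total// mu1 nu1 subee.
Qed.

Let EvP D x k : Ev D k x -> 1 <= (x k).1. Proof. by case=> /= ->. Qed.

Let H_crosses x : H x -> exists2 k, crosses_at x k & (x k).1 = 1.
Proof.
move=> [t _] /(stopped_eventP _ _ (@EvP setT x))[k _ [xk [/= x1 _]]].
by exists k => //; split; rewrite ?x1.
Qed.

Lemma crossing_ae : {ae mu, forall x, exists2 k, crosses_at x k & (x k).1 = 1}.
Proof.
exists (~` H); split; [exact: measurableC|exact: HC0|].
by move=> x; apply: contra_not => /H_crosses.
Qed.

(** By the Markov property at the times t at which layer 1 can be hit, the image law
    is a mixture of the laws of the shifted environment, weighted by the hitting
    distribution m *m Z, which is the initial distribution m' of that environment. *)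
Lemma restart_law (D : set (paths d)) : measurable D -> mu (restart (d:=d) @^-1` D) = nu D.
Proof.
move=> mD; rewrite -(hit_after_total mD).
set A := _ @^-1` D; set B := \bigcup_t _.
have mA : measurable A by rewrite -[A]setTI; exact: measurable_restart.
have AB : A `&` H = B.
  apply/seteqP; split => x.
    move=> [Ax [t _]] /(stopped_eventP _ _ (@EvP setT x))[k kt [xk [/= x1 _]]].
    exists t => //; apply/(stopped_eventP _ _ (@EvP D x)); exists k => //.
    split => //; split => //=; move: Ax; rewrite /A/= /restart.
    by rewrite (@tauE _ x k)//; split; rewrite ?x1.
  move=> [t _] /(stopped_eventP _ _ (@EvP D x))[k kt [xk [/= x1 Dx]]]; split.
    by rewrite /A/= /restart (@tauE _ x k)//; split; rewrite ?x1.
  by exists t => //; apply/(stopped_eventP _ _ (@EvP setT x)); exists k.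
have -> : mu A = (mu (A `\` H) + mu (A `&` H))%E by exact: measureDI.
rewrite AB (_ : mu (A `\` H) = 0%E) ?add0e//.
apply/eqP; rewrite eq_le measure_ge0 andbT -HC0; apply: le_measure; rewrite ?inE//.
- exact: measurableD.
- exact: measurableC.
Qed.

End strong_markov.

(** * The maximal ergodic lemma *)

Section maximal_ergodic.
Context d0 (T : measurableType d0) (R : realType) (mu : probability T R).
Context (phi : T -> T) (mphi : measurable_fun setT phi).
Hypothesis phi_mu : forall A, measurable A -> mu (phi @^-1` A) = mu A.

Lemma ge0_integral_preserving (g : T -> \bar R) : measurable_fun setT g ->
  (forall x, (0 <= g x)%E) -> (\int[mu]_x g (phi x) = \int[mu]_x g x)%E.
Proof.
move=> mg g0.
pose nu := measure_function_pushforward__canonical__measure_function_Measure mu mphi.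
have -> : (\int[mu]_x g x = \int[nu]_x g x)%E.
  by apply: eq_measure_integral => A mA _; rewrite /nu/= /pushforward phi_mu.
by rewrite /nu ge0_integral_pushforward.
Qed.

Lemma integrable_preserving (g : T -> R) : mu.-integrable setT (EFin \o g) ->
  mu.-integrable setT (EFin \o (g \o phi)).
Proof.
move=> /integrableP[mg goo]; apply/integrableP; split.
  exact: (measurableT_comp mg mphi).
rewrite (_ : (\int[mu]_x _)%E = (\int[mu]_x `|(EFin \o g) x|)%E)//.
by rewrite -(@ge0_integral_preserving (fun x => `|(EFin \o g) x|%E))//; exact: measurableT_comp.
Qed.

Lemma integral_preserving (g : T -> R) : mu.-integrable setT (EFin \o g) ->
  (\int[mu]_x (g (phi x))%:E = \int[mu]_x (g x)%:E)%E.
Proof.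
move=> ig; have mg := measurable_int _ ig.
have ig' := integrable_preserving ig.
pose nu := measure_function_pushforward__canonical__measure_function_Measure mu mphi.
have -> : (\int[mu]_x (g x)%:E = \int[nu]_x (g x)%:E)%E.
  by apply: eq_measure_integral => A mA _; rewrite /nu/= /pushforward phi_mu.
by rewrite /nu (integral_pushforward mphi mg).
Qed.

Context (f : T -> R).
Hypothesis fint : mu.-integrable setT (EFin \o f).

Fixpoint birkhoff_sum (n : nat) (x : T) : R :=
  if n is k.+1 then f x + birkhoff_sum k (phi x) else 0.

(** The maximum of the Birkhoff sums of orders 0 to n, by a recursion that makes the
    inequality in [birkhoff_max_le] immediate. *)
Fixpoint birkhoff_max (n : nat) (x : T) : R :=
  if n is k.+1 then Num.max 0 (f x + birkhoff_max k (phi x)) else 0.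

Let mf : measurable_fun setT f.
Proof. exact/measurable_EFinP/(measurable_int _ fint). Qed.

Lemma birkhoff_max_ge0 n x : 0 <= birkhoff_max n x.
Proof. by case: n => //= n; rewrite le_max lexx. Qed.

Lemma birkhoff_max_ndS n x : birkhoff_max n x <= birkhoff_max n.+1 x.
Proof.
elim: n x => [|n IH] x; first exact: birkhoff_max_ge0.
by rewrite /= ge_max le_max lexx/= le_max lerD2l IH orbT.
Qed.

Lemma birkhoff_sum_le_max n k x : (n <= k)%N -> birkhoff_sum n x <= birkhoff_max k x.
Proof.
elim: n k x => [|n IH] k x; first by rewrite birkhoff_max_ge0.
by case: k => //= k nk; rewrite le_max lerD2l IH ?orbT.
Qed.

Lemma integrable_birkhoff_max n : mu.-integrable setT (EFin \o birkhoff_max n).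
Proof.
elim: n => [|n IH]; first exact: integrable0.
have i2 : mu.-integrable setT (EFin \o (fun x => f x + birkhoff_max n (phi x))).
  exact: (integrableD measurableT fint (integrable_preserving IH)).
apply: (le_integrable measurableT _ _ i2).
  apply/measurable_EFinP/measurable_maxr => //.
  exact/measurable_EFinP/(measurable_int _ i2).
move=> x _ /=; rewrite lee_fin; case: (leP 0 (_ + _)) => // _.
by rewrite normr0.
Qed.

Lemma birkhoff_max_le n x : 0 < birkhoff_max n x ->
  birkhoff_max n x - birkhoff_max n (phi x) <= f x.
Proof.
case: n => [|n]; first by rewrite ltxx.
move=> /= h; have {}h : Num.max 0 (f x + birkhoff_max n (phi x)) = f x + birkhoff_max n (phi x).
  by move: h; case: (leP 0 (_ + _)) => //; rewrite ltxx.
by rewrite h lerBlDr lerD2l; exact: (birkhoff_max_ndS n).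
Qed.

Let pos n := [set x | 0 < birkhoff_max n x].

Let mM n : measurable_fun setT (birkhoff_max n).
Proof. exact/measurable_EFinP/(measurable_int _ (integrable_birkhoff_max n)). Qed.

Let mpos n : measurable (pos n).
Proof.
rewrite /pos -[X in measurable X]setTI.
have -> : [set x | 0 < birkhoff_max n x] = birkhoff_max n @^-1` `]0, +oo[%classic.
  by apply/seteqP; split => x /=; rewrite in_itv/= andbT.
exact: mM.
Qed.

Let g n x : R := f x * \1_(pos n) x.

Let mg n : measurable_fun setT (g n).
Proof. by apply: measurable_funM => //; exact: measurable_indic. Qed.

Let gint n : mu.-integrable setT (EFin \o g n).
Proof.
apply: (le_integrable measurableT _ _ fint); first exact/measurable_EFinP.
move=> x _ /=; rewrite lee_fin /g normrM ler_piMr// indicE.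
by case: (_ \in _); rewrite ?normr1 ?normr0.
Qed.

(** By [birkhoff_max_le], f restricted to the set where the maximum M is positive
    dominates M - M \o phi, whose integral vanishes. *)
Lemma integral_pos_ge0 n : (0 <= \int[mu]_x (g n x)%:E)%E.
Proof.
have iM := integrable_birkhoff_max n.
have -> : (0 = \int[mu]_x ((birkhoff_max n x)%:E - (birkhoff_max n (phi x))%:E))%E.
  rewrite (integralB_EFin measurableT iM (integrable_preserving iM)).
  by rewrite integral_preserving// subee//; exact: integrable_fin_num.
apply: le_integral => //.
- exact: (integrableB measurableT iM (integrable_preserving iM)).
- exact: gint.
move=> x _; rewrite -EFinB lee_fin /g indicE.
case: (ltP 0 (birkhoff_max n x)) => h.
  by rewrite mem_set// mulr1 birkhoff_max_le.
rewrite memNset ?mulr0; last by rewrite /pos/= ltNge h.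
by rewrite subr_le0 (le_trans h)// birkhoff_max_ge0.
Qed.

(** The sets where the maxima of order n are positive exhaust the space, so the
    integrals in [integral_pos_ge0] converge to that of f. *)
Theorem maximal_ergodic : {ae mu, forall x, exists n, 0 < birkhoff_sum n x} ->
  (0 <= \int[mu]_x (f x)%:E)%E.
Proof.
move=> hpos.
have [|||||_ _ cv] := @dominated_convergence _ _ _ mu setT measurableT
    (fun n x => (g n x)%:E) (EFin \o f) (fun x => `|f x|%:E).
- by move=> n; exact/measurable_EFinP.
- exact/measurable_EFinP.
- apply: filterS hpos => x [k hk] _.
    apply: cvg_near_cst; exists k => // n /= kn; rewrite /g indicE mem_set ?mulr1//.
    exact: lt_le_trans hk (birkhoff_sum_le_max _ kn).
- exact: integrable_abse fint.
- apply/nearW => x n _ /=; rewrite lee_fin /g normrM ler_piMr// indicE.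
    by case: (_ \in _); rewrite ?normr1 ?normr0.
rewrite -(cvg_lim _ cv)//; apply: lime_ge; first exact: cvgP cv.
by apply: nearW => n; exact: integral_pos_ge0.
Qed.

End maximal_ergodic.

(** * Asymptotic speed and recentring *)

Section speed_events.
Context (R : realType) (d : nat).
Implicit Types (x : paths d) (c : R).

(** Running infinitely far ahead of the line of slope 1 / c. *)
Definition fast c : set (paths d) :=
  [set x | forall C : nat, exists t : nat, C%:R <= c * (x t).1%:~R - t%:R].

(** The running maximum falls infinitely far behind the line of slope 1 / c. The
    maximum makes this a statement about hitting times: T_n - c n is unbounded above. *)
Definition slow c : set (paths d) :=
  [set x | forall C : nat, exists t : nat, forall k, (k <= t)%N ->
    c * (x k).1%:~R + C%:R <= t%:R].

Lemma measurable_fast c : measurable (fast c).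
Proof.
rewrite (_ : fast c = \bigcap_C \bigcup_t
  [set x : paths d | C%:R <= c * (x t).1%:~R - t%:R]).
  apply: bigcapT_measurable => C; apply: bigcupT_measurable => t.
  exact: (measurable_coord t (fun b => C%:R <= c * b.1%:~R - t%:R)).
apply/seteqP; split => x h C; first by have [t ht] := h C; exists t.
by have [t _ ht] := h C I; exists t.
Qed.

Lemma measurable_slow c : measurable (slow c).
Proof.
rewrite (_ : slow c = \bigcap_C \bigcup_t [set x : paths d | forall k, (k <= t)%N ->
    c * (x k).1%:~R + C%:R <= t%:R]).
  apply: bigcapT_measurable => C; apply: bigcupT_measurable => t.
  exact: (measurable_coords (fun k b => (k <= t)%N -> c * b.1%:~R + C%:R <= t%:R)).
apply/seteqP; split => x h C; first by have [t ht] := h C; exists t.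
by have [t _ ht] := h C I; exists t.
Qed.

Lemma nat_bound (r : R) : exists C : nat, r <= C%:R.
Proof.
exists (Num.bound `|r|); apply: (le_trans (ler_norm _)).
exact/ltW/archi_boundP.
Qed.

Lemma prefix_bound c x n : exists B : R, forall k, (k <= n)%N -> `|c * (x k).1%:~R| <= B.
Proof.
exists (\sum_(k < n.+1) `|c * (x k).1%:~R|) => k kn.
rewrite (bigD1 (Ordinal (kn : (k < n.+1)%N)))//= lerDl sumr_ge0//.
Qed.

(** Recentring removes finitely many steps and adds a constant to the position and
    to the time; an unbounded excess over a line does not feel this. *)
Lemma recenter_fast c n a x : fast c (recenter n a x) <-> fast c x.
Proof.
have E t : c * (recenter n a x t).1%:~R - t%:R =
    c * (x (n + t)%N).1%:~R - (n + t)%N%:R + (n%:R - c * a%:~R) :> R.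
  by rewrite /recenter/= intrB natrD; ring.
split => h C.
  have [C' hC'] := nat_bound (C%:R + (n%:R - c * a%:~R)).
  have [t] := h C'; rewrite E => ht; exists (n + t)%N; lra.
have [B hB] := prefix_bound c x n.
have [C' hC'] := nat_bound (C%:R + `|n%:R - c * a%:~R| + B + 1).
have [t ht] := h C'.
have [tn|nt] := leqP t n.
  have := hB t tn; have := ler_norm (c * (x t).1%:~R).
  have := normr_ge0 (n%:R - c * a%:~R).
  have : 0 <= t%:R :> R by []. have : 0 <= C%:R :> R by [].
  lra.
exists (t - n)%N; rewrite E subnKC ?(ltnW nt)//.
have := lerNnormlW (lexx `|n%:R - c * a%:~R|).
have := hB 0%N isT; have := normr_ge0 (c * (x 0%N).1%:~R).
lra.
Qed.

(** As for [recenter_fast]; the removed steps enter the running maximum, which they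
    change by at most a constant. *)
Lemma recenter_slow c n a x : slow c (recenter n a x) <-> slow c x.
Proof.
have E k : c * (recenter n a x k).1%:~R = c * (x (n + k)%N).1%:~R - c * a%:~R.
  by rewrite /recenter/= intrB mulrBr.
have [B hB] := prefix_bound c x n.
have Bge0 : 0 <= B by apply: le_trans (hB n (leqnn n)).
have ca1 := ler_norm (c * a%:~R).
have ca2 := lerNnormlW (lexx `|c * a%:~R|).
split => h C.
  have [C' hC'] := nat_bound (C%:R + `|c * a%:~R| + B + B).
  have [t ht] := h C'; exists (n + t)%N => k knt.
  have [kn|nk] := leqP k n; last first.
    have := ht (k - n)%N; rewrite leq_subLR E subnKC ?(ltnW nk)// => /(_ knt).
    by rewrite natrD; have : 0 <= n%:R :> R by []; lra.
  have := ht 0%N isT; rewrite E addn0 natrD.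
  have := hB k kn; have := ler_norm (c * (x k).1%:~R).
  have := hB n (leqnn n); have := lerNnormlW (lexx `|c * (x n).1%:~R|).
  have : 0 <= n%:R :> R by [].
  lra.
have [C' hC'] := nat_bound (C%:R + `|c * a%:~R| + n%:R + B).
have [t ht] := h C'.
have nt : (n <= t)%N.
  rewrite -(ler_nat R); have := ht 0%N isT.
  have := hB 0%N isT; have := lerNnormlW (lexx `|c * (x 0%N).1%:~R|).
  have : 0 <= C%:R :> R by []. have := normr_ge0 (c * a%:~R).
  lra.
exists (t - n)%N => k ktn; rewrite E natrB//.
have := ht (n + k)%N; rewrite -leq_subRL// => /(_ ktn).
lra.
Qed.

Lemma near_step_le x n k : near_step x -> (x n).1 - k%:Z <= (x (n + k)%N).1.
Proof.
move=> nx; elim: k => [|k IH]; first by rewrite addn0; lia.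
by have /andP[_] := nx (n + k)%N; rewrite addnS; lia.
Qed.

(** Let dl be small. Not being fast for E - dl gives the upper bound. For the lower
    one, let k <= t be a time at which the position is nearly t / (E + dl). Not being
    fast for E - dl also shows that k is at least (E - dl) times this position, up to
    a constant, hence that t - k is small compared with t. Steps of size one cannot
    lose more than t - k afterwards. *)
Lemma speed_limit x (E : R) : near_step x -> 1 <= E ->
  (forall n : nat, ~ slow (E + n.+2%:R^-1) x) ->
  (forall n : nat, ~ fast (E - n.+2%:R^-1) x) ->
  ((x n).1%:~R / n%:R : R) @[n --> \oo] --> E^-1.
Proof.
move=> nx E1 hs hf; apply/cvgrPdist_le => /= e e0.
have [n hn] := nat_bound (6 / e).
set dl : R := n.+2%:R^-1.
have dl0 : 0 < dl by rewrite invr_gt0.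
have dl2 : dl <= 2^-1 by rewrite lef_pV2 ?posrE// ler_nat.
(* Since E >= 1, the two limiting slopes differ from 1 / E by at most 3 dl. *)
have dle : 3 * dl <= e / 2.
  have : 6 / e <= n.+2%:R by rewrite (le_trans hn)// ler_nat (leq_trans (leqnSn _)).
  rewrite ler_pdivrMr// => h.
  by rewrite /dl ler_pdivrMr// mulrC mulrA ler_pdivlMr//; lra.
have [Cs hCs] : exists C : nat, forall t : nat, exists2 k, (k <= t)%N &
    t%:R < (E + dl) * (x k).1%:~R + C%:R.
  apply: contrapT => H; apply: (hs n) => C; apply: contrapT => H'.
  apply: H; exists C => t; apply: contrapT => H''.
  apply: H'; exists t => k kt; rewrite leNgt; apply/negP => lt; apply: H''.
  by exists k.
have [Cf hCf] : exists C : nat, forall t : nat, (E - dl) * (x t).1%:~R - t%:R < C%:R.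
  apply: contrapT => H; apply: (hf n) => C; apply: contrapT => H'.
  apply: H; exists C => t; rewrite ltNge; apply/negP => le; apply: H'.
  by exists t.
have cp : 0 < E - dl by lra.
have cp' : 0 < E + dl by lra.
have E0 : 0 < E by lra.
have up (t : nat) : (x t).1%:~R <= (t%:R + Cf%:R) / (E - dl).
  by rewrite ler_pdivlMr//; have := hCf t; lra.
have lo (t : nat) : (1 + (E - dl)) * ((t%:R - Cs%:R) / (E + dl)) - t%:R - Cf%:R <= (x t).1%:~R.
  have [k kt hk] := hCs t.
  have h1 : (t%:R - Cs%:R) / (E + dl) <= (x k).1%:~R by rewrite ler_pdivrMr//; lra.
  have h2 := hCf k.
  have h3 : (x k).1%:~R - (t%:R - k%:R) <= (x t).1%:~R :> R.
    have := near_step_le k (t - k) nx; rewrite subnKC// -(ler_int R) intrB.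
    by rewrite -pmulrn natrB//; lra.
  have : (1 + (E - dl)) * ((t%:R - Cs%:R) / (E + dl)) <= (1 + (E - dl)) * (x k).1%:~R.
    by rewrite ler_pM2l//; lra.
  lra.
have iE : (E - dl)^-1 <= E^-1 + 2 * dl.
  rewrite -[leLHS]mul1r ler_pdivrMr// mulrDl.
  have : E^-1 <= 1 by rewrite invf_le1.
  have : 0 < E^-1 by rewrite invr_gt0.
  rewrite mulrBr mulVf ?gt_eqF//; nra.
have iE' : E^-1 - 3 * dl <= (1 - 2 * dl) / (E + dl).
  rewrite ler_pdivlMr// mulrBl mulrDr mulVf ?gt_eqF//.
  have : E^-1 <= 1 by rewrite invf_le1.
  have : 0 < E^-1 by rewrite invr_gt0.
  nra.
(* One constant for the bounded errors of both estimates. *)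
set K := Cf%:R / (E - dl) + ((1 + (E - dl)) * (Cs%:R / (E + dl)) + Cf%:R).
have K1 : Cf%:R / (E - dl) <= K.
  by rewrite lerDl addr_ge0// !mulr_ge0// ?invr_ge0 ?ltW//; lra.
have K2 : (1 + (E - dl)) * (Cs%:R / (E + dl)) + Cf%:R <= K.
  by rewrite lerDr divr_ge0// ltW.
near=> t.
have t0 : 0 < t%:R :> R by rewrite ltr0n; near: t; exists 1%N.
have tK : K <= e / 2 * t%:R.
  rewrite mulrC -ler_pdivrMr; last by rewrite divr_gt0.
  by near: t; exact: nbhs_infty_ger.
have u := up t; have l := lo t.
have dt : 3 * dl * t%:R <= e / 2 * t%:R by rewrite ler_pM2r.
have r1 : (x t).1%:~R / t%:R <= E^-1 + e.
  rewrite ler_pdivrMr//; have : t%:R * (E - dl)^-1 <= t%:R * (E^-1 + 2 * dl) by rewrite ler_pM2l.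
  move: u K1 tK dt; rewrite [(t%:R + _) / _]mulrDl.
  move: (E - dl)^-1 (E^-1) (K) => I J K'; nra.
have r2 : E^-1 - e <= (x t).1%:~R / t%:R.
  rewrite ler_pdivlMr//.
  have : (E^-1 - 3 * dl) * t%:R <= (1 - 2 * dl) / (E + dl) * t%:R by rewrite ler_pM2r.
  have : (1 - 2 * dl) / (E + dl) * t%:R =
      (1 + (E - dl)) * (t%:R / (E + dl)) - t%:R.
    by field; rewrite gt_eqF.
  move: l; rewrite [(_ - Cs%:R) / _]mulrBl [X in X - _ - _ <= _]mulrBr; lra.
by rewrite ler_norml; apply/andP; split; lra.
Unshelve. all: by end_near. Qed.

End speed_events.

Section crossing_times.
Context (R : realType) (d : nat).
Implicit Types (x : paths d).

(** The time of the first visit to layer n, as the sum of the durations of n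
    successive crossings. *)
Fixpoint crossing_time (n : nat) x : nat :=
  if n is k.+1 then (tau x + crossing_time k (restart x))%N else 0%N.

Definition regular x : Prop :=
  [/\ near_step x, (x 0%N).1 = 0 & exists k, 1 <= (x k).1].

Lemma tau_layer1 x : regular x -> (x (tau x)).1 = 1.
Proof.
move=> [nx x0 /tauP[lt1 ge1]].
case: (tau x) lt1 ge1 => [|k] lt1 ge1; first by rewrite x0 in ge1.
by have /andP[+ _] := nx k; have := lt1 k (leqnn _); lia.
Qed.

Lemma tau_gt0 x : regular x -> (0 < tau x)%N.
Proof.
move=> rx; have := tau_layer1 rx; case: rx => _ x0 _.
by case: (tau x) => //; rewrite x0.
Qed.

Lemma crossing_time_le x n t : (forall k, regular (iter k (@restart d) x)) ->
  n%:Z <= (x t).1 -> (crossing_time n x <= t)%N.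
Proof.
elim: n x t => [//|n IH] x t rx nt /=.
have r0 := rx 0%N; have [_ _ cx] := r0; have [lt1 _] := tauP cx.
have le_t : (tau x <= t)%N.
  by rewrite leqNgt; apply/negP => /lt1; rewrite ltNge (le_trans _ nt).
rewrite -leq_subRL//; apply: IH => [k|].
  by rewrite -iterSr; exact: rx.
by rewrite /restart /recenter/= subnKC//; lia.
Qed.

Lemma crossing_time_layer x n : (forall k, regular (iter k (@restart d) x)) ->
  (x (crossing_time n x)).1 = n%:Z.
Proof.
elim: n x => [|n IH] x rx /=; first by have [] := rx 0%N.
have := IH (restart x); rewrite /restart /recenter/= => H.
rewrite -[LHS](subrK 1) H; first lia.
by move=> k; rewrite -iterSr; exact: rx.
Qed.

Lemma crossing_time_ge x n : (forall k, regular (iter k (@restart d) x)) ->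
  (n <= crossing_time n x)%N.
Proof.
elim: n x => [//|n IH] x rx /=; rewrite -add1n leq_add//; first exact: tau_gt0 (rx 0%N).
by apply: IH => k; rewrite -iterSr.
Qed.

(** Take t with c xi_t - t >= 1 and n = xi_t: layer n has been reached by time t. *)
Lemma fast_crossing x (c : R) : 0 < c -> (forall k, regular (iter k (@restart d) x)) ->
  fast c x -> exists n, (crossing_time n x)%:R < c * n%:R.
Proof.
move=> c0 rx /(_ 1%N)[t ht].
have x0 : 0 < (x t).1.
  have : 0 < c * (x t).1%:~R by have : 0 <= t%:R :> R by []; lra.
  by rewrite pmulr_rgt0// ltr0z.
exists (absz (x t).1); have E : (absz (x t).1)%:Z = (x t).1 by rewrite gtz0_abs.
have := @crossing_time_le x (absz (x t).1) t rx; rewrite [Posz _]E lexx => /(_ isT).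
have aE : (absz (x t).1)%:R = (x t).1%:~R :> R by rewrite -[in RHS]E.
by rewrite -(ler_nat R) aE; lra.
Qed.

(** Let n be the first layer not visited by time t; layer n - 1 has been visited. *)
Lemma slow_crossing x (c : R) : 0 <= c -> (forall k, regular (iter k (@restart d) x)) ->
  slow c x -> exists n, c * n%:R < (crossing_time n x)%:R.
Proof.
move=> c0 rx sx; have [C hC] := nat_bound (c + 1); have [t ht] := sx C.
have ex : exists n, (t < crossing_time n x)%N.
  by exists t.+1; exact: crossing_time_ge.
(* The time of the 0th crossing is 0, so the least n is a successor. *)
case: (ex_minnP ex) => -[|n] hn min; first by [].
exists n.+1.
have le_t : (crossing_time n x <= t)%N.
  by rewrite leqNgt; apply/negP => /min; rewrite ltnn.
have := ht _ le_t; rewrite crossing_time_layer// -pmulrn -natr1.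
have : t%:R < (crossing_time n.+1 x)%:R :> R by rewrite ltr_nat.
lra.
Qed.

End crossing_times.

(** * Stationary ergodic environments *)

Section environment.
Context (R : realType) (d : nat).
Implicit Types (w : env R d) (n m : int).

Lemma measurable_matP n i j : measurable_fun setT (fun w : env R d => matP w n i j).
Proof.
move=> _ B mB; rewrite setTI; apply: sub_sigma_algebra.
by exists n, i, j, B; split => //; constructor 1.
Qed.

Lemma measurable_matQ n i j : measurable_fun setT (fun w : env R d => matQ w n i j).
Proof.
move=> _ B mB; rewrite setTI; apply: sub_sigma_algebra.
by exists n, i, j, B; split => //; constructor 2.
Qed.

Lemma measurable_matR n i j : measurable_fun setT (fun w : env R d => matR w n i j).
Proof.
move=> _ B mB; rewrite setTI; apply: sub_sigma_algebra.
by exists n, i, j, B; split => //; constructor 3.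
Qed.

Lemma measurable_shiftn m : measurable_fun setT (shiftn m : env R d -> env R d).
Proof.
apply: (@measurability _ _ (env R d) (env R d) setT (shiftn m) (@env_cylinders R d)) => //.
move=> _ [A [n [i [j [B [mB h]]]]] <-]; rewrite setTI; apply: sub_sigma_algebra.
exists (n + m), i, j, B; split => //.
by case: h => ->; [constructor 1|constructor 2|constructor 3].
Qed.

Lemma measurable_stopped m (f : state d -> R) t a :
  measurable_fun setT (fun w : env R d => stopped w m f t a).
Proof.
elim: t a => [|t IH] a /=; first exact: measurable_cst.
case: (a.1 < m); last exact: measurable_cst.
apply: (@measurable_sum _ _ _ setT _ _ (fun j w =>
  matP w a.1 a.2 j * stopped w m f t (a.1 + 1, j) + matR w a.1 a.2 j * stopped w m f t (a.1, j)
  + matQ w a.1 a.2 j * stopped w m f t (a.1 - 1, j))) => j.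
by do ![apply: measurable_funD|apply: measurable_funM]; rewrite //;
  first [exact: measurable_matP|exact: measurable_matQ|exact: measurable_matR].
Qed.

Lemma measurable_trans a b : measurable_fun setT (fun w : env R d => trans w a b).
Proof.
rewrite /trans; case: (b.1 == a.1 + 1); first exact: measurable_matP.
case: (b.1 == a.1); first exact: measurable_matR.
by case: (b.1 == a.1 - 1); [exact: measurable_matQ|exact: measurable_cst].
Qed.

Lemma measurable_ge (f : env R d -> R) r : measurable_fun setT f ->
  measurable [set w | r <= f w].
Proof.
move=> mf; rewrite (_ : [set w | _] = f @^-1` `[r, +oo[%classic).
  by rewrite -[X in measurable X]setTI; exact: mf.
by apply/seteqP; split => w /=; rewrite in_itv/= andbT.
Qed.

Lemma measurable_gt (f : env R d -> R) r : measurable_fun setT f ->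
  measurable [set w | r < f w].
Proof.
move=> mf; rewrite (_ : [set w | _] = f @^-1` `]r, +oo[%classic).
  by rewrite -[X in measurable X]setTI; exact: mf.
by apply/seteqP; split => w /=; rewrite in_itv/= andbT.
Qed.

Lemma measurable_uniform_hit M N : measurable [set w : env R d | uniform_hit w M N].
Proof.
rewrite (_ : [set w | _] = \bigcap_i \bigcap_j
    [set w : env R d | N.+1%:R^-1 <= hit_prob w M%:Z j N (0, i)]); last first.
  by apply/seteqP; split => w h; [move=> i _ j _|move=> i j]; exact: h.
apply: fin_bigcap_measurable => [|i _]; first exact: finite_finset.
apply: fin_bigcap_measurable => [|j _]; first exact: finite_finset.
by apply: measurable_ge; exact: measurable_stopped.
Qed.

Lemma measurable_one_class n : measurable [set w : env R d | one_class w n].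
Proof.
pose T0 := (int * 'I_d.+1)%type.
have mpath (p : seq T0) (a : T0) :
    measurable [set w : env R d | path (fun x y : T0 => 0 < trans w x y) a p].
  elim: p a => [|b p IH] a /=.
    by rewrite (_ : [set _ | _] = setT)//; apply/seteqP; split.
  rewrite (_ : [set _ | _] = [set w | 0 < trans w a b] `&`
    [set w | path (fun x y : T0 => 0 < trans w x y) b p]).
    by apply: measurableI => //; apply: measurable_gt; exact: measurable_trans.
  by apply/seteqP; split => w /= /andP.
rewrite (_ : [set w | _] = \bigcap_i \bigcap_j \bigcup_(p : seq T0)
   ([set w : env R d | path (fun x y : T0 => 0 < trans w x y) (n, i) p] `&`
    [set _ | last ((n, i) : T0) p = (n, j)])); last first.
  apply/seteqP; split => w h.
    by move=> i _ j _; have [p [h1 h2]] := h i j; exists p.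
  by move=> i j; have [p _ [h1 h2]] := h i I j I; exists p.
apply: fin_bigcap_measurable => [|i _]; first exact: finite_finset.
apply: fin_bigcap_measurable => [|j _]; first exact: finite_finset.
apply: (@bigcup_countType (seq T0)) => p; apply: measurableI; first exact: mpath.
have [h|h] := pselect (last ((n, i) : T0) p = (n, j)).
  by rewrite (_ : [set _ | _] = setT)//; apply/seteqP; split.
by rewrite (_ : [set _ | _] = set0)//; apply/seteqP; split.
Qed.

Context (P : probability (env R d) R).
Hypothesis Pst : stationary P.

Let mpre m A : measurable A -> measurable (shiftn m @^-1` A : set (env R d)).
Proof. by move=> mA; rewrite -[X in measurable X]setTI; exact: measurable_shiftn. Qed.

(** Stationarity concerns only the shift by +1; for negative m apply it to the
    preimage. *)
Lemma shiftn_preserving m A : measurable A -> P (shiftn m @^-1` A) = P A.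
Proof.
have pos (k : nat) B : measurable B -> P (shiftn k%:Z @^-1` B) = P B.
  move=> mB; elim: k => [|k IH].
    by congr (P _); apply/funext => w; rewrite /preimage/= shiftn0.
  rewrite -IH -[RHS]Pst; last exact: mpre.
  by congr (P _); apply/funext => w; rewrite /preimage/= shift_shiftn shiftnD -addn1 PoszD.
move=> mA; case: m => k; first exact: pos.
rewrite -(pos k.+1); last exact: mpre.
congr (P _); apply/funext => w; rewrite /preimage/= shiftnD NegzE addrC subrr.
by rewrite shiftn0.
Qed.

Lemma ae_forall_int (Q : int -> env R d -> Prop) :
  (forall n, {ae P, forall w, Q n w}) -> {ae P, forall w, forall n, Q n w}.
Proof.
move=> h; have h1 : {ae P, forall w, forall k : nat, Q k%:Z w}.
  by apply: ae_foralln => k; exact: h.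
have h2 : {ae P, forall w, forall k : nat, Q (- k%:Z) w}.
  by apply: ae_foralln => k; exact: h.
apply: filterS2 h1 h2 => w p1 p2 [k|k]; first exact: p1.
by rewrite NegzE; exact: p2.
Qed.

Lemma ae_shiftn (Q : env R d -> Prop) : {ae P, forall w, Q w} ->
  {ae P, forall w, forall n : int, Q (shiftn n w)}.
Proof.
move=> [N [mN N0 QN]]; apply: ae_forall_int => n.
exists (shiftn n @^-1` N); split; first exact: mpre.
  by rewrite shiftn_preserving.
by move=> w /= h; apply: QN.
Qed.

Hypothesis Perg : ergodic P.

Definition often (g : nat -> int) (U : set (env R d)) : set (env R d) :=
  [set w | forall N : nat, exists2 n : nat, (N <= n)%N & U (shiftn (g n) w)].

(** A recurrence theorem: the event is shift-invariant, and its probability is at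
    least that of U because it is a decreasing limit of unions of translates of U.
    The first two hypotheses say that the set of values of g is, up to finitely many
    of them, invariant under translation by one. *)
Lemma often_ae (g : nat -> int) (U : set (env R d)) :
  (forall N : nat, exists N' : nat, forall n : nat, (N' <= n)%N ->
    exists2 n' : nat, (N <= n')%N & g n' = g n + 1) ->
  (forall N : nat, exists N' : nat, forall n : nat, (N' <= n)%N ->
    exists2 n' : nat, (N <= n')%N & g n' = g n - 1) ->
  measurable U -> (0 < P U)%E -> {ae P, forall w, often g U w}.
Proof.
move=> gp gm mU PU.
pose B N := \bigcup_(n in [set n : nat | (N <= n)%N]) (shiftn (g n) @^-1` U).
have mB N : measurable (B N) by apply: bigcup_measurable => n _; exact: mpre.
have oE : often g U = \bigcap_N B N.
  apply/seteqP; split => w h; first by move=> N _; have [n nN Un] := h N; exists n.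
  by move=> N; have [n /= nN Un] := h N I; exists n.
have mo : measurable (often g U) by rewrite oE; exact: bigcapT_measurable.
have inv : @Defs.shift R d @^-1` often g U = often g U.
  apply/seteqP; split => w h N.
    have [N' hN'] := gp N; have [n nN' Un] := h N'.
    have [n' n'N E] := hN' n nN'; exists n' => //.
    by move: Un; rewrite shift_shiftn shiftnD E.
  have [N' hN'] := gm N; have [n nN' Un] := h N'.
  have [n' n'N E] := hN' n nN'; exists n' => //.
  by rewrite shift_shiftn shiftnD E subrK.
have lo : (P U <= P (often g U))%E.
  have cv : P (B N) @[N --> \oo] --> P (often g U).
    rewrite oE; apply: nonincreasing_cvg_mu => //.
    - by rewrite (le_lt_trans (probability_le1 _ _))// ltry.
    - by rewrite -oE.
    - move=> N N' NN'; apply/subsetPset => w [n /= nN' Un]; exists n => //=.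
      exact: leq_trans nN'.
  rewrite -(cvg_lim _ cv)//; apply: lime_ge; first exact: cvgP cv.
  apply: nearW => N; rewrite -(shiftn_preserving (g N) mU).
  apply: le_measure; rewrite ?inE//; first exact: mpre.
  by move=> w Uw; exists N => /=.
have P1 : P (often g U) = 1%E.
  by case: (Perg mo inv) => // h; move: lo; rewrite h leNgt PU.
exists (~` often g U); split => //; first exact: measurableC.
by rewrite probability_setC// P1 subee.
Qed.

Lemma recurrent_ae (U : set (env R d)) : measurable U -> (0 < P U)%E ->
  {ae P, forall w, forall a : int, (exists n : nat, U (shiftn (a + n%:Z) w)) /\
    (exists n : nat, U (shiftn (a - n%:Z) w))}.
Proof.
move=> mU PU.
have h1 : {ae P, forall w, often (fun n : nat => n%:Z) U w}.
  apply: often_ae => // N.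
    by exists N => n nN; exists n.+1; [exact: leq_trans nN _|lia].
  by exists N.+1 => -[//|n] nN; exists n => //; lia.
have h2 : {ae P, forall w, often (fun n : nat => - n%:Z) U w}.
  apply: often_ae => // N.
    by exists N.+1 => -[//|n] nN; exists n => //; lia.
  by exists N => n nN; exists n.+1; [exact: leq_trans nN _|lia].
apply: filterS2 h1 h2 => w o1 o2 a; split.
  have [n nN Un] := o1 (absz a); exists (absz (n%:Z - a)%R).
  by rewrite (_ : a + _ = n%:Z)//; lia.
have [n nN Un] := o2 (absz a); exists (absz (n%:Z + a)%R).
by rewrite (_ : a - _ = - n%:Z)//; lia.
Qed.

(** Almost every environment has a translate in B by recurrence. *)
Lemma invariant_ae (B : set (env R d)) : measurable B ->
  {ae P, forall w, forall n : int, B (shiftn n w) -> B w} ->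
  (0 < P B)%E -> {ae P, forall w, B w}.
Proof.
move=> mB inv PB; apply: filterS2 (recurrent_ae mB PB) inv => w h i.
by have [[n /i]] := h 0.
Qed.

End environment.

(** * Integrals of functions known almost everywhere *)

Section integral_ae.
Context d0 (T : measurableType d0) (R : realType) (mu : {measure set T -> \bar R}).
Local Open Scope ereal_scope.
Import HBNNSimple.

(** The integral of a nonnegative function is a supremum over simple functions below
    it, so monotonicity holds for arbitrary functions. *)
Lemma ge0_le_integral_all (f g : T -> \bar R) : (forall x, 0 <= f x) ->
  (forall x, f x <= g x) -> \int[mu]_x f x <= \int[mu]_x g x.
Proof.
move=> f0 fg; have g0 x : 0 <= g x by exact: le_trans (fg x).
rewrite !ge0_integralTE//; apply: ereal_sup_le => _ [h hf <-].
by exists h => // x; exact: le_trans (fg x).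
Qed.

Lemma ge0_integral_ae_eq_all (f g : T -> \bar R) : (forall x, 0 <= f x) ->
  (forall x, 0 <= g x) -> measurable_fun setT g -> {ae mu, forall x, f x = g x} ->
  \int[mu]_x f x = \int[mu]_x g x.
Proof.
move=> f0 g0 mg ae; apply/eqP; rewrite eq_le; apply/andP; split.
  rewrite ge0_integralTE//; apply: ge_ereal_sup => _ [h /= hf <-].
  rewrite -integralT_nnsfun; apply: ae_ge0_le_integral => //.
  - by move=> x _; rewrite /= lee_fin fun_ge0.
  - exact/measurable_EFinP.
  - by apply: filterS ae => x xE _; rewrite -xE; exact: hf.
have [N [mN N0 hN]] := ae.
pose g' := g \_ (~` N).
have mg' : measurable_fun setT g'.
  apply/(measurable_restrictT g (measurableC mN)).
  exact: (@measurable_funTS _ _ _ _ _ g).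
have g'0 x : 0 <= g' x by rewrite /g' patchE; case: ifP.
have -> : \int[mu]_x g x = \int[mu]_x g' x.
  apply: ge0_ae_eq_integral => //.
  exists N; split => // x /= h; apply: contrapT => Nx; apply: h => _.
  by rewrite /g' patchE mem_set.
apply: ge0_le_integral_all => // x; rewrite /g' patchE; case: ifPn => // /set_mem Nx.
suff -> : f x = g x by [].
by apply: contrapT => h; apply: Nx; exact: hN.
Qed.

(** The matrices zeta are determined only almost surely, so functions built from them,
    such as the series of the theorem, may fail to be measurable. Agreement almost
    everywhere with a nonnegative measurable function is enough to integrate them. *)
Lemma integral_ae_eq_all (f g : T -> \bar R) : (forall x, 0 <= g x) ->
  measurable_fun setT g -> {ae mu, forall x, f x = g x} ->
  \int[mu]_x f x = \int[mu]_x g x.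
Proof.
move=> g0 mg ae; rewrite integralE.
rewrite (@ge0_integral_ae_eq_all f^\+ g)//; last first.
  by apply: filterS ae => x E; rewrite funeposE E; apply/max_idPl.
rewrite (@ge0_integral_ae_eq_all f^\- (cst 0))//; last first.
  by apply: filterS ae => x E; rewrite funenegE E; apply/max_idPr; rewrite leeNl oppe0.
by rewrite integral0 sube0.
Qed.

End integral_ae.

(** * Environments with recurrent uniform blocks *)

Section recurrent_forgets.
Context (R : realType) (d : nat) (w : env R d) (z : int -> 'M[R]_d.+1).
Hypothesis zP : is_zeta w z.
Hypothesis colP : forall (n : int) (j : 'I_d.+1), 0 < \sum_i matP w n i j.
Context (M N : nat).
Hypothesis rec : forall a : int, (exists n : nat, uniform_hit (shiftn (a + n%:Z) w) M N) /\
    (exists n : nat, uniform_hit (shiftn (a - n%:Z) w) M N).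

Let dl : R := N.+1%:R^-1.

Let dl0 : 0 < dl. Proof. by rewrite invr_gt0. Qed.

Let dl1 : dl <= 1. Proof. by rewrite invf_le1// ler1n. Qed.

Lemma zeta_stochastic n : stochastic (z n). Proof. by have [] := zP n. Qed.

Lemma uniform_hit_block a : uniform_hit (shiftn a w) M N -> block z dl M a.
Proof.
move=> h i j; have := h i j; rewrite hit_prob_shiftn add0r => /le_trans; apply.
have := hit_prob_le_zeta_hit zP j N (_ : (a, i).1 <= M%:Z + a).
rewrite /zeta_hit/= addrK; apply; lia.
Qed.

Let small (e : R) : 0 < e -> exists r, (1 - dl) ^+ r <= e.
Proof. by apply: expr_small; move: dl0 dl1; lra. Qed.

Let dl01 : 0 <= dl <= 1. Proof. by rewrite dl1 ltW. Qed.

Lemma zeta_forgets_future : forgets_future z.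
Proof.
move=> e /small[r hr] a.
have [k0 hk0] := @contracting_future _ _ z zeta_stochastic dl M dl01
  (fun a => let: conj (ex_intro n h) _ := rec a in ex_intro _ n (uniform_hit_block h)) r a.
by exists k0 => k kk0; apply: (contracting_le hr); exact: hk0.
Qed.

Let past a : exists n : nat, block z dl M (a - n%:Z).
Proof. by have [_ [n h]] := rec a; exists n; exact: uniform_hit_block. Qed.

Lemma zeta_forgets_past : forgets_past z.
Proof.
move=> e /small[r hr] b.
have [k0 hk0] := @contracting_past _ _ z zeta_stochastic dl M dl01 past r b.
by exists k0 => k kk0; apply: (contracting_le hr); exact: hk0.
Qed.

Lemma zeta_vecy_gt0 v : (forall a, probvec (v a)) -> forall j, 0 < vecy z v (-1) 0 j.
Proof.
move=> vp; apply: (@vecy_gt0 _ _ z v dl M) => //.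
- exact: zeta_stochastic.
- exact: zeta_forgets_past.
move=> n j; have [i hi] := col_witness colP n j; exists i.
rewrite (zeta_eq zP n) !mxE -addrA ltr_wpDr// addr_ge0// sumr_ge0// => k _.
  by rewrite mulr_ge0 ?matR_ge0//; have /stochasticP[+ _] := zeta_stochastic n; exact.
rewrite mulr_ge0 ?matQ_ge0//.
have /stochasticP[+ _] := stochasticM (zeta_stochastic (n - 1)) (zeta_stochastic n).
exact.
Qed.

End recurrent_forgets.

(** All solutions are limits of the same hitting probabilities. *)
Lemma zeta_unique (R : realType) (d : nat) (w : env R d) z z' :
  (forall n i, exists C : R, forall t, trunc_time w (n + 1) t (n, i) <= C) ->
  is_zeta w z -> is_zeta w z' -> z = z'.
Proof.
move=> eb zP z'P; apply/funext => n; apply/matrixP => i k.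
by apply: (cvg_unique _ (@hit_prob1_cvg _ _ w z zP eb n i k) (@hit_prob1_cvg _ _ w z' z'P eb n i k)).
Qed.

Lemma is_zeta_shiftn (R : realType) (d : nat) (w : env R d) z m :
  is_zeta w z -> is_zeta (shiftn m w) (fun n => z (n + m)).
Proof.
move=> zP n; have := zP (n + m).
by rewrite /resolvent_arg /matP /matQ /matR /shiftn (addrAC n m).
Qed.

(** Harmonic functions are averages of their values on a layer far to the right, with
    respect to the hitting distribution: the inequality given by the comparison
    principle for H and for 1 - H. Hitting distributions from different points of a
    layer merge, so H is constant on layers, and then across layers. *)
Lemma harmonic_const (R : realType) (d : nat) (w : env R d) z (H : state d -> R) :
  is_zeta w z -> (forall n i, exists C : R, forall t, trunc_time w (n + 1) t (n, i) <= C) ->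
  forgets_future z -> (forall a, 0 <= H a <= 1) -> (forall a, step w H a = H a) ->
  forall a b, H a = H b.
Proof.
move=> zP eb fz H01 Hh.
pose h (m : int) : 'cV[R]_d.+1 := \col_j H (m, j).
have lower (G : state d -> R) : (forall a, 0 <= G a <= 1) -> (forall a, step w G a = G a) ->
    forall n i k, (iprod z n k *m \col_j G (n + k%:Z, j)) i 0 <= G (n, i).
  move=> G01 Gh n i k; rewrite mxE.
  under eq_bigr do rewrite [X in _ * X]mxE.
  have le0 : (n, i).1 <= n + k%:Z by rewrite /=; lia.
  have cv : \sum_j hit_prob w (n + k%:Z) j t (n, i) * G (n + k%:Z, j) @[t --> \oo] -->
      \sum_j iprod z n k i j * G (n + k%:Z, j).
    apply: cvg_sumr => j; apply: cvgM; last exact: cvg_cst.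
    have := @hit_prob_cvg_zeta_hit _ _ w z zP eb (n + k%:Z) j (n, i) le0.
    rewrite /zeta_hit/= (_ : absz _ = k); last lia.
    exact.
  apply: (ler_cvg_to cv (@cvg_cst _ (G (n, i)) _ \oo _)); apply: nearW => t.
  pose f (b : state d) := if b.1 < n + k%:Z then 0 else G b.
  rewrite (_ : \sum_j _ = \sum_j f (n + k%:Z, j) * hit_prob w (n + k%:Z) j t (n, i)); last first.
    by apply: eq_bigr => j _; rewrite /f/= ltxx mulrC.
  rewrite -stopped_hit_prob//; last by move=> b bk; rewrite /f bk.
  apply: stopped_le => // [a _|a _]; last by rewrite Gh.
  by rewrite /f; case: ifP => // _; have /andP[] := G01 a.
(* The reverse inequality is that of the harmonic function 1 - H. *)
have HE n i k : H (n, i) = (iprod z n k *m h (n + k%:Z)) i 0.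
  apply/le_anti; rewrite lower// andbT.
  have := @lower (fun a => 1 - H a) _ _ n i k.
  have st := stochastic_iprod (fun n => let: And3 s _ _ := zP n in s) n k.
  have /stochasticP[_ s1] := st.
  have -> : (iprod z n k *m \col_j (1 - H (n + k%:Z, j))) i 0 = 1 - (iprod z n k *m h (n + k%:Z)) i 0.
    rewrite !mxE; under eq_bigr do rewrite [X in _ * X]mxE mulrBr mulr1.
    by rewrite sumrB s1; congr (_ - _); apply: eq_bigr => j _; rewrite mxE.
  rewrite lerD2l lerN2; apply.
    by move=> a; have := H01 a; lra.
  move=> a; rewrite -[X in _ = X - _](step_cst w 1 a) -[X in _ = _ - X](Hh a) -mulN1r -stepZ -stepD.
  by apply: eq_step => b; rewrite mulN1r.
have flat n i i' : H (n, i) = H (n, i').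
  have le i1 i2 : H (n, i1) - H (n, i2) <= 0.
    rewrite leNgt; apply/negP => pos.
    have e0 : 0 < (H (n, i1) - H (n, i2)) / 2 by rewrite divr_gt0.
    have [k0 hk0] := fz _ e0 n.
    have := hk0 k0 (leqnn _) (h (n + k0%:Z)) 1 _ i1 i2.
    rewrite -!HE mulr1 => /(_ _); set D := H _ - H _.
    have hb : forall j j', h (n + k0%:Z) j 0 - h (n + k0%:Z) j' 0 <= 1.
      by move=> j j'; rewrite !mxE; have := H01 (n + k0%:Z, j); have := H01 (n + k0%:Z, j'); lra.
    by move=> /(_ hb); rewrite /D; move: pos; lra.
  by apply/le_anti; rewrite -[_ <= H (n, i')]subr_le0 le/= -subr_le0 le.
have const n k i j : H (n, i) = H (n + k%:Z, j).
  rewrite (HE n i k) mxE.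
  have st := stochastic_iprod (fun n => let: And3 s _ _ := zP n in s) n k.
  have /stochasticP[_ s1] := st.
  rewrite (eq_bigr (fun l => iprod z n k i l * H (n + k%:Z, j))).
    by rewrite -mulr_suml s1 mul1r.
  by move=> l _; rewrite mxE (flat _ l j).
move=> [n i] [n' i']; case: (leP n n') => nn'.
  by rewrite (const n (absz (n' - n)%R) i i'); congr (H (_, _)); lia.
by rewrite (const n' (absz (n - n')%R) i' i); congr (H (_, _)); lia.
Qed.

(** * The hitting time of layer 1 as a sum of indicators *)

Section first_hit.
Context (R : realType) (d : nat).
Implicit Types x : paths d.

(** The event that layer 1 has not been visited up to time t, for paths with steps of
    size one. *)
Definition below (t : nat) : set (paths d) := [set x | forall k, (k <= t)%N -> (x k).1 < 1].

Lemma measurable_below t : measurable (below t).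
Proof. exact: (measurable_coords (fun k b => (k <= t)%N -> b.1 < 1)). Qed.

Lemma below_tau x t : regular x -> below t x <-> (t < tau x)%N.
Proof.
move=> [_ _ cx]; have [lt1 ge1] := tauP cx; split=> [b|tt k kt].
  by rewrite ltnNge; apply/negP => /b; rewrite ltNge ge1.
by apply: lt1; exact: leq_ltn_trans tt.
Qed.

Lemma hit1_regular x : regular x -> hit1 R x = (tau x)%:R%:E.
Proof.
move=> rx; apply/eqP; rewrite eq_le; apply/andP; split.
  by apply: ereal_inf_lbound; exists (tau x) => //; exact: tau_layer1.
apply: le_ereal_inf_tmp => _ [t /= xt <-]; rewrite lee_fin ler_nat leqNgt.
by apply/negP => /(below_tau _ rx) /(_ t (leqnn t)); rewrite -/(xi x t) xt ltxx.
Qed.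

Lemma sum_below_regular x : regular x ->
  (\sum_(0 <= t <oo) (\1_(below t) x : R)%:E = (tau x)%:R%:E)%E.
Proof.
move=> rx; have E t : (\1_(below t) x : R) = ((t < tau x)%N)%:R.
  rewrite indicE; congr ((nat_of_bool _)%:R); apply/idP/idP.
    by move=> /set_mem /(below_tau _ rx).
  by move=> h; apply/mem_set/(below_tau _ rx).
rewrite (@nneseries_split _ _ _ (tau x)) => [|k _]; last by rewrite lee_fin.
rewrite add0n eseries0 => [|k]; last by rewrite E => /= h _; rewrite ltnNge h.
rewrite adde0 (eq_big_nat _ _ (F2 := fun=> 1%E)) => [|k /= kt]; last by rewrite E kt.
by rewrite sumEFin sumr_const_nat subn0.
Qed.

Lemma hit1_sum_below x : near_step x -> (x 0%N).1 = 0 ->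
  hit1 R x = (\sum_(0 <= t <oo) (\1_(below t) x : R)%:E)%E.
Proof.
move=> nx x0; have [cx|ncx] := pselect (exists k, 1 <= (x k).1).
  by rewrite hit1_regular ?sum_below_regular.
have b t : below t x.
  by move=> k _; rewrite ltNge; apply/negP => h; apply: ncx; exists k.
rewrite (eq_eseriesr (g := fun=> 1%E)) => [|t _]; last by rewrite indicE mem_set.
rewrite (_ : hit1 R x = +oo%E).
  apply/esym/cvg_lim => //; apply/cvgeyPge => A.
  exists (Num.bound `|A|) => // n /= hn.
  rewrite sumEFin sumr_const_nat subn0 lee_fin (le_trans (ler_norm A))//.
  by rewrite (le_trans (ltW (archi_boundP (normr_ge0 A))))// ler_nat.
rewrite /hit1 (_ : [set _ | _ in _] = set0) ?ereal_inf0//.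
apply/seteqP; split => // _ [t /= xt _]; apply: ncx; exists t.
by rewrite -/(xi x t) xt.
Qed.

Lemma measurable_regular : measurable [set x : paths d | ~ regular x].
Proof.
rewrite (_ : [set x | _] =
  (\bigcup_k [set x : paths d | ~ ((x k.+1).1 - 1 <= (x k).1 <= (x k.+1).1 + 1)]) `|`
  ([set x : paths d | (x 0%N).1 <> 0] `|` ~` \bigcup_k [set x : paths d | 1 <= (x k).1])).
  apply: measurableU; first by apply: bigcupT_measurable => k; exact: measurable_near_step.
  apply: measurableU; first exact: (measurable_coord 0 (fun b => b.1 <> 0)).
  apply: measurableC; apply: bigcupT_measurable => k.
  exact: (measurable_coord k (fun b => 1 <= b.1)).
apply/seteqP; split => x.
  move=> nr; apply: contrapT => /not_orP[h1 /not_orP[h2 h3]]; apply: nr; split.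
  - by move=> k; apply: contrapT => h; apply: h1; exists k.
  - exact: contrapT.
  - by move: h3 => /contrapT[k _ h]; exists k.
case=> [[k _ h]|[h|h]] [nx x0 [k' cx]]; [exact: h|exact: h|].
by apply: h; exists k'.
Qed.

Lemma measurable_tau : measurable_fun setT (fun x : paths d => (tau x)%:R : R).
Proof.
move=> _ B mB; rewrite setTI.
rewrite (_ : _ @^-1` B = (\bigcup_k ([set x : paths d | crosses_at x k] `&` [set _ | B k%:R])) `|`
  (~` (\bigcup_k [set x : paths d | crosses_at x k]) `&` [set _ | B 0])).
  have mc (Q : Prop) : measurable [set _ : paths d | Q].
    have [q|q] := pselect Q.
      by rewrite (_ : [set _ | _] = setT)//; apply/seteqP; split.
    by rewrite (_ : [set _ | _] = set0)//; apply/seteqP; split.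
  apply: measurableU.
    apply: bigcupT_measurable => k; apply: measurableI => //.
    exact: measurable_crosses_at.
  apply: measurableI => //; apply: measurableC.
  by apply: bigcupT_measurable => k; exact: measurable_crosses_at.
apply/seteqP; split => x.
  have [h|h] := pselect (exists k, 1 <= (x k).1).
    by move=> Bx; left; exists (tau x) => //; split => //; exact: tauP.
  rewrite /=; have -> : tau x = 0%N by rewrite /tau; case: pselect.
  by move=> Bx; right; split => // -[k _ [_ k1]]; apply: h; exists k.
case=> [[k _ [/tauE <- //]]|[h Bx]].
rewrite /=; have -> // : tau x = 0%N.
by rewrite /tau; case: pselect => // h'; case: h; exists (tau x) => //; exact: tauP.
Qed.

End first_hit.

Lemma ae_and d0 (T : measurableType d0) (R : realType) (m : {measure set T -> \bar R})
  (Q1 Q2 : T -> Prop) : {ae m, forall w, Q1 w} -> {ae m, forall w, Q2 w} ->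
  {ae m, forall w, Q1 w /\ Q2 w}.
Proof. by move=> h1 h2; apply: filterS2 h1 h2. Qed.

Lemma ae_imp d0 (T : measurableType d0) (R : realType) (m : {measure set T -> \bar R})
  (Q1 Q2 : T -> Prop) : (forall w, Q1 w -> Q2 w) -> {ae m, forall w, Q1 w} ->
  {ae m, forall w, Q2 w}.
Proof. by move=> h h1; apply: filterS h1. Qed.

(** * The law of large numbers *)

Section environment_facts.
Context (R : realType) (d : nat) (P : probability (env R d) R).
Hypothesis Pst : stationary P.
Hypothesis PC : conditionC P.
Context (zeta : env R d -> int -> 'M[R]_d.+1).
Hypothesis zetaP : {ae P, forall w, is_zeta w (zeta w)}.
Context (v : env R d -> int -> 'rV[R]_d.+1).
Hypothesis vP : forall w a, probvec (v w a).
Context (mu : env R d -> 'rV[R]_d.+1).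
Hypothesis muP : forall w, probvec (mu w).
Hypothesis mu_y : {ae P, forall w, mu w = vecy (zeta w) (v w) (-1)}.
Context (K : R.-pker env R d ~> paths d).
Hypothesis KP : forall w, is_quenched_law w (mu w) (K w).
Hypothesis hit_fin : (\int[annealed P K]_z hit1 R z.2 < +oo)%E.

(** The properties that the law of the environment provides almost surely, before
    the finiteness of the mean hitting time is used. *)
Definition base_ok (M N : nat) (w : env R d) : Prop :=
  [/\ is_zeta w (zeta w), (forall (n : int) (j : 'I_d.+1), 0 < \sum_i matP w n i j),
    (forall a : int, (exists n : nat, uniform_hit (shiftn (a + n%:Z) w) M N) /\
      (exists n : nat, uniform_hit (shiftn (a - n%:Z) w) M N)) &
    mu w = vecy (zeta w) (v w) (-1)].

(** Almost every environment with a communicating layer 0 lies in one of countably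
    many events of the form [uniform_hit]. *)
Lemma uniform_hit_pos : exists M N, (0 < P [set w | uniform_hit w M N])%E.
Proof.
have [_ _ C3 C4] := PC; apply: contrapT => H.
suff : P.-negligible [set w | one_class w 0].
  by move/negligibleP => /(_ (measurable_one_class 0)) E; rewrite E ltxx in C4.
have H0 M N : P.-negligible [set w | uniform_hit w M N].
  apply/negligibleP; first exact: measurable_uniform_hit.
  apply/eqP; rewrite eq_le measure_ge0 andbT leNgt; apply/negP => h.
  by apply: H; exists M, N.
pose bad : set (env R d) := [set w | ~ forall (n : int) (j : 'I_d.+1), 0 < \sum_i matP w n i j].
have C3' : P.-negligible bad.
  by apply: negligibleS C3 => w /= h h'; apply: h => n j; have [] := h' n j.
pose U : set (env R d) := \bigcup_M \bigcup_N [set w | uniform_hit w M N].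
have U0 : P.-negligible U.
  by apply: negligible_bigcup => M; apply: negligible_bigcup => N.
apply: negligibleS (negligibleU C3' U0) => w oc.
have [cw|cw] := pselect (forall (n : int) (j : 'I_d.+1), 0 < \sum_i matP w n i j).
  by right; have [M [N h]] := one_class_uniform_hit cw oc; exists M => //; exists N.
by left.
Qed.

Lemma base_ok_ae : exists M N, {ae P, forall w, forall n : int, base_ok M N (shiftn n w)}.
Proof.
have [M [N h]] := uniform_hit_pos; exists M, N; apply: (ae_shiftn Pst).
have [erg _ C3 _] := PC.
have rec := recurrent_ae Pst erg (measurable_uniform_hit M N) h.
have h1 : {ae P, forall w, is_zeta w (zeta w) /\ mu w = vecy (zeta w) (v w) (-1)}.
  exact: ae_and zetaP mu_y.
have h2 : {ae P, forall w, (forall (n : int) (j : 'I_d.+1), 0 < \sum_i matP w n i j) /\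
    (forall a : int, (exists n : nat, uniform_hit (shiftn (a + n%:Z) w) M N) /\
      (exists n : nat, uniform_hit (shiftn (a - n%:Z) w) M N))}.
  apply: ae_imp (ae_and C3 rec) => w [c r]; split => // n j; by have [] := c n j.
by apply: ae_imp (ae_and h1 h2) => w [[a b] [c e]]; split.
Qed.

Lemma base_ok_mu_gt0 M N w : base_ok M N w -> forall j, 0 < mu w 0 j.
Proof. by move=> [zP cP rec ->]; exact: (zeta_vecy_gt0 zP cP rec). Qed.

Lemma K_setT w : K w setT = 1%E. Proof. exact: prob_kernel. Qed.

Lemma K_below w t : K w (below (d:=d) t) = (\sum_i mu w 0 i * survival w 1 t (0, i))%:E.
Proof. exact: (quenched_survival (KP w) (K_setT w) (muP w)). Qed.

(** The quenched mean of T_1, as a sum of tail probabilities. *)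
Definition mean_hit w : \bar R := (\sum_(0 <= t <oo) K w (below (d:=d) t))%E.

Lemma mean_hit_ge0 w : (0 <= mean_hit w)%E.
Proof. by apply: nneseries_ge0 => t _ _. Qed.

Lemma measurable_mean_hit : measurable_fun setT mean_hit.
Proof.
apply: (@ge0_emeasurable_sum _ _ _ setT (fun t w => K w (below (d:=d) t)) xpredT) => [k x _ _|k _].
  exact: measure_ge0.
exact: (measurable_kernel K _ (measurable_below (d:=d) k)).
Qed.

(** Measurability of the exceptional set is assumed because the null sets of the
    different quenched laws need not fit together. *)
Lemma ae_annealed (Q : paths d -> Prop) : measurable [set x | ~ Q x] ->
  {ae P, forall w, {ae K w, forall x, Q x}} -> {ae annealed P K, forall z, Q z.2}.
Proof.
move=> mQ h; exists (setT `*` [set x | ~ Q x]); split.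
- exact: measurableX.
- rewrite annealed_rect// (@integral_ae_eq_all _ _ _ P _ (cst 0%E))//.
    by rewrite integral0.
  by apply: ae_imp h => w hw; apply: (negligibleP (K w) mQ).1.
- by move=> z /= h'; split.
Qed.

Lemma ae_annealed_start : {ae annealed P K, forall z, near_step z.2 /\ (z.2 0%N).1 = 0}.
Proof.
apply: (@ae_annealed (fun x => near_step x /\ (x 0%N).1 = 0)).
  rewrite (_ : [set x | _] =
    (\bigcup_k [set x : paths d | ~ ((x k.+1).1 - 1 <= (x k).1 <= (x k.+1).1 + 1)]) `|`
    [set x : paths d | (x 0%N).1 <> 0]).
    apply: measurableU; first by apply: bigcupT_measurable => k; exact: measurable_near_step.
    exact: (measurable_coord 0 (fun b => b.1 <> 0)).
  apply/seteqP; split => x.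
    move=> nr; apply: contrapT => /not_orP[h1 h2]; apply: nr; split.
      by move=> k; apply: contrapT => h; apply: h1; exists k.
    exact: contrapT.
  by case=> [[k _ h] [nx _]|h [_ x0]]; [exact: h|exact: h].
apply: nearW => w; apply: ae_and; first exact: quenched_near_step (KP w) (K_setT w) (muP w).
exact: quenched_start0 (KP w) (K_setT w) (muP w).
Qed.

Lemma integral_hit1 : (\int[annealed P K]_z hit1 R z.2 = \int[P]_w mean_hit w)%E.
Proof.
pose g (z : env R d * paths d) : \bar R := (\sum_(0 <= t <oo) (\1_(below (d:=d) t) z.2 : R)%:E)%E.
have mS t : measurable (setT `*` below t : set (env R d * paths d)).
  by apply: measurableX => //; exact: measurable_below.
have mt t : measurable_fun setT (fun z : env R d * paths d => (\1_(below (d:=d) t) z.2 : R)%:E).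
  apply/measurable_EFinP.
  by apply: (measurableT_comp (f := (\1_(below (d:=d) t) : paths d -> R)));
    [apply: measurable_indic; exact: measurable_below|exact: measurable_snd].
rewrite (@integral_ae_eq_all _ _ _ (annealed P K) _ g); first last.
- apply: ae_imp ae_annealed_start => z [nz z0]; exact: hit1_sum_below.
- apply: (@ge0_emeasurable_sum _ _ _ setT
    (fun t (z : env R d * paths d) => (\1_(below (d:=d) t) z.2 : R)%:E) xpredT) => [k x _ _|k _].
    by rewrite lee_fin.
  exact: mt.
- by move=> z; apply: nneseries_ge0 => t _ _; rewrite lee_fin.
rewrite /g (integral_nneseries (annealed P K) measurableT mt); last first.
  by move=> t z _; rewrite lee_fin.
rewrite /mean_hit (integral_nneseries P measurableT)//; last first.
  by move=> t; exact: (measurable_kernel K _ (measurable_below (d:=d) t)).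
apply: eq_eseriesr => t _.
rewrite -(annealed_rect P K measurableT (measurable_below t)).
rewrite -[X in annealed P K X]setIT -integral_indic//.
by apply: eq_integral => z _; rewrite !indicE in_setX in_setT.
Qed.

Lemma mean_hit_fin : {ae P, forall w, (mean_hit w < +oo)%E}.
Proof.
have ih : P.-integrable setT mean_hit.
  apply/integrableP; split; first exact: measurable_mean_hit.
  under eq_integral do rewrite gee0_abs ?mean_hit_ge0//.
  by rewrite -integral_hit1.
by apply: ae_imp (integrable_ae measurableT ih) => w /(_ I); rewrite ge0_fin_numE ?mean_hit_ge0.
Qed.

Lemma sum_K_below w t : (\sum_(0 <= s < t) K w (below (d:=d) s) =
  (\sum_i mu w 0 i * trunc_time w 1 t (0, i))%:E)%E.
Proof.
rewrite big_mkord (eq_bigr (fun s : 'I_t => (\sum_i mu w 0 i * survival w 1 s (0, i))%:E)); last first.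
  by move=> s _; rewrite K_below.
rewrite sumEFin; congr EFin; rewrite exchange_big; apply: eq_bigr => i _ /=.
by rewrite -mulr_sumr.
Qed.

(** The initial distribution charges every point of layer 0, so a finite mean under it
    is finite from each starting point. *)
Lemma mean_hit_bound w : (forall j, 0 < mu w 0 j) -> (mean_hit w < +oo)%E ->
  forall i, exists C : R, forall t, trunc_time w 1 t (0, i) <= C.
Proof.
move=> mpos hfin i; exists (fine (mean_hit w) / mu w 0 i) => t.
rewrite ler_pdivlMr// mulrC -lee_fin fineK; last by rewrite ge0_fin_numE ?mean_hit_ge0.
have : (\sum_(0 <= s < t) K w (below (d:=d) s) <= mean_hit w)%E.
  by apply: nneseries_lim_ge => n _ _; exact: measure_ge0.
apply: le_trans; rewrite sum_K_below lee_fin (bigD1 i)//= lerDl sumr_ge0// => j _.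
by rewrite mulr_ge0 ?trunc_time_ge0// ltW.
Qed.

(** Besides [base_ok] for all shifts, finite mean crossing times for all layers. *)
Definition env_ok (M N : nat) w : Prop := (forall n : int, base_ok M N (shiftn n w)) /\
  (forall n i, exists C : R, forall t, trunc_time w (n + 1) t (n, i) <= C).

Lemma env_ok_ae : exists M N, {ae P, forall w, env_ok M N w}.
Proof.
have [M [N h]] := base_ok_ae; exists M, N.
have h2 := ae_shiftn Pst mean_hit_fin.
apply: ae_imp (ae_and h h2) => w [b f]; split => // n i.
have [C hC] := mean_hit_bound (base_ok_mu_gt0 (b n)) (f n) i.
exists C => t; have := hC t; rewrite trunc_time_shiftn add0r addrC; exact.
Qed.

Section good_environment.
Context (M N : nat) (w : env R d).
Hypothesis wok : env_ok M N w.

Lemma env_ok_shiftn n : env_ok M N (shiftn n w).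
Proof.
have [b e] := wok; split=> [m|m i]; first by rewrite shiftnD.
have [C hC] := e (m + n) i; exists C => t.
by rewrite trunc_time_shiftn addrAC.
Qed.

Lemma ok_zeta : is_zeta w (zeta w).
Proof. by have [b _] := wok; have [] := b 0; rewrite shiftn0. Qed.

Lemma ok_base : base_ok M N w.
Proof. by have [b _] := wok; have := b 0; rewrite shiftn0. Qed.

Lemma ok_mu_gt0 n j : 0 < mu (shiftn n w) 0 j.
Proof. by have [b _] := wok; exact: base_ok_mu_gt0 (b n) j. Qed.

Lemma ok_forgets_future : forgets_future (zeta w).
Proof. by have [zP cP rec _] := ok_base; exact: (zeta_forgets_future zP rec). Qed.

Lemma ok_forgets_past : forgets_past (zeta w).
Proof. by have [zP cP rec _] := ok_base; exact: (zeta_forgets_past zP rec). Qed.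

Lemma y_series_mean_hit : y_series w (zeta w) (v w) = mean_hit w.
Proof.
have zP := ok_zeta; have [_ eb] := wok; have [_ _ _ mE] := ok_base.
have H1 : mean_hit w = (\sum_i mu w 0 i * uA_series w (zeta w) 0 i 0)%:E.
  apply/cvg_lim => //; rewrite (_ : (fun t => _) = fun t => (\sum_i mu w 0 i * trunc_time w 1 t (0, i))%:E).
    apply: cvg_EFin; first exact: nearW.
    apply: cvg_sumr => i; apply: cvgM; first exact: cvg_cst.
    by have := @trunc_time_cvg_uA_series _ _ w (zeta w) zP eb 0 i; rewrite add0r; exact.
  by apply/funext => t; exact: sum_K_below.
rewrite H1 /y_series -sumEFin; apply: eq_bigr => j _; rewrite -mE EFinM; congr (_ * _)%E.
apply/cvg_lim => //; rewrite (_ : (fun t => _) = fun t =>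
   (\sum_(l < t) (prodA_past w (zeta w) l *m vecu w (zeta w) (- l%:Z)) j 0)%:E).
  apply: cvg_EFin; first exact: nearW.
  exact: (@uA_series_past_cvg _ _ w (zeta w) zP eb j).
by apply/funext => t; rewrite big_mkord sumEFin.
Qed.

End good_environment.

Lemma zeta_shift M N w : env_ok M N w -> forall n, zeta (shiftn 1 w) n = zeta w (n + 1).
Proof.
move=> wok n; have wok1 := env_ok_shiftn wok 1; have [_ eb1] := wok1.
have -> // : zeta (shiftn 1 w) = fun n => zeta w (n + 1).
exact: (zeta_unique eb1 (ok_zeta wok1) (is_zeta_shiftn 1 (ok_zeta wok))).
Qed.

(** This is y_(-1) zeta_0 = y_0, where y_0 is the vector y_(-1) of the shifted
    environment. *)
Lemma mu_shift M N w : env_ok M N w -> mu w *m zeta w 0 = mu (shiftn 1 w).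
Proof.
move=> wok; have wok1 := env_ok_shiftn wok 1.
have [_ _ _ ->] := ok_base wok; have [_ _ _ ->] := ok_base wok1.
apply/esym/vecy_succ.
- by move=> n; exact: zeta_stochastic (ok_zeta wok) n.
- exact: ok_forgets_past wok.
- exact: ok_forgets_past wok1.
- exact: zeta_shift wok.
- exact: vP.
- exact: vP.
Qed.

Lemma K_restart M N w : env_ok M N w -> forall D, measurable D ->
  K w (restart (d:=d) @^-1` D) = K (shiftn 1 w) D.
Proof.
move=> wok D mD; have [_ eb] := wok.
apply: (restart_law (KP w) (K_setT w) (muP w) (KP (shiftn 1 w)) (K_setT _) (muP _)
  (ok_mu_gt0 wok 1) _ (mu_shift wok)) => // i k.
by have := @hit_prob1_cvg _ _ w (zeta w) (ok_zeta wok) eb 0 i k; rewrite add0r; exact.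
Qed.

Lemma K_regular M N w : env_ok M N w -> {ae K w, forall x, regular x}.
Proof.
move=> wok; have [_ eb] := wok.
have h1 := quenched_near_step (KP w) (K_setT w) (muP w).
have h2 := quenched_start0 (KP w) (K_setT w) (muP w).
have h3 : {ae K w, forall x, exists2 k, crosses_at x k & (x k).1 = 1}.
  apply: (crossing_ae (KP w) (K_setT w) (muP w) (KP (shiftn 1 w)) (K_setT _) (muP _)
    (ok_mu_gt0 wok 1) _ (mu_shift wok)) => // i k.
  by have := @hit_prob1_cvg _ _ w (zeta w) (ok_zeta wok) eb 0 i k; rewrite add0r; exact.
apply: ae_imp (ae_and h1 (ae_and h2 h3)) => x [nx [x0 [k _ xk]]]; split => //.
by exists k; rewrite xk.
Qed.

Let mK (D : set (paths d)) : measurable D -> measurable_fun setT (fun w => K w D).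
Proof. by move=> mD; exact: (measurable_kernel K _ mD). Qed.

Let K_fin w (D : set (paths d)) : measurable D -> K w D = (fine (K w D))%:E.
Proof.
move=> mD; rewrite fineK// ge0_fin_numE// (le_lt_trans _ (ltry 1))// -(K_setT w).
by apply: le_measure; rewrite ?inE.
Qed.

(** The dynamics that makes the crossing durations a stationary sequence. *)
Definition advance (z : env R d * paths d) : env R d * paths d :=
  (shiftn 1 z.1, restart z.2).

Lemma measurable_advance : measurable_fun setT advance.
Proof.
apply: measurable_fun_pair.
  exact: (measurableT_comp (@measurable_shiftn R d 1) (@measurable_fst _ _ _ _)).
exact: (measurableT_comp (@measurable_restart d) (@measurable_snd _ _ _ _)).
Qed.

Lemma advance_preserving (A : set (env R d * paths d)) : measurable A ->
  annealed P K (advance @^-1` A) = annealed P K A.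
Proof.
move=> mA; have [M [N hok]] := env_ok_ae.
have mf : measurable_fun setT (fun w => K w (xsection A w)).
  by apply: measurable_fun_xsection_finite_kernel; rewrite inE.
rewrite /annealed -(ge0_integral_preserving (@measurable_shiftn R d 1)
  (shiftn_preserving Pst 1) mf)//.
apply: integral_ae_eq_all => //.
  exact: (measurableT_comp mf (@measurable_shiftn R d 1)).
apply: ae_imp hok => w wok; rewrite -(K_restart wok); last exact: measurable_xsection.
by congr (K w _); apply/seteqP; split => x; rewrite /xsection/= !inE.
Qed.

Lemma iter_advance n z : (iter n advance z).2 = iter n (@restart d) z.2.
Proof. by elim: n => //= n ->. Qed.

Lemma ae_iter_regular :
  {ae annealed P K, forall z, forall n, regular (iter n (@restart d) z.2)}.
Proof.
have [M [N hok]] := env_ok_ae.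
have [B [mB B0 hB]] : {ae annealed P K, forall z, regular z.2}.
  apply: ae_annealed; first exact: measurable_regular.
  by apply: ae_imp hok => w wok; exact: K_regular wok.
apply: ae_foralln => n; exists (iter n (fun D => advance @^-1` D) B).
have [mBn Bn0] : measurable (iter n (fun D => advance @^-1` D) B) /\
    annealed P K (iter n (fun D => advance @^-1` D) B) = 0%E.
  elim: n => [//|n [mBn Bn0]] /=; split.
    by rewrite -[X in measurable X]setTI; exact: measurable_advance.
  by rewrite advance_preserving.
split => // z /= h; have : ~ regular (iter n advance z).2 by rewrite iter_advance.
move=> /hB; clear; elim: n z => //= n IH z h; apply: IH.
by rewrite -iterSr.
Qed.

Section zero_one.
Context (A : set (paths d)) (mA : measurable A).
Hypothesis Ainv : forall n a x, A (recenter n a x) <-> A x.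

Let m0 j : measurable [set x : paths d | x 0%N = (0 : int, j)].
Proof. exact: (measurable_coord 0 (fun b => b = _)). Qed.

Let preA n a : recenter n a @^-1` A = A.
Proof. by apply/seteqP; split => x h; apply/(Ainv n a x). Qed.

Let start j : [set x : paths d | x 0%N = (0 : int, j)] = cyl 0 (fun=> (0 : int, j)).
Proof.
apply/seteqP; split => x /= h; last exact: h.
by move=> k; rewrite leqn0 => /eqP ->.
Qed.

(** The conditional probability of A for the walk started at b. By translation it is
    read off in the environment shifted so that b lies in layer 0; dividing by the
    initial weight conditions on the starting point. *)
Definition prob_from w (b : state d) : R :=
  fine (K (shiftn b.1 w) (A `&` [set x | x 0%N = (0 : int, b.2)])) / mu (shiftn b.1 w) 0 b.2.

(** A does not depend on the initial segment, so the Markov property gives its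
    conditional probability. *)
Lemma prob_from_markov w : (forall n j, 0 < mu (shiftn n w) 0 j) -> forall n s,
  K w (cyl n s `&` A) = (K w (cyl n s) * (prob_from w (s n))%:E)%E.
Proof.
move=> mpos n s.
have := markov_property (KP w) (KP (shiftn (s n).1 w)) (K_setT _) (ltW (mpos _ _))
  (surjective_pairing (s n)) mA.
rewrite preA (K_fin _ (measurableI _ _ (measurable_cyl n s) mA)).
rewrite (quenched_cyl_fin n s (KP w)) (K_fin _ (measurableI _ _ mA (m0 _))).
rewrite -!EFinM => -[] E; congr EFin.
by rewrite /prob_from mulrA -E mulfK// gt_eqF.
Qed.

Lemma prob_from01 w : (forall n j, 0 < mu (shiftn n w) 0 j) -> forall a, 0 <= prob_from w a <= 1.
Proof.
move=> mpos a; rewrite /prob_from; apply/andP; split.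
  by rewrite divr_ge0 ?fine_ge0//; exact: ltW (mpos _ _).
rewrite ler_pdivrMr// mul1r -lee_fin -K_fin; last exact: measurableI.
have -> : (mu (shiftn a.1 w) 0 a.2)%:E = K (shiftn a.1 w) (cyl 0 (fun=> (0 : int, a.2))).
  by rewrite (quenched_cylE _ _ (KP _)) big_ord0 mulr1.
rewrite -start; apply: le_measure; rewrite ?inE//.
exact: measurableI.
Qed.

Lemma prob_from_shift w m b : prob_from (shiftn m w) b = prob_from w (b.1 + m, b.2).
Proof. by rewrite /prob_from shiftnD. Qed.

Lemma step_prob_from w : (forall n j, 0 < mu (shiftn n w) 0 j) ->
  forall a, step w (prob_from w) a = prob_from w a.
Proof.
move=> mpos a; pose w' := shiftn a.1 w.
have mpos' n j : 0 < mu (shiftn n w') 0 j by rewrite /w' shiftnD.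
pose b0 : state d := (0 : int, a.2).
have h1 := quenched_step (KP w') (K_setT w') 0 (fun=> b0) mA.
have h2 : K w' (cyl 0 (fun=> b0) `&` A) = (mu w' 0 a.2 * prob_from w a)%:E.
  rewrite (prob_from_markov mpos') (quenched_cylE _ _ (KP _)) big_ord0 mulr1 -EFinM.
  by rewrite prob_from_shift/= add0r -surjective_pairing.
have h3 : (\sum_p K w' (cyl 1 (extend 0 (fun=> b0) (nbr b0 p)) `&` A) =
    (mu w' 0 a.2 * step w (prob_from w) a)%:E)%E.
  rewrite step_nbr mulr_sumr -sumEFin; apply: eq_bigr => p _.
  rewrite (prob_from_markov mpos') (quenched_extend (KP _)) extend_last.
  rewrite (quenched_cylE _ _ (KP _)) big_ord0 mulr1 -!EFinM -mulrA; congr EFin.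
  congr (_ * (_ * _)).
    rewrite trans_shiftn /nbr/= add0r -surjective_pairing; congr trans.
    by congr pair; ring.
  by rewrite prob_from_shift /nbr/=; congr (prob_from w (_, _)); ring.
move: h1; rewrite h2 h3 => -[] /(mulfI _) -> //.
by rewrite gt_eqF// /w'; have := mpos a.1 a.2.
Qed.

(** Constancy of [prob_from] makes A independent of all cylinders, hence of all
    events, in particular of itself. *)
Lemma K_zero_one M N w : env_ok M N w ->
  (K w A = 0%E \/ K w A = 1%E) /\ forall n, K (shiftn n w) A = K w A.
Proof.
move=> wok; have mpos := ok_mu_gt0 wok; have [_ eb] := wok.
pose F := prob_from w (0, ord0).
have hF a : prob_from w a = F.
  by apply: (harmonic_const (ok_zeta wok) eb (ok_forgets_future wok) (prob_from01 mpos) (step_prob_from mpos)).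
have cylF w' n s : (forall n j, 0 < mu (shiftn n w') 0 j) -> (forall a, prob_from w' a = F) ->
    K w' (cyl n s `&` A) = (K w' (cyl n s) * F%:E)%E.
  by move=> mp hF'; rewrite (prob_from_markov mp) hF'.
have F0 : 0 <= F by have /andP[] := prob_from01 mpos (0, ord0).
have all w' : (forall n j, 0 < mu (shiftn n w') 0 j) -> (forall a, prob_from w' a = F) ->
    forall D, measurable D -> K w' (D `&` A) = (F%:E * K w' D)%E.
  move=> mp hF' D mD.
  apply: (@paths_measure_unique R d (mrestr (K w') mA) (mscale (NngNum F0) (K w'))) => //.
    by move=> n s; rewrite /= /mrestr /mscale /= cylF// muleC.
  by rewrite /= /mrestr setTI (K_fin _ mA) ltry.
have KF w' : (forall n j, 0 < mu (shiftn n w') 0 j) -> (forall a, prob_from w' a = F) -> K w' A = F%:E.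
  by move=> mp hF'; rewrite -[A]setTI (all w' mp hF')// K_setT mule1.
split; last first.
  move=> n; rewrite (KF w)// KF// => [m j|a]; first by rewrite shiftnD.
  by rewrite prob_from_shift.
have := all w mpos hF A mA; rewrite setIid (KF w mpos hF) -EFinM => -[] E.
have /eqP : F * (1 - F) = 0 by rewrite mulrBr mulr1 -E subrr.
by rewrite mulf_eq0 subr_eq0 => /orP[/eqP ->|/eqP <-]; [left|right].
Qed.

(** The quenched probability of A is 0 or 1 and shift-invariant, so its value is
    almost surely constant by ergodicity. *)
Lemma invariant_zero_one :
  {ae annealed P K, forall z, ~ A z.2} \/ {ae annealed P K, forall z, A z.2}.
Proof.
have [M [N hok]] := env_ok_ae; have [erg _ _ _] := PC.
pose B : set (env R d) := [set w | K w A = 1%E].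
have mB : measurable B.
  rewrite (_ : B = (fun w => K w A) @^-1` [set 1%E]); last by [].
  rewrite -[X in measurable X]setTI; exact: (mK mA).
have [PB|PB] := ltP 0%E (P B).
  right.
  have hB : {ae P, forall w, B w}.
    apply: (invariant_ae Pst erg mB _ PB).
    apply: ae_imp hok => w wok n; rewrite /B/=.
    by have [_ ->] := K_zero_one wok.
  apply: (@ae_annealed A); first exact: measurableC.
  apply: ae_imp hB => w Bw; exists (~` A); split => //; first exact: measurableC.
  have -> : K w (~` A) = (K w setT - K w (setT `&` A))%E.
    rewrite -setTD; apply: measureD => //.
    by rewrite [X in (X < _)%E]K_setT ltry.
  by rewrite setTI K_setT Bw subee.
left; apply: (@ae_annealed (fun x => ~ A x)).
  rewrite (_ : [set x | _] = A)//; apply/seteqP; split => x /=; first exact: contrapT.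
  by move=> Ax; apply.
have hB : {ae P, forall w, ~ B w}.
  exists B; split => //; last by move=> w /contrapT.
  by apply/eqP; rewrite eq_le PB measure_ge0.
apply: ae_imp (ae_and hok hB) => w [wok nB]; exists A; split => //; last by move=> x /contrapT.
by have [[//|h] _] := K_zero_one wok; case: nB.
Qed.

End zero_one.

Let E : R := fine (\int[annealed P K]_z hit1 R z.2)%E.

Lemma hit1_ge0 (x : paths d) : (0 <= hit1 R x)%E.
Proof. by apply: le_ereal_inf_tmp => _ [t _ <-]; rewrite lee_fin. Qed.

Lemma integral_hit1_fin : (\int[annealed P K]_z hit1 R z.2 = E%:E)%E.
Proof. by rewrite fineK// ge0_fin_numE// integral_ge0// => z _; exact: hit1_ge0. Qed.

Let T1 (z : env R d * paths d) : R := (tau z.2)%:R.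

Let mT1 : measurable_fun setT T1.
Proof. exact: (measurableT_comp (@measurable_tau R d) (@measurable_snd _ _ _ _)). Qed.

Lemma integral_tau : (\int[annealed P K]_z (T1 z)%:E = E%:E)%E.
Proof.
rewrite -integral_hit1_fin; apply/esym/integral_ae_eq_all.
- by move=> z; rewrite lee_fin.
- exact/measurable_EFinP.
by apply: ae_imp ae_iter_regular => z /(_ 0%N) rz; exact: hit1_regular.
Qed.

Lemma integrable_tau : (annealed P K).-integrable setT (EFin \o T1).
Proof.
apply/integrableP; split; first exact/measurable_EFinP.
under eq_integral do rewrite /= ger0_norm//.
by rewrite integral_tau ltry.
Qed.

Lemma integrable_const_annealed (c : R) : (annealed P K).-integrable setT (EFin \o (fun=> c)).
Proof. by apply: finite_measure_integrable_cst. Qed.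

Lemma mean_ge1 : 1 <= E.
Proof.
rewrite -lee_fin -integral_tau.
have <- : (\int[annealed P K]_z 1%:E = 1)%E.
  rewrite (integral_cst (annealed P K) measurableT) mul1e.
  exact: probability_setT.
apply: ae_ge0_le_integral => //.
- by move=> z _; rewrite lee_fin.
- exact/measurable_EFinP.
by apply: ae_imp ae_iter_regular => z /(_ 0%N) rz _; rewrite lee_fin ler1n tau_gt0.
Qed.

Lemma birkhoff_affine (s c : R) n z :
  birkhoff_sum advance (fun z => s * T1 z + c) n z = s * (crossing_time n z.2)%:R + c * n%:R.
Proof.
elim: n z => [|n IH] z /=; first by rewrite !mulr0 addr0.
by rewrite IH /= natrD -natr1 /T1; ring.
Qed.

(** The maximal ergodic lemma for s T_1 + c and the map [advance]: the Birkhoff sums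
    are s T_n + c n. *)
Lemma affine_mean_ge0 (s c : R) :
  {ae annealed P K, forall z, exists n, 0 < s * (crossing_time n z.2)%:R + c * n%:R} ->
  0 <= s * E + c.
Proof.
move=> h; have i1 : (annealed P K).-integrable setT (EFin \o (fun z => s * T1 z)).
  exact: (integrableZl measurableT s integrable_tau).
have i2 := integrable_const_annealed c.
have ii : (annealed P K).-integrable setT (EFin \o (fun z => s * T1 z + c)).
  exact: (integrableD measurableT i1 i2).
have := @maximal_ergodic _ _ R (annealed P K) advance measurable_advance
  advance_preserving _ ii.
have h' : {ae annealed P K, forall z, exists n, 0 < birkhoff_sum advance (fun z => s * T1 z + c) n z}.
  by apply: ae_imp h => z [n hn]; exists n; rewrite birkhoff_affine.
move=> /(_ h').
pose g1 z : R := s * T1 z; pose g2 (z : env R d * paths d) : R := c.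
have -> : (\int[annealed P K]_x ((g1 x + g2 x)%R)%:E = (s * E + c)%R%:E)%E.
  rewrite (integralD_EFin measurableT i1 i2) EFinD; congr (_ + _)%E.
    have := integralZl measurableT integrable_tau s.
    by rewrite integral_tau -EFinM.
  rewrite (integral_cst (annealed P K) measurableT) [X in (_ * X)%E](_ : _ = 1%E) ?mule1//.
  exact: probability_setT.
by rewrite lee_fin.
Qed.

Lemma ae_not_slow (c : R) : E < c -> {ae annealed P K, forall z, ~ slow c z.2}.
Proof.
move=> Ec; have c0 : 0 <= c by have := mean_ge1; lra.
have [//|h] := invariant_zero_one (measurable_slow c) (recenter_slow c).
have : 0 <= 1 * E + - c; last lra.
apply: affine_mean_ge0; apply: ae_imp (ae_and h ae_iter_regular) => z [sz rz].
have [n hn] := slow_crossing c0 rz sz; exists n; lra.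
Qed.

Lemma ae_not_fast (c : R) : 0 < c < E -> {ae annealed P K, forall z, ~ fast c z.2}.
Proof.
move=> /andP[c0 Ec].
have [//|h] := invariant_zero_one (measurable_fast c) (recenter_fast c).
have : 0 <= -1 * E + c; last lra.
apply: affine_mean_ge0; apply: ae_imp (ae_and h ae_iter_regular) => z [sz rz].
have [n hn] := fast_crossing c0 rz sz; exists n; lra.
Qed.

Lemma integral_y_series : (\int[P]_w y_series w (zeta w) (v w) = E%:E)%E.
Proof.
have [M [N hok]] := env_ok_ae.
rewrite -integral_hit1_fin integral_hit1; apply: integral_ae_eq_all.
- exact: mean_hit_ge0.
- exact: measurable_mean_hit.
by apply: ae_imp hok => w wok; exact: y_series_mean_hit wok.
Qed.

Lemma speed_ae : {ae annealed P K, forall z : env R d * paths d,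
  ((xi z.2 n)%:~R / n%:R : R)%:E @[n --> \oo]
    --> ((\int[P]_w y_series w (zeta w) (v w))^-1)%E}.
Proof.
have E1 := mean_ge1.
have hs : {ae annealed P K, forall z, forall n : nat, ~ slow (E + n.+2%:R^-1) z.2}.
  by apply: ae_foralln => n; apply: ae_not_slow; rewrite ltrDl invr_gt0.
have hf : {ae annealed P K, forall z, forall n : nat, ~ fast (E - n.+2%:R^-1) z.2}.
  apply: ae_foralln => n; apply: ae_not_fast; rewrite ltrBlDr ltrDl invr_gt0 ltr0n andbT.
  by rewrite subr_gt0 (lt_le_trans _ E1)// invf_lt1// ltr1n.
apply: ae_imp (ae_and ae_iter_regular (ae_and hs hf)) => z [/(_ 0%N)[nz _ _] [sz fz]].
rewrite integral_y_series inver gt_eqF; last lra.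
apply: cvg_EFin; first exact: nearW.
exact: speed_limit.
Qed.

End environment_facts.

Theorem corollary1p4 (R : realType) (d : nat)
  (P : probability (env R d) R)
  (P_stationary : stationary P)
  (P_conditionC : conditionC P)
  (zeta : env R d -> int -> 'M[R]_d.+1)
  (zetaP : {ae P, forall w, is_zeta w (zeta w)})
  (zeta_lyapunov : lyapunov_neg P zeta)
  (v : env R d -> int -> 'rV[R]_d.+1)
  (vP : forall w a, probvec (v w a))
  (mu : env R d -> 'rV[R]_d.+1)
  (muP : forall w, probvec (mu w))
  (mu_y : {ae P, forall w, mu w = vecy (zeta w) (v w) (-1)})
  (K : R.-pker env R d ~> paths d)
  (KP : forall w, is_quenched_law w (mu w) (K w))
  (X_transient : transient_right P K)
  (vp_gt0 : (0 < speed P K)%E) :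
  {ae annealed P K, forall z : env R d * paths d,
    ((xi z.2 n)%:~R / n%:R : R)%:E @[n --> \oo]
    --> ((\int[P]_w y_series w (zeta w) (v w))^-1)%E}.
Proof.
have hit_fin : (\int[annealed P K]_z hit1 R z.2 < +oo)%E.
  rewrite ltey; apply/eqP => h; move: vp_gt0.
  by rewrite /speed h invey ltxx.
exact: (speed_ae P_stationary P_conditionC zetaP vP muP mu_y KP hit_fin).
Qed.
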